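(* Let $k,l\ge1$ be integers, $\mu>0$, $\lambda_1,\dots,\lambda_l>0$, $\Lambda=\sum_{m=1}^l\lambda_m$, $c_m=\lambda_m/\Lambda$, $\theta>0$, $\alpha\in(0,1)$, $\beta=\theta^\alpha-\Lambda-k\mu$. The mean queue length of the tempered Erlang queue with multiple arrivals is, for $t\ge0$, \begin{align*} \mathcal{M}^{\theta,\alpha}(t)&=k\Big(\Lambda\sum_{i=1}^{l}ic_{i}-\mu\Big)e^{-\theta t}\sum_{q=0}^{\infty}\theta^q t^{q+\alpha}E_{\alpha,\alpha+q+1}(\theta^\alpha t^\alpha)\\ &\quad+k\mu \sum_{h=1}^{\infty}\sum_{n=0}^{\infty}\sum_{\substack{\mathbf m\in\mathbb N_0^l\\ m_1+\dots+m_l=n}}C_{h,n}^{0}(\mathbf{m})e^{-\theta t} \sum_{q=0}^{\infty}\theta^q t^{\beta_{h,n}^{\mathcal{M}}(\mathbf{m})+q-1}E_{\alpha,\beta_{h,n}^{\mathcal{M}}(\mathbf{m})+q}^{\gamma_{h,n}^{0}(\mathbf{m})}(\beta t^{\alpha}), \end{align*} where $\beta_{h,n}^{\mathcal{M}}(\mathbf{m})=\alpha\gamma_{h,n}^{0}(\mathbf{m})+1$.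
   Context: Erlang queue with multiple arrivals: $\{\mathcal{Q}(t)\}_{t\ge0}$ is the continuous-time Markov chain on $\{(0,0)\}\cup S$, $S=\{(n,s)\in\mathbb{N}\times\mathbb{N}: n\ge1,\ 1\le s\le k\}$, started at $(0,0)$, with transition rates: $(0,0)\to(m,k)$ at rate $\lambda_m$; $(n,s)\to(n+m,s)$ at rate $\lambda_m$ ($m=1,\dots,l$); $(n,s)\to(n,s-1)$ at rate $k\mu$ for $s\ge2$; $(n,1)\to(n-1,k)$ at rate $k\mu$ for $n\ge2$; $(1,1)\to(0,0)$ at rate $k\mu$. Let $D_{\theta,\alpha}$ be the subordinator with $\mathbb{E}e^{-sD_{\theta,\alpha}(t)}=e^{-t((s+\theta)^\alpha-\theta^\alpha)}$, $Y_{\theta,\alpha}(t)=\inf\{x>0:D_{\theta,\alpha}(x)>t\}$ independent of $\mathcal Q$, $\mathcal{Q}^{\theta,\alpha}(t)=\mathcal{Q}(Y_{\theta,\alpha}(t))$. Queue length: $\mathcal{L}^{\theta,\alpha}(t)=g_k(\mathcal{Q}^{\theta,\alpha}(t))$ with $g_k(n,s)=k(n-1)+s$, $g_k(0,0)=0$; $\mathcal{M}^{\theta,\alpha}(t)=\mathbb{E}(\mathcal{L}^{\theta,\alpha}(t)\mid\mathcal{L}^{\theta,\alpha}(0)=0)$. Notation: $\gamma_{h,n}^{0}(\mathbf{m})=h+n+k\sum_{j=1}^{l}jm_{j}$, $C_{h,n}^{0}(\mathbf{m})=h\Lambda^{n}\Big(\prod_{i=1}^{l}\frac{c_{i}^{m_{i}}}{m_{i}!}\Big)\frac{(k\mu)^{\gamma_{h,n}^{0}(\mathbf{m})-n-1}}{(\gamma_{h,n}^{0}(\mathbf{m})-n)!}(\gamma_{h,n}^{0}(\mathbf{m})-1)!$.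 Mittag-Leffler functions: $E_{\alpha,b}^{\gamma}(x)=\frac{1}{\Gamma(\gamma)}\sum_{j\ge0}\frac{\Gamma(j+\gamma)x^j}{j!\Gamma(\alpha j+b)}$ and $E_{\alpha,b}(x)=E^1_{\alpha,b}(x)$. *)

(* Defs.v *)
From HB Require Import structures.
From mathcomp Require Import all_boot all_order all_algebra.
From mathcomp Require Import all_classical all_reals all_analysis.
Set Implicit Arguments. Unset Strict Implicit. Unset Printing Implicit Defensive.
Import Order.TTheory GRing.Theory Num.Theory.
Import numFieldNormedType.Exports.
Local Open Scope classical_set_scope.
Local Open Scope ring_scope.

Section ErlangDefs.
Context {R : realType}.

Definition Gamma (s : R) : R :=
  fine (\int[@lebesgue_measure R]_(x in `]0%R, +oo[%classic)
          (powR x (s - 1) * expR (- x))%:E)%E.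

Definition ML3 (g a b x : R) : R :=
  (limn (fun N => \sum_(j < N)
     Gamma (j%:R + g) * x ^+ j / ((j`!)%:R * Gamma (a * j%:R + b))))
  / Gamma g.

Definition ML2 (a b x : R) : R := ML3 1 a b x.

(* states: (0,0) and (n,s) with n >= 1, 1 <= s <= k; other pairs of nat
   are unreachable and have no outgoing transitions *)
Definition state := (nat * nat)%type.

Definition Lam (l : nat) (lam : nat -> R) : R := \sum_(1 <= m < l.+1) lam m.

Definition rate (k l : nat) (lam : nat -> R) (mu : R) (x y : state) : R :=
  if x == (0%N, 0%N) then
    (if (y.2 == k) && (1 <= y.1 <= l)%N then lam y.1 else 0)
  else if [&& (1 <= x.1)%N, (1 <= x.2)%N & (x.2 <= k)%N] then
    (if (y.2 == x.2) && (x.1 < y.1 <= x.1 + l)%N then lam (y.1 - x.1)%N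
     else if (2 <= x.2)%N && (y == (x.1, x.2.-1)) then k%:R * mu
     else if [&& x.2 == 1%N, (2 <= x.1)%N & y == (x.1.-1, k)] then k%:R * mu
     else if (x == (1%N, 1%N)) && (y == (0%N, 0%N)) then k%:R * mu
     else 0)
  else 0.

(* total outgoing rate: every target y of x satisfies y.1 <= x.1 + l, y.2 <= k *)
Definition qout k l lam mu (x : state) : R :=
  \sum_(a < x.1 + l + 1) \sum_(b < k.+1) rate k l lam mu x (a : nat, b : nat).

Definition gen k l lam mu (x y : state) : R :=
  if x == y then - qout k l lam mu x else rate k l lam mu x y.

(* row vector times generator: (v G)(y) = sum_x v(x) G(x,y); the only x with
   G(x,y) <> 0 satisfy x.1 <= y.1 + 1 and x.2 <= k, so the finite sum below
   is the full (countable) sum. *)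
Definition fstep k l lam mu (v : state -> R) (y : state) : R :=
  \sum_(a < y.1 + 2) \sum_(b < k.+1) v (a : nat, b : nat) * gen k l lam mu (a : nat, b : nat) y.

Definition dirac_st (x : state) : state -> R := fun y => (y == x)%:R.

(* transition function P(t) = exp(t G):  P_t(x,y) = sum_j t^j/j! (G^j)(x,y) *)
Definition ptrans k l lam mu (t : R) (x y : state) : R :=
  limn (fun N => \sum_(j < N)
     t ^+ j / (j`!)%:R * iter j (fstep k l lam mu) (dirac_st x) y).

Definition gk (k : nat) (x : state) : nat :=
  if x == (0%N, 0%N) then 0%N else (k * (x.1 - 1) + x.2)%N.

Definition fdd_event {T : Type} (Q : R -> T -> state) (ts : seq R) (xs : seq state)
  : set T := [set w | forall i, (i < size ts)%N -> Q (nth 0 ts i) w = nth (0%N,0%N) xs i].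

Definition is_erlang_chain k l lam mu {d} {T : measurableType d}
    (P : probability T R) (Q : R -> T -> state) : Prop :=
  [/\ (forall t y, measurable [set w | Q t w = y]),
      (forall w t, 0 <= t -> exists2 e : R, 0 < e &
          forall s, t <= s < t + e -> Q s w = Q t w) &
      (forall (ts : seq R) (xs : seq state),
          size ts = size xs -> path <=%R 0 ts ->
          P (fdd_event Q ts xs) =
          (\prod_(i < size ts)
             ptrans k l lam mu (nth 0 ts i - nth 0 (0 :: ts) i)
                    (nth (0%N,0%N) ((0%N,0%N) :: xs) i) (nth (0%N,0%N) xs i))%:E)].

(* D is a subordinator with Laplace exponent psi(s) = (s+theta)^alpha - theta^alpha:
   D(0)=0, nondecreasing right-continuous paths, and its increments over
   consecutive intervals are independent and stationary with
   E exp(-s (D(t+h)-D(t))) = exp(-h psi(s)); this is encoded by the joint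
   Laplace transform of the increments. *)
Definition tempered_psi (theta alpha s : R) : R :=
  powR (s + theta) alpha - powR theta alpha.

Definition is_tempered_subordinator (theta alpha : R) {d} {T : measurableType d}
    (P : probability T R) (D : R -> T -> R) : Prop :=
  [/\ (forall t, measurable_fun setT (D t)),
      (forall w, D 0 w = 0),
      (forall w s t, 0 <= s -> s <= t -> D s w <= D t w),
      (forall w t, 0 <= t -> (D ^~ w) @ at_right t --> D t w) &
      (forall (ts us : seq R), size ts = size us -> path <=%R 0 ts ->
          all (fun u => 0 <= u) us ->
          (\int[P]_w (expR (- \sum_(i < size ts)
               nth 0 us i * (D (nth 0 ts i) w - D (nth 0 (0 :: ts) i) w)))%:E)%E
          = (\prod_(i < size ts)
               expR (- (nth 0 ts i - nth 0 (0 :: ts) i)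
                       * tempered_psi theta alpha (nth 0 us i)))%:E)].

(* independence of the processes Q and D (on the pi-systems of
   finite-dimensional cylinder events, which generate their sigma-algebras) *)
Definition indep_processes {d} {T : measurableType d} (P : probability T R)
    (Q : R -> T -> state) (D : R -> T -> R) : Prop :=
  forall (ts : seq R) (xs : seq state) (ss : seq R) (Bs : seq (set R)),
    (forall B, B \in Bs -> measurable B) ->
    let EQ := fdd_event Q ts xs in
    let ED := [set w | forall i, (i < size ss)%N -> nth setT Bs i (D (nth 0 ss i) w)] in
    P (EQ `&` ED) = (P EQ * P ED)%E.

Definition inv_sub {T : Type} (D : R -> T -> R) (t : R) (w : T) : R :=
  inf [set x | 0 < x /\ t < D x w].

Definition mean_queue (k : nat) {d} {T : measurableType d} (P : probability T R)
    (Q : R -> T -> state) (D : R -> T -> R) (t : R) : \bar R :=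
  (\int[P]_w ((gk k (Q (inv_sub D t w) w))%:R)%:E)%E.

Definition gamma0 (k l : nat) (h n : nat) (m : 'I_l -> nat) : nat :=
  (h + n + k * \sum_(i < l) i.+1 * m i)%N.

Definition C0 (k l : nat) (lam : nat -> R) (mu : R) (h n : nat) (m : 'I_l -> nat) : R :=
  let g := @gamma0 k l h n m in
  h%:R * Lam l lam ^+ n
  * (\prod_(i < l) ((lam i.+1 / Lam l lam) ^+ (m i) / ((m i)`!)%:R))
  * (k%:R * mu) ^+ (g - n - 1) / ((g - n)`!)%:R * ((g - 1)`!)%:R.

Arguments gamma0 : clear implicits.
Arguments C0 : clear implicits.

Definition M_formula (k l : nat) (lam : nat -> R) (mu theta alpha t : R) : R :=
  let L := Lam l lam in
  let beta := powR theta alpha - L - k%:R * mu in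
  k%:R * (L * (\sum_(i < l) i.+1%:R * (lam i.+1 / L)) - mu) * expR (- theta * t)
    * limn (fun Nq => \sum_(q < Nq) theta ^+ q * powR t (q%:R + alpha)
              * ML2 alpha (alpha + q%:R + 1) (powR theta alpha * powR t alpha))
  + k%:R * mu *
    limn (fun H => \sum_(1 <= h < H)
      limn (fun N => \sum_(n < N)
        \sum_(m : {ffun 'I_l -> 'I_n.+1} | (\sum_(i < l) (m i : nat) == n)%N)
          let g := gamma0 k l h n (fun i => m i : nat) in
          let bM := alpha * g%:R + 1 in
          C0 k l lam mu h n (fun i => m i : nat) * expR (- theta * t)
          * limn (fun Nq => \sum_(q < Nq) theta ^+ q * powR t (bM + q%:R - 1)
                   * ML3 g%:R alpha (bM + q%:R) (beta * powR t alpha)))).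

End ErlangDefs.

(* Main.v *)
(* Adding k mu to the diagonal of the generator makes every state serve at rate k mu, so that
   with q = Lambda + k mu the queue length is a walk on the naturals, reflected at 0 and run at
   the times of a Poisson process of rate q; its mean at time u differs from a linear function
   of u by k mu times the time spent at 0.  If W_i is the weight of the i-step walks from 0 to
   0, then p_0(u) = e^(-q u) sum_i W_i u^i / i!, and a down-step of the reflected walk taken at 0
   is a first passage of the free skip-free walk, so that Kemperman's (ballot) formula and the
   multinomial theorem turn W_i into the sum of the coefficients C0 over the triples with
   gamma = i + 1.

   Since the inverse subordinator Y is independent of the chain, u may be replaced by Y(t) and
   averaged, which leaves the moments
   G_(nu, g)(t) = E int_0^Y(t) u^g / g! e^(-nu u) du = int_0^oo u^g / g! e^(-nu u) P(D_u <= t) du.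
   The Laplace transform of G_(nu, g) is computed from that of D_u.  It agrees with the
   transform of the Mittag-Leffler series, after the powers of beta = theta^alpha - nu are split
   into positive and negative parts so that all interchanges concern nonnegative terms, and both
   sides are right-continuous, hence equal. *)
Require Import Defs.
From HB Require Import structures.
From mathcomp Require Import all_boot all_order all_algebra.
From mathcomp Require Import ring lra zify.
From mathcomp Require Import all_classical all_reals all_analysis.
From mathcomp Require Import measurable_realfun.
Set Implicit Arguments. Unset Strict Implicit. Unset Printing Implicit Defensive.
Import Order.TTheory GRing.Theory Num.Theory.
Import numFieldNormedType.Exports.
Local Open Scope classical_set_scope.
Local Open Scope ring_scope.

(** * First passages of a skip-free walk *)

(** Two features of the statement shape the proof. [ptrans] is a signed power series, and the
    formula contains iterated [limn], which say nothing about sequences that diverge; besides,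
    integrability of the queue length is not known beforehand. Sums and integrals are therefore
    taken over nonnegative terms in the extended reals, where interchanges are free, and a negative
    contribution is carried to the other side of its equation: the service term [c * u] stands next
    to the mean, the negative part of the Mittag-Leffler series next to the moment. Subtraction
    comes last, when finiteness is known.

    Finiteness has two sources. On the probabilistic side it is the exponential decay of P(D_u <= t)
    in u, which bounds E Y(t) and, as W_i <= q^i, the series over the return weights. On the
    analytic side it is the Laplace transform at a large argument, which bounds the series at every
    t because they are monotone in t.

    Indicators of D_u <= t are continuous from the right only, so uniqueness of the transform and
    the time change both work to the right of a point. *)

Lemma multinomial_coef (K : numFieldType) (A : comAlgType K) (I : Type)
    (r : seq I) (a : I -> A) (n c : nat) : (c <= n)%N ->
  (\prod_(i <- r) \poly_(j < n.+1) ((j`!)%:R^-1 *: a i ^+ j))`_c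
  = (c`!)%:R^-1 *: (\sum_(i <- r) a i) ^+ c.
Proof.
(* The factors are exponential series truncated at degree n, which does not affect the coefficients
   c <= n; the induction step is the binomial theorem. *)
elim: r c => [|i r IH] c cn.
  rewrite !big_nil coef1; case: c cn => [|c] _ /=.
    by rewrite expr0 fact0 invr1 scale1r.
  by rewrite expr0n /= scaler0.
rewrite !big_cons coefM exprDn scaler_sumr [RHS](reindex_inj rev_ord_inj) /=.
apply: eq_bigr => j _.
have jc : (j <= c)%N by rewrite -ltnS.
rewrite coef_poly ifT; last by rewrite ltnS (leq_trans jc).
rewrite IH; last by rewrite (leq_trans _ cn)// leq_subr.
rewrite subSS subKn//.
have sM (x y : K) (u v : A) : (x *: u) * (y *: v) = (x * y) *: (u * v).
  by rewrite -scalerAl -scalerAr; exact: scalerA.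
have sN (x : K) (v : A) m : x *: (v *+ m) = (x * m%:R) *: v.
  by rewrite -scaler_nat; exact: scalerA.
rewrite sM bin_sub// sN; congr (_ *: _).
have : ('C(c, j) * (j`! * (c - j)`!))%:R = c`!%:R :> K by rewrite bin_fact.
rewrite !natrM => <-.
have f0 m : (m`!)%:R != 0 :> K by rewrite pnatr_eq0 -lt0n fact_gt0.
have b0 : 'C(c,j)%:R != 0 :> K by rewrite pnatr_eq0 -lt0n bin_gt0.
by field; rewrite b0 !f0.
Qed.

(** Expanding the product of sums in [multinomial_coef] over all choices of exponents leaves, in
    degree n, the exponent vectors of sum n. It is needed over polynomials, where each [a i] is the
    monomial of a jump. *)
Lemma multinomial_thm (K : numFieldType) (A : comAlgType K) (l n : nat)
    (a : 'I_l -> A) :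
  (\sum_i a i) ^+ n = \sum_(m : {ffun 'I_l -> 'I_n.+1} | (\sum_i (m i : nat) == n)%N)
    ((n`!)%:R / \prod_i ((m i)`!)%:R) *: \prod_i a i ^+ m i.
Proof.
have f0 m : (m`!)%:R != 0 :> K by rewrite pnatr_eq0 -lt0n fact_gt0.
have := multinomial_coef (index_enum 'I_l) a (leqnn n).
move/(congr1 (fun x => (n`!)%:R *: x)); rewrite scalerA divff// scale1r => <-.
under eq_bigr do rewrite poly_def.
rewrite bigA_distr_bigA /= coef_sum scaler_sumr [RHS]big_mkcond /=.
apply: eq_bigr => m _.
under eq_bigr do rewrite -mul_polyC.
rewrite big_split /= -(big_morph (fun p : A => p%:P) (@polyCM _) (erefl : 1%:P = 1)).
rewrite coefCM.
have -> : \prod_i 'X^(m i) = 'X^(\sum_i m i) :> {poly A}.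
  by rewrite (big_morph _ (exprD 'X) (expr0 'X)).
rewrite coefXn eq_sym; case: ifP => [_|_]; last by rewrite mulr0 scaler0.
rewrite mulr1 scaler_prod scalerA; congr (_ *: _).
by rewrite prodfV.
Qed.

Section skipfree_walk.
Context {R : numFieldType}.
Variables (k l : nat) (lam : nat -> R) (c : R).

(** Generating polynomial of one step, with displacements raised by one so that a down-step has
    exponent 0. After n steps the end point 0 is then read in degree n. *)
Definition step_poly : {poly R} :=
  c%:P + \sum_(i < l) lam i.+1 *: 'X^(k * i.+1 + 1).

(* total weight of the free n-step walks from h to 0 *)
Definition free_weight (n h : nat) : R := ('X^h * step_poly ^+ n)`_n.

Lemma free_weightS n h : free_weight n.+1 h.+1 =
  c * free_weight n h + \sum_(i < l) lam i.+1 * free_weight n (h.+1 + k * i.+1).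
Proof.
rewrite /free_weight [step_poly ^+ n.+1]exprS mulrCA {1}/step_poly.
rewrite mulrDl coefD mul_polyC coefZ; congr (_ * _ + _).
  by rewrite exprS -mulrA coefXM.
rewrite big_distrl /= coef_sum; apply: eq_bigr => i _.
rewrite -scalerAl coefZ mulrA -exprD; congr (_ * _).
have -> : (k * i.+1 + 1 + h.+1 = (h.+1 + k * i.+1).+1)%N by lia.
by rewrite exprS -mulrA coefXM.
Qed.

(** The Euler operator X d/dX multiplies the coefficient of degree [n.+1] by [n.+1]; the product
    rule evaluates it a second time. In terms of walks this is the exchangeability of the steps: on
    average the first one carries the share 1/(n+1) of the total displacement. *)
Lemma free_weight_deriv n h : (n.+1%:R - h.+1%:R) * free_weight n.+1 h.+1 =
  n.+1%:R * \sum_(i < l) ((k * i.+1)%:R + 1) * lam i.+1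
            * free_weight n (h.+1 + k * i.+1).
Proof.
rewrite mulrBl.
have -> : n.+1%:R * free_weight n.+1 h.+1 =
    ('X * poly.deriv ('X^(h.+1) * step_poly ^+ n.+1))`_n.+1.
  by rewrite coefXM /= coef_deriv /free_weight mulr_natl.
have Xd : 'X * poly.deriv 'X^(h.+1) = 'X^(h.+1) *+ h.+1 :> {poly R}.
  by rewrite derivXn mulrnAr -exprS.
rewrite derivM mulrDr coefD mulrA Xd mulrnAl coefMn.
rewrite -/(free_weight n.+1 h.+1) mulr_natl addrAC subrr add0r.
rewrite deriv_exp /= !mulrnAr coefMn -[LHS]mulr_natl; congr (_ * _).
rewrite !mulrA.
have -> : 'X * 'X^(h.+1) * poly.deriv step_poly * step_poly ^+ n =
   \sum_(i < l) (((k * i.+1)%:R + 1) * lam i.+1) *: ('X^((h.+1 + k * i.+1).+1) * step_poly ^+ n).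
  rewrite /step_poly derivD derivC add0r raddf_sum /= mulr_sumr mulr_suml.
  apply: eq_bigr => i _.
  rewrite derivZ derivXn addn1 /= -scaler_nat scalerA -scalerAr -scalerAl.
  rewrite -natr1 [lam _ * _]mulrC; congr (_ *: (_ * _)).
  by rewrite -exprS -exprD addSn.
rewrite coef_sum; apply: eq_bigr => i _.
by rewrite coefZ exprS -mulrA coefXM.
Qed.

(* Kemperman's formula: the weight of the walks from h that hit 0 for the
   first time at step n is h / n times the weight of all walks from h to 0. *)
Definition first_passage (n h : nat) : R := h%:R / n%:R * free_weight n h.

Lemma first_passage_n0 n : first_passage n 0 = 0.
Proof. by rewrite /first_passage !mul0r. Qed.

(** A linear combination of [free_weightS] and [free_weight_deriv]. The recursion breaks down at n =
    0, where [first_passage 0 0] is 0 although a walk at 0 has already arrived. *)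
Lemma first_passageS n h : (0 < n)%N -> first_passage n.+1 h.+1 =
  c * first_passage n h + \sum_(i < l) lam i.+1 * first_passage n (h.+1 + k * i.+1).
Proof.
move=> n0.
have nn0 : n%:R != 0 :> R by rewrite pnatr_eq0 -lt0n.
have n1 : n.+1%:R != 0 :> R by rewrite pnatr_eq0.
rewrite /first_passage.
have E1 := free_weightS n h; have E2 := free_weight_deriv n h.
have {E2}E2 : \sum_(i < l) ((k * i.+1)%:R + 1) * lam i.+1 * free_weight n (h.+1 + k * i.+1)
    = (n.+1%:R - h.+1%:R) / n.+1%:R * free_weight n.+1 h.+1.
  by rewrite mulrAC E2; field.
set S1 := \sum_(i < l) lam i.+1 * free_weight n _ in E1.
have -> : \sum_(i < l) lam i.+1 * ((h.+1 + k * i.+1)%:R / n%:R * free_weight n (h.+1 + k * i.+1))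
   = n%:R^-1 * (\sum_(i < l) ((k * i.+1)%:R + 1) * lam i.+1 * free_weight n (h.+1 + k * i.+1)
       + h%:R * S1).
  rewrite /S1 [h%:R * _]big_distrr /= -big_split /= big_distrr /=; apply: eq_bigr => i _.
  by rewrite natrD -[h.+1%:R]natr1; ring.
rewrite E2; have -> : S1 = free_weight n.+1 h.+1 - c * free_weight n h by rewrite E1 addrC addKr.
rewrite -[h.+1%:R]natr1; rewrite -[n.+1%:R]natr1 in n1 *.
by field; rewrite n1 nn0.
Qed.

(* one backward step of the walk reflected at 0: it goes up by [k * m] with
   weight [lam m] and down by 1 with weight [c]; [0.-1 = 0] *)
Definition back_step (f : nat -> R) (x : nat) : R :=
  c * f x.-1 + \sum_(i < l) lam i.+1 * f (x + k * i.+1)%N.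

Definition return_weight (j x : nat) : R :=
  iter j back_step (fun y => (y == 0)%N%:R) x.

(* A down-step of the reflected walk taken at 0 is a new minimum of the free
   walk, i.e. a first passage. *)
Lemma return_weight_first_passage j x M : (0 < k)%N -> (j.+1 < M)%N ->
  c * return_weight j x = \sum_(x.+1 <= h < M) first_passage j.+1 h.
Proof.
(* The bound M is arbitrary because [first_passage j.+1 h] vanishes for h > j + 1. It stays free in
   the induction, since a jump upwards shifts the range of h. *)
move=> k0; elim: j x M => [|j IH] x M jM.
  have fp1 h : first_passage 1 h.+1 = c * (h == 0)%N%:R.
    rewrite /first_passage divr1 /free_weight expr1 exprS -mulrA coefXM /=.
    rewrite coefXnM; case: h => [|h] /=; last by rewrite mulr0 mulr0.
    rewrite mul1r subn0 mulr1 /step_poly coefD coefC /= coef_sum big1 ?addr0//.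
    by move=> i _; rewrite coefZ coefXn addn1 /= mulr0.
  rewrite /return_weight /=; case: x => [|x].
    rewrite big_ltn// fp1 /= big_nat big1 ?addr0// => -[|[|h]]// _.
    by rewrite fp1 /= mulr0.
  rewrite mulr0 big_nat big1// => -[|[|h]]// _.
  by rewrite fp1 /= mulr0.
have M0 : (0 < M)%N by apply: leq_trans jM.
have jM' : (j.+1 < M.-1)%N by rewrite -ltnS prednK.
have -> : return_weight j.+1 x = back_step (return_weight j) x by [].
transitivity (\sum_(x.+1 <= h < M)
    (c * first_passage j.+1 h.-1 + \sum_(i < l) lam i.+1 * first_passage j.+1 (h + k * i.+1))); last first.
  by rewrite !big_nat; apply: eq_bigr => -[//|h] _; rewrite first_passageS.
rewrite big_split /= -[in \sum_(x.+1 <= h < M) _ + _](prednK M0).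
rewrite /back_step mulrDr; congr (_ + _).
  rewrite big_add1 /= -big_distrr /=; congr (_ * _).
  case: x => [|x] /=; last exact: IH.
  (* From 0 a down-step stays at 0: the sum starting at 1 agrees with the one starting at 0 by
     [first_passage_n0]. *)
  by rewrite (IH 0%N _ jM') [RHS]big_ltn ?first_passage_n0 ?add0r// (leq_trans _ jM').
rewrite big_distrr exchange_big /=; apply: eq_bigr => i _.
rewrite mulrCA -big_distrr /= (IH _ (M + k * i.+1)%N); last first.
  by apply: (leq_trans (ltnW jM)); rewrite leq_addr.
by rewrite -addSn big_addn addnK prednK.
Qed.
End skipfree_walk.

(** * Expansion of the return weights in the coefficients C0 *)

Section ballot_expansion.
Context {R : realType}.
Variables (k l : nat) (lam : nat -> R) (mu : R).
Hypotheses (k0 : (0 < k)%N) (mu0 : 0 < mu) (Lam0 : 0 < Lam l lam).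

Let c := k%:R * mu.

Lemma fact_neq0 n : (n`!)%:R != 0 :> R.
Proof. by rewrite pnatr_eq0 -lt0n fact_gt0. Qed.

(** Walks are sorted by the number n of their jumps and by the numbers [m] of jumps of each size;
    the remaining steps go down. The end point is 0 exactly if [gamma0] equals j + 1, so [gamma0] is
    the number of steps, and h/(j+1) times (j+1)! yields the factors h and (gamma - 1)! of [C0]. *)
Lemma first_passage_C0 j h M : (0 < h)%N -> (j.+1 < M)%N ->
  first_passage k l lam c j.+1 h =
  c * \sum_(n < M) \sum_(m : {ffun 'I_l -> 'I_n.+1} | (\sum_(i < l) (m i : nat) == n)%N)
    C0 k lam mu h n (fun i => m i : nat) * (gamma0 k h n (fun i => m i : nat) == j.+1)%N%:R.
Proof.
move=> h0 jM; set J := j.+1.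
have c0 : c != 0 by rewrite mulf_neq0 ?pnatr_eq0 ?gt_eqF// -lt0n.
have J0 : J%:R != 0 :> R by rewrite pnatr_eq0.
rewrite /first_passage.
have -> : free_weight k l lam c J h = \sum_(n < M)
    \sum_(m : {ffun 'I_l -> 'I_n.+1} | (\sum_(i < l) (m i : nat) == n)%N)
    ('C(J, n) * n`!)%:R * c ^+ (J - n) * (\prod_(i < l) (lam i.+1 ^+ m i / ((m i)`!)%:R))
     * (gamma0 k h n (fun i => m i : nat) == J)%N%:R.
  rewrite /free_weight /step_poly exprDn mulr_sumr coef_sum.
  rewrite (big_ord_widen_cond M predT (fun n => ('X^h * (c%:P ^+ (J - n) *
    (\sum_(i < l) lam i.+1 *: 'X^(k * i.+1 + 1)) ^+ n *+ 'C(J, n)))`_J))//.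
  rewrite big_mkcond /=; apply: eq_bigr => n _.
  transitivity (('X^h * (c%:P ^+ (J - n) *
    (\sum_(i < l) lam i.+1 *: 'X^(k * i.+1 + 1)) ^+ n *+ 'C(J, n)))`_J).
    by case: ifPn => // Jn; rewrite bin_small ?mulr0n ?mulr0 ?coef0// -ltnS ltnNge.
  rewrite multinomial_thm mulr_sumr -sumrMnl mulr_sumr coef_sum.
  apply: eq_bigr => m /eqP mn.
  have -> : \prod_i (lam (i : 'I_l).+1 *: 'X^(k * i.+1 + 1)) ^+ m i =
      (\prod_i lam (i : 'I_l).+1 ^+ m i)%:P * 'X^(n + k * \sum_(i < l) i.+1 * m i) :> {poly R}.
    under eq_bigr do rewrite exprZn -exprM -mul_polyC.
    rewrite big_split /= (big_morph _ (@polyCM _) (erefl : 1%:P = 1)); congr (_ * _).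
    rewrite -(big_morph _ (exprD 'X) (expr0 'X)); congr ('X^_).
    transitivity (\sum_(i < l) m i + k * \sum_(i < l) i.+1 * m i)%N; last by rewrite mn.
    by rewrite big_distrr /= -big_split /=; apply: eq_bigr => i _; lia.
  rewrite -rmorphXn /= -mulrnAr mulrnAr -mul_polyC -mulrnAl -polyCMn.
  rewrite [LHS](_ : _ = (c ^+ (J - n) *+ 'C(J, n)) * ((n`!%:R / \prod_(i < l) (m i)`!%:R)
     * ((\prod_(i < l) lam i.+1 ^+ m i) * (gamma0 k h n (fun i : 'I_l => m i) == J)%:R))); last first.
    have coefE (p q r : R) e :
        ('X^h * (p%:P * (q%:P * (r%:P * 'X^e))))`_J = p * (q * (r * (h + e == J)%N%:R)).
      by rewrite !(mulrCA 'X^h) !coefCM -exprD coefXn eq_sym.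
    by rewrite coefE /gamma0 addnA.
  rewrite big_split /= prodfV natrM -mulr_natl; ring.
rewrite !mulr_sumr; apply: eq_bigr => n _.
rewrite !mulr_sumr; apply: eq_bigr => m /eqP mn.
have [gJ|gJ] := eqVneq (gamma0 k h n (fun i : 'I_l => m i)) J; last by rewrite !mulr0.
have nJ : (n < J)%N by rewrite -gJ /gamma0; lia.
rewrite /C0 gJ !mulr1 /= subSS subn0.
(* The powers of [Lam] inside and outside the product cancel because the entries of m add up to
   n. *)
have -> : \prod_(i < l) ((lam i.+1 / Lam l lam) ^+ m i / (m i)`!%:R)
   = (Lam l lam ^+ n)^-1 * \prod_(i < l) (lam i.+1 ^+ m i / (m i)`!%:R).
  under eq_bigr do rewrite expr_div_n mulrAC.
  rewrite big_split /= mulrC prodfV; congr (_^-1 * _).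
  by rewrite -(big_morph _ (exprD (Lam l lam)) (expr0 _)) mn.
set Pm := \prod_(i < l) _.
have L0 : Lam l lam ^+ n != 0 by rewrite expf_neq0// gt_eqF.
have -> : ('C(J, n) * n`!)%:R = (J`!)%:R / ((J - n)`!)%:R :> R.
  rewrite -(bin_fact (ltnW nJ)) mulnA [X in _ = X / _]natrM mulfK// ?fact_neq0//.
rewrite -/c /J factS natrM -/J.
have -> : c ^+ (J - n) = c * c ^+ (J - n - 1) by rewrite -exprS subn1 prednK ?subn_gt0.
by field; rewrite L0 J0 pnatr_eq0 -lt0n fact_gt0.
Qed.

(* Enumerates the steps by the number of down-steps and of the jumps of each size. *)
Lemma return_weight0_C0 j M : (j.+1 < M)%N ->
  return_weight k l lam c j 0 =
  \sum_(1 <= h < M) \sum_(n < M) \sum_(m : {ffun 'I_l -> 'I_n.+1} | (\sum_(i < l) (m i : nat) == n)%N)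
    C0 k lam mu h n (fun i => m i : nat) * (gamma0 k h n (fun i => m i : nat) == j.+1)%N%:R.
Proof.
move=> jM.
have c0 : c != 0 by rewrite mulf_neq0 ?pnatr_eq0 ?gt_eqF// -lt0n.
apply: (mulfI c0); rewrite (return_weight_first_passage _ _ _ _ k0 jM).
rewrite mulr_sumr !big_nat; apply: eq_bigr => h /andP[h0 _].
exact: first_passage_C0.
Qed.
End ballot_expansion.

(** * Uniformization of the queue *)

Definition reach (k : nat) (x : state) : bool :=
  (x == (0, 0)) || [&& (1 <= x.1)%N, (1 <= x.2)%N & (x.2 <= k)%N].

Definition arrive (k : nat) (x : state) (m : nat) : state :=
  if x == (0, 0) then (m, k) else ((x.1 + m)%N, x.2).

(** At the empty state this is a self-loop, the fictitious service added by uniformization. *)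
Definition serve (k : nat) (x : state) : state :=
  if x == (0, 0) then (0, 0) else if (2 <= x.2)%N then (x.1, x.2.-1)
  else if (2 <= x.1)%N then (x.1.-1, k) else (0, 0).

Lemma state_eqE (y z : state) : (y == z) = (y.2 == z.2)%N && (y.1 == z.1)%N.
Proof. by case: y z => ? ? [? ?]; rewrite xpair_eqE andbC. Qed.

Lemma reach_arrive k x i : (0 < k)%N -> reach k x -> reach k (arrive k x i.+1).
Proof.
rewrite /reach /arrive => k0 /orP[/eqP->|/and3P[x1 x2 xk]]; apply/orP; right.
  by rewrite /=; lia.
by case: ifP => _ /=; lia.
Qed.

Lemma reach_serve k x : (0 < k)%N -> reach k x -> reach k (serve k x).
Proof.
rewrite /reach /serve => k0 /orP[/eqP->|/and3P[x1 x2 xk]] //=.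
case: ifP => // _; case: ifP => [x22|_].
  by apply/orP; right => /=; rewrite x1 /=; lia.
by case: ifP => // x12; apply/orP; right; rewrite /= k0 leqnn; lia.
Qed.

(** Together with [gk_serve] this makes [gk] a lumping: phases and customers collapse to one walk on
    the naturals, with the truncated predecessor as reflection at 0. *)
Lemma gk_arrive k x i : (0 < k)%N -> reach k x ->
  gk k (arrive k x i.+1) = (gk k x + k * i.+1)%N.
Proof.
rewrite /reach /arrive /gk => k0 /orP[/eqP->|/and3P[x1 x2 xk]] /=.
  by rewrite subn1 mulnS /=; lia.
have x0 : (x == (0, 0)) = false by apply/eqP => E; move: x1; rewrite E.
rewrite x0.
rewrite xpair_eqE addnS /= subn1 /= subn1.
have -> : (x.1 + i)%N = (x.1.-1 + i.+1)%N by lia.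
by rewrite mulnDr; lia.
Qed.

Lemma gk_serve k x : (0 < k)%N -> reach k x -> gk k (serve k x) = (gk k x).-1.
Proof.
rewrite /reach /serve /gk => k0 /orP[/eqP->//|/and3P[x1 x2 xk]].
have x0 : (x == (0, 0)) = false by apply/eqP => E; move: x1; rewrite E.
rewrite x0.
have [x22|x22] := boolP (2 <= x.2)%N.
  rewrite xpair_eqE /= (_ : (x.1 == 0)%N = false) /=; last by lia.
  by move: (k * _)%N => z; lia.
have [x12|x12] := boolP (2 <= x.1)%N.
  rewrite xpair_eqE /= (_ : (x.1.-1 == 0)%N = false) /=; last by lia.
  have -> : (x.1 - 1)%N = (x.1.-1 - 1).+1 by lia.
  by rewrite mulnS; lia.
rewrite eqxx; have -> : (x.1 - 1 = 0)%N by lia.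
by lia.
Qed.

Lemma gk_eq0 k x : reach k x -> (gk k x == 0)%N = (x == (0, 0)).
Proof.
rewrite /reach /gk => /orP[/eqP->//|/and3P[x1 x2 xk]].
case: (eqVneq x (0, 0)) => [_|_] //=; by rewrite addn_eq0 [x.2 == 0%N]eqn0Ngt x2 andbF.
Qed.

(** * The generator as a sum over moves *)

Section generator.
Context {R : realType}.
Variables (k l : nat) (lam : nat -> R) (mu : R).
Hypotheses (k0 : (0 < k)%N).
Let c := k%:R * mu.
Let q := Lam l lam + c.

Lemma sum_pulse (f : nat -> R) (b : bool) (a x : nat) :
  \sum_(i < l) f i.+1 * (b && (a == x + i.+1)%N)%:R =
  if b && (x < a <= x + l)%N then f (a - x)%N else 0.
Proof.
case: b => /=; last by rewrite big1// => i _; rewrite mulr0.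
case: ifP => [/andP[xa al]|H].
  have H : (a - x.+1 < l)%N by lia.
  rewrite (bigD1 (Ordinal H)) //= big1 ?addr0.
    have -> : (a == x + (a - x.+1).+1)%N by lia.
    by rewrite mulr1; congr f; lia.
  move=> i /eqP ij; rewrite (_ : (a == _) = false) ?mulr0//.
  by apply/negP => /eqP E; apply: ij; apply: val_inj => /=; lia.
rewrite big1// => i _; rewrite (_ : (a == _) = false) ?mulr0//.
by apply/negP => /eqP E; move: H (ltn_ord i); rewrite E; lia.
Qed.

(** The nested tests of [rate] exclude each other, since an arrival raises the first coordinate and
    a service never does; they can be traded for a sum of indicators. *)
Lemma rateE x y : reach k x -> rate k l lam mu x y =
  \sum_(i < l) lam i.+1 * (y == arrive k x i.+1)%:R
  + c * (x != (0, 0))%:R * (y == serve k x)%:R.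
Proof.
rewrite /rate /arrive /serve; case: eqP => [-> _|x0 rx] /=.
  rewrite mulr0 mul0r addr0.
  under eq_bigr do rewrite state_eqE /=.
  by rewrite (sum_pulse lam (y.2 == k) y.1 0) add0n subn0.
have {rx} : [&& (1 <= x.1)%N, (1 <= x.2)%N & (x.2 <= k)%N].
  by move: rx; rewrite /reach; case: eqP.
move=> /[dup] rx ->; rewrite mulr1.
under eq_bigr do rewrite state_eqE /=.
rewrite sum_pulse; case: x x0 rx => x1 x2 /= x0 /and3P[x10 x20 xk].
case: y => y1 y2 /=.
have [x22|x22] := boolP (2 <= x2)%N; last first.
  have x21 : x2 = 1%N by lia.
  subst x2; have [x12|x12] := boolP (2 <= x1)%N; last first.
    have x11 : x1 = 1%N by lia.
    rewrite x11 !state_eqE /=; case: ifP => [H|_].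
      by rewrite (_ : (y2 == 0) && (y1 == 0) = false)%N ?mulr0 ?addr0//; lia.
    by case: ifP => _; rewrite ?mulr1 ?mulr0 ?add0r.
  rewrite !state_eqE /=; case: ifP => [H|_].
    by rewrite (_ : (y2 == k) && (y1 == x1.-1) = false)%N ?mulr0 ?addr0//; lia.
  rewrite [in X in if _ then _ else X]ifF; last by lia.
  by case: ifP => _; rewrite ?mulr1 ?mulr0 ?add0r.
rewrite !state_eqE /=; case: ifP => [H|_].
  by rewrite (_ : (y2 == x2.-1) && (y1 == x1) = false)%N ?mulr0 ?addr0//; lia.
case: ifP => _; first by rewrite ?mulr1 ?add0r.
by rewrite mulr0 addr0 ifF ?ifF//; lia.
Qed.

Definition box_sum (N : nat) (f : state -> R) : R :=
  \sum_(a < N) \sum_(b < k.+1) f (a : nat, b : nat).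

Lemma box_sum_delta N (z : state) (f : state -> R) : (z.1 < N)%N -> (z.2 <= k)%N ->
  box_sum N (fun y => f y * (y == z)%:R) = f z.
Proof.
move=> zN zk; rewrite /box_sum (bigD1 (Ordinal zN))//= (bigD1 (Ordinal (zk : (z.2 < k.+1)%N)))//=.
rewrite -surjective_pairing eqxx mulr1 !big1 ?addr0// => i /eqP iz.
  rewrite big1// => b _; rewrite (_ : _ == z = false) ?mulr0//.
  by apply/eqP => E; apply: iz; apply: val_inj; exact: (congr1 fst E).
by rewrite (_ : _ == z = false) ?mulr0//; apply/eqP => E; apply: iz; apply: val_inj; exact: (congr1 snd E).
Qed.

Lemma box_sumD N f g : box_sum N (fun y => f y + g y) = box_sum N f + box_sum N g.
Proof. by rewrite /box_sum -big_split /=; apply: eq_bigr => a _; rewrite -big_split. Qed.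

Lemma box_sum_sumr N (I : Type) (r : seq I) (F : I -> state -> R) :
  box_sum N (fun y => \sum_(i <- r) F i y) = \sum_(i <- r) box_sum N (F i).
Proof.
by rewrite /box_sum; under eq_bigr do rewrite exchange_big /=; rewrite exchange_big.
Qed.

Lemma box_sumZ N a f : box_sum N (fun y => a * f y) = a * box_sum N f.
Proof. by rewrite /box_sum mulr_sumr; apply: eq_bigr => i _; rewrite mulr_sumr. Qed.

Lemma eq_box_sum N f g : (forall y, (y.1 < N)%N -> (y.2 <= k)%N -> f y = g y) ->
  box_sum N f = box_sum N g.
Proof.
move=> fg; apply: eq_bigr => a _; apply: eq_bigr => b _.
by apply: fg => /=; rewrite ?ltn_ord// -ltnS ltn_ord.
Qed.

Lemma box_sum_exchange N M (F : state -> state -> R) :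
  box_sum N (fun x => box_sum M (F x)) = box_sum M (fun y => box_sum N (F ^~ y)).
Proof.
have pairE K f : box_sum K f = \sum_(p : 'I_K * 'I_k.+1) f (p.1 : nat, p.2 : nat).
  by rewrite /box_sum pair_big.
rewrite !pairE; under eq_bigr do rewrite pairE.
by rewrite exchange_big /=; apply: eq_bigr => p _; rewrite pairE.
Qed.

Lemma box_sum_widen N M f : (N <= M)%N ->
  (forall y, (N <= y.1)%N -> f y = 0) -> box_sum M f = box_sum N f.
Proof.
move=> NM f0; rewrite /box_sum [RHS](big_ord_widen M (fun a => \sum_(b < k.+1) f (a, b : nat)))//.
rewrite [RHS]big_mkcond /=. apply: eq_bigr => a _; case: ifPn => // aN.
by rewrite big1// => b _; rewrite f0//= leqNgt.
Qed.

Lemma serve1_le x : ((serve k x).1 <= x.1)%N.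
Proof. by rewrite /serve; case: ifP => [/eqP->//|_]; do 2 case: ifP => // _; exact: leq_pred. Qed.

Lemma serve2_le x : reach k x -> ((serve k x).2 <= k)%N.
Proof.
by move=> /(reach_serve k0); rewrite /reach => /orP[/eqP->//|/and3P[]].
Qed.

Lemma arrive2_le x m : reach k x -> ((arrive k x m).2 <= k)%N.
Proof. by rewrite /arrive /reach; case: ifP => //= _ /and3P[]. Qed.

Lemma arrive1 x m : ((arrive k x m).1 = x.1 + m)%N.
Proof. by rewrite /arrive; case: ifP => // /eqP->. Qed.

Lemma qoutE x : reach k x -> qout k l lam mu x = Lam l lam + c * (x != (0, 0))%:R.
Proof.
move=> rx.
rewrite [LHS](_ : _ = box_sum (x.1 + l + 1) (fun y => rate k l lam mu x y)) //.
under [in LHS]eq_box_sum => y _ _ do rewrite rateE//.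
rewrite box_sumD box_sum_sumr box_sum_delta; last 2 first.
  by rewrite addn1 ltnS (leq_trans (serve1_le x))// leq_addr.
  exact: serve2_le.
congr (_ + _); rewrite /Lam big_add1 /= big_mkord; apply: eq_bigr => i _.
rewrite (box_sum_delta (fun=> lam i.+1))// ?arrive2_le// arrive1.
by rewrite addn1 ltnS leq_add2l.
Qed.

Lemma gen_uniformized x y : reach k x -> gen k l lam mu x y + q * (x == y)%:R =
  \sum_(i < l) lam i.+1 * (y == arrive k x i.+1)%:R + c * (y == serve k x)%:R.
Proof.
move=> rx; rewrite /gen; case: eqP => [<-|xy]; last first.
  rewrite mulr0 addr0 rateE//; congr (_ + _); case: eqP => [x0|_]; last by rewrite mulr1.
  rewrite mulr0 mul0r /serve x0 eqxx (_ : y == _ = false) ?mulr0//.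
  by apply/eqP => y0; apply: xy; rewrite x0 y0.
rewrite qoutE// mulr1 /q big1 ?add0r; last first.
  move=> i _; rewrite (_ : x == _ = false) ?mulr0//; apply/eqP => E.
  by move: (congr1 fst E); rewrite arrive1 -{1}(addn0 x.1) => /addnI.
have [x0|x0] := boolP (x == (0, 0)).
  by rewrite /serve x0 (eqP x0) eqxx /=; lra.
rewrite (_ : x == _ = false) ?mulr1 /=; first by lra.
(* A nonempty state is not fixed by [serve], which lowers [gk] by one. *)
apply/eqP => E; move: (gk_serve k0 rx) (gk_eq0 rx); rewrite -E (negbTE x0).
by case: (gk k x) => //= n; lia.
Qed.
End generator.

(** * Backward iteration of the reflected walk *)

Section back_step_theory.
Context {R : realFieldType}.
Variables (k l : nat) (lam : nat -> R) (c : R).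
Hypotheses (lam0 : forall i : 'I_l, 0 <= lam i.+1) (c0 : 0 <= c).
Notation Bw := (back_step k l lam c).
Let q := \sum_(i < l) lam i.+1 + c.

Lemma iter_back_step_lin j a (f g : nat -> R) x :
  iter j Bw (fun y => a * f y + g y) x = a * iter j Bw f x + iter j Bw g x.
Proof.
elim: j x => // j IH x; rewrite !iterS /back_step !IH !mulrDr.
under eq_bigr do rewrite IH mulrDr mulrCA.
rewrite big_split /= -mulr_sumr; ring.
Qed.

Lemma iter_back_step_ext j (f g : nat -> R) : f =1 g -> iter j Bw f =1 iter j Bw g.
Proof. by move=> /funext ->. Qed.

Lemma iter_back_step1 j x : iter j Bw (fun=> 1) x = q ^+ j.
Proof.
elim: j x => // j IH x; rewrite iterS /back_step IH.
under eq_bigr do rewrite IH.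
by rewrite -mulr_suml exprS /q; ring.
Qed.

Lemma iter_back_step_le j (f g : nat -> R) x : (forall y, f y <= g y) ->
  iter j Bw f x <= iter j Bw g x.
Proof.
move=> fg; elim: j x => [|j IH] x; first exact: fg.
by rewrite !iterS lerD// ?ler_wpM2l// ler_sum// => i _; rewrite ler_wpM2l.
Qed.

Lemma return_weight_ge0 j x : 0 <= return_weight k l lam c j x.
Proof.
elim: j x => [|j IH] x; first by rewrite /return_weight /= ler0n.
by rewrite /return_weight iterS addr_ge0 ?mulr_ge0 ?IH// sumr_ge0// => i _; rewrite mulr_ge0 ?IH.
Qed.

Lemma return_weight_le j x : return_weight k l lam c j x <= q ^+ j.
Proof.
rewrite -(iter_back_step1 j x); apply: iter_back_step_le => y.
by rewrite lern1 leq_b1.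
Qed.

Definition mean_weight j := iter j Bw (fun y => y%:R) 0%N.

(** Apart from the constant drift, one backward step multiplies the identity function by q;
    reflection adds c times the indicator of 0, whose iterates are the return weights. *)
Lemma mean_weightS j : mean_weight j.+1 = q * mean_weight j
  + (k%:R * \sum_(i < l) i.+1%:R * lam i.+1 - c) * q ^+ j
  + c * return_weight k l lam c j 0.
Proof.
rewrite /mean_weight iterSr; set a := k%:R * _ - c.
(* The nesting and the trailing 0 fit three applications of [iter_back_step_lin]. *)
rewrite (@iter_back_step_ext _ _ (fun y => q * y%:R + (a * 1 + (c * (y == 0)%N%:R + 0)))).
  rewrite !iter_back_step_lin iter_back_step1 addrA; congr (_ + _).
  rewrite -[in RHS](addr0 (c * _)); congr (_ + _).
  have := iter_back_step_lin j 0 (fun=> 0) (fun=> 0) 0.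
  rewrite mul0r add0r => H.
  have E : forall y, iter j Bw (fun=> 0) y = 0.
    elim: j {H} => // j IH y; rewrite iterS /back_step IH mulr0 big1 ?addr0// => i _.
    by rewrite IH mulr0.
  exact: E.
move=> y; rewrite /back_step /a /q.
under eq_bigr do rewrite natrD mulrDr natrM.
rewrite big_split /= -mulr_suml mulr_sumr.
under [X in _ + (_ + X)]eq_bigr do rewrite mulrCA [lam _ * _]mulrC.
by case: y => [|y] /=; rewrite -?[y.+1%:R]natr1; ring.
Qed.

(** The recurrence [mean_weightS] solved by variation of constants, with the negative part of the
    drift kept on the left so that only nonnegative terms are summed over j later on. *)
Lemma mean_weightE j : mean_weight j + c * \sum_(i < j) q ^+ (j.-1 - i) * q ^+ i
  = \sum_(i < j) q ^+ (j.-1 - i) *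
     (k%:R * (\sum_(i < l) i.+1%:R * lam i.+1) * q ^+ i + c * return_weight k l lam c i 0).
Proof.
elim: j => [|j IH]; first by rewrite !big_ord0 mulr0 addr0.
rewrite mean_weightS !big_ord_recr /= subnn.
have E (f : nat -> R) : \sum_(i < j) q ^+ (j - i) * f i = q * \sum_(i < j) q ^+ (j.-1 - i) * f i.
  rewrite mulr_sumr; apply: eq_bigr => i _; rewrite mulrA -exprS; congr (q ^+ _ * _).
  by move: (ltn_ord i); lia.
rewrite !(E (fun i => q ^+ i)) (E (fun i => k%:R * (\sum_(i < l) i.+1%:R * lam i.+1) * q ^+ i + c * return_weight k l lam c i 0)) -IH.
ring.
Qed.
End back_step_theory.

(** * The uniformized chain and its pairing with functions of the queue length *)

Section uniformization.
Context {R : realType}.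
Variables (k l : nat) (lam : nat -> R) (mu : R).
Hypotheses (k0 : (0 < k)%N) (lam0 : forall i : 'I_l, 0 <= lam i.+1) (mu0 : 0 <= mu).
Let c := k%:R * mu.
Let q := Lam l lam + c.

Definition uniform_step (v : state -> R) (y : state) : R :=
  fstep k l lam mu v y + q * v y.

Definition supported (N : nat) (v : state -> R) :=
  forall y, ~~ reach k y || (N <= y.1)%N -> v y = 0.

Let jump (x y : state) : R :=
  \sum_(i < l) lam i.+1 * (y == arrive k x i.+1)%:R + c * (y == serve k x)%:R.

Lemma serve1_ge x : reach k x -> (x.1 <= (serve k x).1.+1)%N.
Proof.
rewrite /reach /serve => /orP[/eqP->//|/and3P[x1 x2 xk]].
case: ifP => [/eqP->//|_]; case: ifP => [_|_] //=; case: ifP => [_|/negbT] /=; lia.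
Qed.

Lemma jump_eq0 x y : reach k x -> (y.1.+1 < x.1)%N || (x.1 + l < y.1)%N || ~~ reach k y -> jump x y = 0.
Proof.
move=> rx H; rewrite /jump big1 ?add0r => [|i _]; case: eqP => [yE|_]; rewrite ?mulr0//.
  move: H; rewrite yE reach_serve// orbF.
  by move: (serve1_ge rx) (serve1_le k x); lia.
move: H; rewrite yE reach_arrive// orbF arrive1.
by move: (ltn_ord i); lia.
Qed.

(** [fstep] cuts its sum according to the target y, the right-hand side according to the support of
    v. Both extend to the common bound [K]: the first because a jump lowers the first coordinate by
    at most one, the second because v vanishes outside. *)
Lemma uniform_stepE N v y : supported N v ->
  uniform_step v y = box_sum k N (fun x => v x * jump x y).
Proof.
move=> sv; set K := maxn N (y.1 + 2).
have vq : q * v y = box_sum k K (fun x => v x * (q * (x == y)%:R)).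
  have [ry|ry] := boolP (reach k y); last first.
    rewrite sv ?ry// mulr0 /box_sum big1// => a _; rewrite big1// => b _.
    by case: eqP => [->|_]; rewrite ?mulr0// sv ?mul0r// ry.
  under [RHS]eq_box_sum => x _ _ do rewrite mulrA.
  rewrite box_sum_delta; first by rewrite mulrC.
    by rewrite /K; lia.
  by move: ry; rewrite /reach => /orP[/eqP->//|/and3P[]].
have -> : uniform_step v y = box_sum k K (fun x => v x * gen k l lam mu x y) + q * v y.
  rewrite /uniform_step; congr (_ + _).
  transitivity (box_sum k (y.1 + 2) (fun x => v x * gen k l lam mu x y)); first by [].
  symmetry; apply: box_sum_widen; first by rewrite /K leq_maxr.
  - move=> x xy; have [rx|rx] := boolP (reach k x); last by rewrite sv ?rx// mul0r.
    have := gen_uniformized l lam mu k0 y rx; rewrite -/(jump x y) jump_eq0//; last first.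
      by rewrite (_ : (y.1.+1 < x.1)%N)//; lia.
    case: eqP => [xy'|_]; first by move: xy; rewrite xy'; lia.
    by rewrite mulr0 addr0 => ->; rewrite mulr0.
rewrite vq -box_sumD; transitivity (box_sum k K (fun x => v x * jump x y)); last first.
  apply: box_sum_widen; first by rewrite /K leq_maxl.
  by move=> x Nx; rewrite sv ?mul0r// Nx orbT.
apply: eq_box_sum => x _ _; rewrite -mulrDr.
have [rx|rx] := boolP (reach k x); last by rewrite sv ?rx// !mul0r.
by rewrite gen_uniformized.
Qed.

Lemma uniform_step_supported N v : supported N v -> supported (N + l) (uniform_step v).
Proof.
move=> sv y yE; rewrite (uniform_stepE _ sv) /box_sum big1// => a _; rewrite big1// => b _.
have [rx|rx] := boolP (reach k (a : nat, b : nat)); last by rewrite sv ?rx ?mul0r.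
rewrite jump_eq0 ?mulr0//=; move: yE; case: (reach k y) => //=; last by rewrite orbT.
by move: (ltn_ord a); lia.
Qed.

Lemma uniform_step_ge0 N v : supported N v -> (forall y, 0 <= v y) ->
  forall y, 0 <= uniform_step v y.
Proof.
move=> sv v0 y; rewrite (uniform_stepE _ sv).
apply: sumr_ge0 => a _; apply: sumr_ge0 => b _; apply: mulr_ge0 => //.
apply: addr_ge0; first by apply: sumr_ge0 => i _; rewrite mulr_ge0.
by rewrite !mulr_ge0.
Qed.

(** Duality between the forward step on measures and the backward step on functions, with [gk]
    passing from states to lengths. The box grows by l, the largest batch. *)
Lemma uniform_step_pairing N M v (f : nat -> R) : supported N v -> (N + l <= M)%N ->
  box_sum k M (fun y => uniform_step v y * f (gk k y)) =
  box_sum k N (fun y => v y * back_step k l lam c f (gk k y)).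
Proof.
move=> sv NM.
under [LHS]eq_box_sum => y _ _.
  rewrite (uniform_stepE _ sv) mulrC -box_sumZ.
  over.
rewrite box_sum_exchange; apply: eq_box_sum => x xN xk.
under eq_box_sum => y _ _ do rewrite mulrCA.
rewrite box_sumZ.
have [rx|rx] := boolP (reach k x); last by rewrite sv ?rx// !mul0r.
congr (_ * _); rewrite /jump.
under eq_box_sum => y _ _ do rewrite mulrDr mulr_sumr.
rewrite box_sumD box_sum_sumr addrC; congr (_ + _).
  under eq_box_sum => y _ _ do rewrite mulrCA.
  rewrite box_sumZ box_sum_delta ?serve2_le ?gk_serve//.
  by move: (serve1_le k x); lia.
apply: eq_bigr => i _.
under eq_box_sum => y _ _ do rewrite mulrCA.
rewrite box_sumZ box_sum_delta ?arrive2_le ?gk_arrive//.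
by rewrite arrive1; move: (ltn_ord i); lia.
Qed.

Definition forward (j : nat) : state -> R := iter j uniform_step (dirac_st (0, 0)).

Lemma forward_supported j : supported (l * j).+1 (forward j).
Proof.
elim: j => [|j IH].
  move=> y; rewrite muln0 /forward /= /dirac_st; case: eqP => [->|//].
  by rewrite /reach eqxx.
have := uniform_step_supported IH; rewrite /forward iterS mulnS.
by rewrite (_ : (l * j).+1 + l = (l + l * j).+1)%N//; lia.
Qed.

Lemma forward_ge0 j y : 0 <= forward j y.
Proof.
elim: j y => [|j IH] y; first by rewrite /forward /= /dirac_st ler0n.
by rewrite /forward iterS; apply: (uniform_step_ge0 (@forward_supported j)).
Qed.

Lemma forward_pairing j (f : nat -> R) :
  box_sum k (l * j).+1 (fun y => forward j y * f (gk k y)) = iter j (back_step k l lam c) f 0%N.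
Proof.
elim: j f => [|j IH] f.
  rewrite muln0 /forward /= /dirac_st.
  under eq_box_sum => y _ _ do rewrite mulrC.
  by rewrite box_sum_delta.
rewrite iterSr -IH /forward iterS.
apply: uniform_step_pairing; first exact: forward_supported.
by rewrite mulnS; lia.
Qed.

Lemma rate_sumE : \sum_(i < l) lam i.+1 + c = q.
Proof. by rewrite /q /Lam big_add1 /= big_mkord. Qed.

Lemma uniform_rate_ge0 : 0 <= q.
Proof. by rewrite -rate_sumE addr_ge0 ?sumr_ge0// mulr_ge0. Qed.

(** The total mass of [forward j] is [q ^+ j], because constants are eigenfunctions of
    [back_step]. *)
Lemma forward_le j y : forward j y <= q ^+ j.
Proof.
have [/andP[ry yl]|] := boolP (reach k y && (y.1 < (l * j).+1)%N); last first.
  rewrite negb_and -leqNgt => ry; rewrite forward_supported// exprn_ge0//.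
  exact: uniform_rate_ge0.
have <- : box_sum k (l * j).+1 (fun z => forward j z * (z == y)%:R) = forward j y.
  by rewrite box_sum_delta//; move: ry; rewrite /reach => /orP[/eqP->//|/and3P[]].
have := forward_pairing j (fun=> 1); rewrite iter_back_step1 rate_sumE => <-.
apply: ler_sum => a _; apply: ler_sum => b _.
by rewrite ler_wpM2l ?forward_ge0// lern1 leq_b1.
Qed.

(** Binomial expansion of the powers of G = (G + q) - q, by Pascal's rule. *)
Lemma iter_fstep j y : iter j (fstep k l lam mu) (dirac_st (0, 0)) y =
  \sum_(i < j.+1) 'C(j, i)%:R * (- q) ^+ (j - i) * forward i y.
Proof.
elim: j y => [|j IH] y; first by rewrite big_ord_recl big_ord0 bin0 expr0 !mul1r addr0.
have fstep_sum (a : 'I_j.+1 -> R) : fstep k l lam mu (fun z => \sum_(i < j.+1) a i * forward i z) y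
    = \sum_(i < j.+1) a i * fstep k l lam mu (forward i) y.
  rewrite /fstep; under [RHS]eq_bigr do rewrite mulr_sumr.
  rewrite [RHS]exchange_big /=; apply: eq_bigr => x _.
  under [RHS]eq_bigr do rewrite mulr_sumr.
  rewrite [RHS]exchange_big /=; apply: eq_bigr => b _.
  by rewrite mulr_suml; apply: eq_bigr => i _; rewrite mulrA.
rewrite iterS (_ : iter j _ _ = (fun z => \sum_(i < j.+1) 'C(j, i)%:R * (- q) ^+ (j - i) * forward i z)); last exact/funext.
rewrite fstep_sum.
have E i : fstep k l lam mu (forward i) y = forward i.+1 y + - q * forward i y.
  by rewrite /forward iterS /uniform_step; ring.
under eq_bigr do rewrite E mulrDr.
rewrite big_split /= [RHS]big_ord_recl /= bin0 subn0.
under [X in _ = _ + X]eq_bigr => i _ do rewrite /bump /= add1n binS natrD !mulrDl subSS.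
rewrite [X in _ = _ + X]big_split /= [X in _ = _ + X]addrC addrCA; congr (_ + _).
rewrite [in RHS]big_ord_recr /= bin_small// !mul0r addr0 big_ord_recl /= bin0 subn0.
congr (_ + _); first by rewrite exprS; ring.
apply: eq_bigr => i _; rewrite /bump /= add1n.
have -> : (j - i = (j - i.+1).+1)%N by move: (ltn_ord i); lia.
by rewrite exprS; ring.
Qed.

End uniformization.

Lemma sum_triangle (V : nmodType) (N : nat) (F : nat -> nat -> V) :
  \sum_(n < N) \sum_(i < n.+1) F i (n - i)%N =
  \sum_(i < N) \sum_(j < N | (i + j < N)%N) F i j.
Proof.
transitivity (\sum_(n < N) \sum_(i < N | (i <= n)%N) F i (n - i)%N).
  apply: eq_bigr => n _.
  by rewrite (big_ord_widen_cond N predT (fun i => F i (n - i)%N)).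
rewrite (exchange_big_dep predT)//=; apply: eq_bigr => i _.
rewrite -(big_geq_mkord i N predT (fun n => F i (n - i)%N)).
rewrite -[X in \sum_(X <= _ < _) _](add0n (i : nat)) big_addn big_mkord.
rewrite (eq_bigr (fun j : (ordinal (N - i)) => F i j)); last by move=> j _; congr (F i); lia.
rewrite (big_ord_widen N (fun j => F i j)) ?leq_subr//.
by apply: eq_bigl => j; rewrite ltn_subRL.
Qed.

Section cauchy_product.
Context {R : realType}.

(** The triangle i + j < n lies between the squares of sides n/2 and n, so the error is at most the
    absolute mass between these squares, which tends to 0. *)
Lemma cauchy_product (a b : R^nat) :
  cvgn [normed series a] -> cvgn [normed series b] ->
  series (fun n => \sum_(i < n.+1) a i * b (n - i)%N) @ \oo -->
  limn (series a) * limn (series b).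
Proof.
move=> ca cb.
pose A n := [normed series a] n; pose B n := [normed series b] n.
have key n : `|series (fun n => \sum_(i < n.+1) a i * b (n - i)%N) n - series a n * series b n|
   <= A n * B n - A n./2 * B n./2.
  have prodE (u v : R^nat) m : (m <= n)%N -> series u m * series v m =
      \sum_(i < n) \sum_(j < n) ((i < m) && (j < m))%N%:R * (u i * v j).
    move=> mn; rewrite /series /= !big_mkord big_distrl /=.
    rewrite (big_ord_widen n (fun i => u i * \sum_(j < m) v j))// big_mkcond /=.
    apply: eq_bigr => i _; case: ifP => im; last first.
      by rewrite big1// => j _; rewrite mul0r.
    rewrite mulr_sumr (big_ord_widen n (fun j => u i * v j))// big_mkcond /=.
    by apply: eq_bigr => j _; case: ifP => jm; rewrite ?mul1r ?mul0r.
  have n2 : (n./2 <= n)%N by rewrite -divn2 leq_div.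
  rewrite /A /B !prodE//.
  have -> : series (fun n0 => \sum_(i < n0.+1) a i * b (n0 - i)%N) n =
      \sum_(i < n) \sum_(j < n) (i + j < n)%N%:R * (a i * b j).
    rewrite /series /= big_mkord (sum_triangle n (fun i j => a i * b j)).
    apply: eq_bigr => i _; rewrite big_mkcond /=; apply: eq_bigr => j _.
    by case: ifP => _; rewrite ?mul1r ?mul0r.
  rewrite -!sumrB (le_trans (ler_norm_sum _ _ _))//; apply: ler_sum => i _.
  rewrite -!sumrB (le_trans (ler_norm_sum _ _ _))//; apply: ler_sum => j _.
  rewrite -!mulrBl !normrM; apply: ler_wpM2r; first by rewrite mulr_ge0.
  rewrite !ltn_ord /=.
  have [ij|ij] := boolP ((i < n./2) && (j < n./2))%N; last first.
    by case: (_ < n)%N; rewrite ?subrr ?normr0 ?subr0 ?sub0r ?normrN ?normr1 ?ler01.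
  rewrite (_ : (i + j < n)%N = true) ?subrr ?normr0//.
  by move: ij; rewrite -!divn2; lia.
have cAB : (fun n => A n * B n - A n./2 * B n./2) @ \oo --> 0.
  rewrite -(subrr (limn A * limn B)).
  have half : (n./2)%N @[n --> \oo] --> \oo.
    move=> P [N _ NP]; exists N.*2 => // n /= Nn; apply: NP => /=.
    by rewrite -(doubleK N) half_leq.
  have cM : (fun n => A n * B n) @ \oo --> limn A * limn B by exact: cvgM.
  by apply: cvgB => //; exact: (cvg_comp _ _ half cM).
have cS : (fun n => series a n * series b n) @ \oo --> limn (series a) * limn (series b).
  by apply: cvgM; apply: normed_cvg.
rewrite -[X in _ --> X]add0r.
rewrite [X in X @ _](_ : _ = (fun n => (series (fun n => \sum_(i < n.+1) a i * b (n - i)%N) n - series a n * series b n) + series a n * series b n)); last first.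
  by apply/funext => n; rewrite subrK.
apply: cvgD => //.
apply/norm_cvg0P.
apply: (squeeze_cvgr _ (cvg_cst 0) cAB).
by near=> n; rewrite normr_ge0 key.
Unshelve. all: by end_near. Qed.

Lemma cvg_series_nneseries (u : R^nat) : (forall n, 0 <= u n) ->
  (\sum_(n <oo) (u n)%:E < +oo)%E ->
  series u @ \oo --> fine (\sum_(n <oo) (u n)%:E)%E.
Proof.
move=> u0 uoo.
have c : (fun n => (series u n)%:E) @ \oo --> (\sum_(n <oo) (u n)%:E)%E.
  rewrite [X in X @ _](_ : _ = (fun n => \sum_(0 <= i < n) (u i)%:E)%E).
    by apply: is_cvg_nneseries => n _ _; rewrite lee_fin.
  by apply/funext => n; rewrite /series /= sumEFin.
rewrite -(@fineK _ (\sum_(n <oo) (u n)%:E)%E) in c.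
  by move/fine_cvgP: c => [].
by rewrite ge0_fin_numE// nneseries_ge0// => n _ _; rewrite lee_fin.
Qed.

Lemma nneseries_EFin (u : R^nat) : (forall n, 0 <= u n) -> cvgn (series u) ->
  (\sum_(n <oo) (u n)%:E)%E = (limn (series u))%:E.
Proof.
move=> u0 cu; apply/cvg_lim => //.
rewrite (_ : (fun n => _) = EFin \o series u); last first.
  by apply/funext => n /=; rewrite /series /= sumEFin.
apply: cvg_EFin; first exact: nearW.
exact: cu.
Qed.
End cauchy_product.

Section uniformized_transition.
Context {R : realType}.
Variables (k l : nat) (lam : nat -> R) (mu : R).
Hypotheses (k0 : (0 < k)%N) (lam0 : forall i : 'I_l, 0 <= lam i.+1) (mu0 : 0 <= mu).
Let q := Lam l lam + k%:R * mu.

Let series_abs_exp (x : R) : cvgn [normed series (exp_coeff x)].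
Proof. by rewrite normed_series_exp_coeff; exact: is_cvg_series_exp_coeff. Qed.

Definition poisson_term (u : R) (y : state) (j : nat) : R :=
  u ^+ j / j`!%:R * forward k l lam mu j y.

Lemma poisson_term_ge0 u y j : 0 <= u -> 0 <= poisson_term u y j.
Proof. by move=> u0; rewrite !mulr_ge0 ?exprn_ge0 ?forward_ge0// invr_ge0. Qed.

Lemma is_cvg_series_poisson u y : 0 <= u -> cvgn (series (poisson_term u y)).
Proof.
move=> u0; apply: (series_le_cvg _ _ _ (is_cvg_series_exp_coeff (u * q))) => n.
- exact: poisson_term_ge0.
- by apply: exp_coeff_ge0; rewrite mulr_ge0// uniform_rate_ge0.
- rewrite /poisson_term /exp_coeff /= exprMn mulrAC ler_wpM2r ?invr_ge0//.
  by rewrite ler_wpM2l ?exprn_ge0// forward_le.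
Qed.

(** exp(u G) = exp(-q u) exp(u (G + q)), entry by entry: by [iter_fstep] the series [ptrans] is the
    Cauchy product of both factors. A signed series is thus replaced by one with nonnegative
    terms. *)
Lemma ptrans_uniformized u y : 0 <= u ->
  ((ptrans k l lam mu u (0, 0) y)%:E =
   (expR (- q * u))%:E * \sum_(j <oo) (poisson_term u y j)%:E)%E.
Proof.
move=> u0; rewrite nneseries_EFin; last first.
- exact: is_cvg_series_poisson.
- by move=> j; exact: poisson_term_ge0.
rewrite -EFinM mulrC; congr EFin.
have nc : cvgn [normed series (poisson_term u y)].
  rewrite (_ : [normed series _] = series (poisson_term u y)); first exact: is_cvg_series_poisson.
  by apply/funext => n; apply: eq_bigr => i _ /=; rewrite ger0_norm// poisson_term_ge0.
rewrite /expR -(cvg_lim _ (cauchy_product nc (@series_abs_exp (- q * u))))//.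
congr (lim (_ @ \oo)); apply/funext => N; rewrite /series /= big_mkord; apply: eq_bigr => j _.
rewrite iter_fstep// mulr_sumr; apply: eq_bigr => i _.
rewrite /poisson_term /exp_coeff /= exprMn.
have ij : (i <= j)%N by rewrite -ltnS.
rewrite -(bin_fact ij) !natrM -[in u ^+ j](subnKC ij) exprD.
have b0 : 'C(j,i)%:R != 0 :> R by rewrite pnatr_eq0 -lt0n bin_gt0.
by field; rewrite b0 !fact_neq0.
Qed.
End uniformized_transition.

(** * Laplace transforms *)

Section erlang_density.
Context {R : realType}.
Notation leb := (@lebesgue_measure R).

Definition exp_poly n : {poly R} := \poly_(j < n.+1) (j`!%:R^-1).

Lemma deriv_exp_poly n : poly.deriv (exp_poly n.+1) = exp_poly n.
Proof.
apply/polyP => j; rewrite coef_deriv !coef_poly ltnS.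
case: ifP => _; last by rewrite mul0rn.
rewrite -[LHS]mulr_natr factS natrM.
by field; rewrite fact_neq0 addrC natr1 pnatr_eq0.
Qed.

Lemma exp_polyS n : exp_poly n.+1 = exp_poly n + n.+1`!%:R^-1 *: 'X^(n.+1).
Proof.
apply/polyP => j; rewrite coefD coefZ coefXn !coef_poly [(j < n.+2)%N]ltnS leq_eqVlt.
by case: eqP => [->|_] /=; rewrite ?ltnn ?mulr1 ?add0r ?mulr0 ?addr0.
Qed.

Lemma is_derive_expR (y : R) : is_derive y (1 : R) expR (expR y).
Proof. by apply: DeriveDef; [exact: derivable_expR|exact: (congr1 (@^~ y) (@derive_expR R))]. Qed.

(** The derivative of [exp_poly n] is the same polynomial without its last monomial, so the product
    rule telescopes to that monomial. *)
Lemma is_derive_erlang_tail n (y : R) :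
  is_derive y (1 : R) (fun x => - ((exp_poly n).[x] * expR (- x))) (y ^+ n / n`!%:R * expR (- y)).
Proof.
have H := is_deriveN (is_deriveM (is_derive_poly (exp_poly n) y)
   (is_derive1_comp (is_derive_expR (- y)) (is_deriveN (is_derive_id y (1 : R))))).
apply: (is_derive_eq H); rewrite /GRing.scale /=.
case: n {H} => [|n].
  have -> : exp_poly 0 = 1%:P.
    by apply/polyP => j; rewrite coef_poly coefC; case: j => [|j] //=; rewrite invr1.
  by rewrite derivC !hornerC fact0 divr1 expr0; ring.
rewrite deriv_exp_poly exp_polyS !hornerE /=; ring.
Qed.

Definition erlang_weight (p : R) (n : nat) (x : R) : R := x ^+ n / n`!%:R * expR (- p * x).

Lemma erlang_weight_ge0 p n x : 0 <= x -> 0 <= erlang_weight p n x.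
Proof. by move=> x0; rewrite !mulr_ge0 ?exprn_ge0 ?expR_ge0// invr_ge0. Qed.

(** The Erlang distribution function divided by [p ^+ n.+1], that is, the primitive of
    [erlang_weight] vanishing at 0. *)
Definition erlang_cdf (p : R) n (x : R) : R :=
  (1 - (exp_poly n).[p * x] * expR (- (p * x))) / p ^+ n.+1.

Lemma is_derive_erlang_cdf p n x : p != 0 ->
  is_derive x (1 : R) (erlang_cdf p n) (erlang_weight p n x).
Proof.
move=> p0.
have H := is_deriveZ (p ^- n.+1) (is_deriveD (is_derive_cst (1 : R) x (1 : R))
  (is_derive1_comp (is_derive_erlang_tail n (p * x)) (is_deriveZ p (is_derive_id x (1 : R))))).
rewrite (_ : erlang_cdf p n = p ^- n.+1 \*: (cst (1 : R) +
    ((fun y => - ((exp_poly n).[y] * expR (- y))) \o (p \*: id)))); last first.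
  by apply/funext => y; rewrite /erlang_cdf mulrC.
apply: (is_derive_eq H); rewrite /GRing.scale /= add0r mulr1 /erlang_weight.
have P0 : p ^+ n != 0 by rewrite expf_neq0.
rewrite mulNr exprMn exprS; move: (p ^+ n) P0 => P P0.
by field; rewrite fact_neq0 p0 P0.
Qed.

Lemma erlang_cdf0 (p : R) n : erlang_cdf p n 0 = 0.
Proof.
rewrite /erlang_cdf mulr0 oppr0 expR0 mulr1.
rewrite horner_coef0 coef_poly /= invr1 subrr mul0r.
by [].
Qed.

Lemma continuous_erlang_weight p n : continuous (erlang_weight p n).
Proof.
move=> x; apply: differentiable_continuous; apply/derivable1_diffP.
have [H _] := is_deriveM (is_derive_poly (n`!%:R^-1 *: 'X^n) x)
  (is_derive1_comp (is_derive_expR (- p * x)) (is_deriveZ (- p) (is_derive_id x (1 : R)))).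
rewrite (_ : erlang_weight p n = horner (n`!%:R^-1 *: 'X^n) * (expR \o (- p \*: id))) //.
by apply/funext => y; rewrite /erlang_weight /= !fctE hornerZ hornerXn mulrC [in RHS]mulrC [_ / _]mulrC.
Qed.

Lemma integral_erlang_weight (p : R) n (u : R) : p != 0 -> 0 <= u ->
  (\int[leb]_(x in `[0%R, u]) (erlang_weight p n x)%:E = (erlang_cdf p n u)%:E)%E.
Proof.
move=> p0; rewrite le_eqVlt => /predU1P[<-|u0].
  by rewrite set_itv1 integral_set1 erlang_cdf0.
have dF x : derivable (erlang_cdf p n) x 1 by have [] := is_derive_erlang_cdf n x p0.
have cF : continuous (erlang_cdf p n).
  by move=> x; apply: differentiable_continuous; apply/derivable1_diffP.
rewrite (@continuous_FTC2 _ _ (erlang_cdf p n))//.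
- by rewrite erlang_cdf0 sube0.
- exact/continuous_subspaceT/continuous_erlang_weight.
- split => // [|]; [exact/cvg_at_right_filter/cF|exact/cvg_at_left_filter/cF].
- by move=> x _; rewrite derive1E; have [_ ->] := is_derive_erlang_cdf n x p0.
Qed.

Lemma cvg_exp_poly_tail n : (exp_poly n).[x] * expR (- x) @[x --> +oo] --> (0 : R).
Proof.
have mono m : x ^+ m / m`!%:R * expR (- x) @[x --> +oo] --> (0 : R).
  apply/cvgrPdist_le => e e0; near=> x.
  have x0 : 0 < x by near: x; exact: nbhs_pinfty_gt.
  rewrite sub0r normrN ger0_norm; last by rewrite !mulr_ge0 ?exprn_ge0 ?expR_ge0 ?invr_ge0// ltW.
  (* The next monomial of the exponential series is at most exp(x), so this one times exp(-x) is
     O(1/x). *)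
  have := expR_ge1Dxn m (ltW x0).
  rewrite -(ler_pM2r (expR_gt0 (- x))) -expRD subrr expR0 => H.
  have {}H : x ^+ m.+1 / m.+1`!%:R * expR (- x) <= 1.
    by apply: le_trans H; rewrite ler_wpM2r ?expR_ge0// lerDr.
  have -> : x ^+ m / m`!%:R * expR (- x) = m.+1%:R / x * (x ^+ m.+1 / m.+1`!%:R * expR (- x)).
    by rewrite factS natrM exprS; field; rewrite fact_neq0 addrC natr1 pnatr_eq0 (gt_eqF x0).
  apply: (@le_trans _ _ (m.+1%:R / x * 1)).
    by rewrite ler_wpM2l// divr_ge0// ltW.
  rewrite mulr1 ler_pdivrMr// mulrC -ler_pdivrMr//.
elim: n => [|n IH].
  rewrite (_ : (fun x => _) = (fun x => x ^+ 0 / 0`!%:R * expR (- x))); first exact: mono.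
  apply/funext => x; rewrite (_ : exp_poly 0 = 1%:P) ?hornerC ?fact0 ?divr1//.
  by apply/polyP => j; rewrite coef_poly coefC; case: j => [|j] //=; rewrite invr1.
rewrite (_ : (fun x => _) = (fun x => (exp_poly n).[x] * expR (- x) + x ^+ n.+1 / n.+1`!%:R * expR (- x))).
  by rewrite -(addr0 0); apply: cvgD => //; exact: mono.
by apply/funext => x; rewrite exp_polyS !hornerE /=; ring.
Unshelve. all: by end_near. Qed.

Lemma integral_erlang_weight_tail (p : R) n (a : R) : 0 < p -> 0 <= a ->
  (\int[leb]_(x in `[a, +oo[) (erlang_weight p n x)%:E =
   (p ^- n.+1 - erlang_cdf p n a)%:E)%E.
Proof.
move=> p0 a0; have pn0 : p != 0 by rewrite gt_eqF.
have dF x : derivable (erlang_cdf p n) x 1 by have [] := is_derive_erlang_cdf n x pn0.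
have cF : continuous (erlang_cdf p n).
  by move=> x; apply: differentiable_continuous; apply/derivable1_diffP.
rewrite (@ge0_continuous_FTC2y _ _ (erlang_cdf p n) _ (p ^- n.+1))//.
- by move=> x ax; apply: erlang_weight_ge0; exact: le_trans ax.
- exact/continuous_subspaceT/continuous_erlang_weight.
- have : erlang_cdf p n x @[x --> +oo] --> (1 - 0) / p ^+ n.+1; last by rewrite subr0 mul1r.
  rewrite /erlang_cdf; apply: cvgMr_tmp; apply: cvgB; first exact: cvg_cst.
  exact: (cvg_comp _ _ (gt0_cvgMry p0 (@cvg_id _ _)) (@cvg_exp_poly_tail n)).
- exact/cvg_at_right_filter/cF.
- by move=> x _; rewrite derive1E; have [_ ->] := is_derive_erlang_cdf n x pn0.
Qed.

Lemma integral_erlang_weighty (p : R) n : 0 < p ->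
  (\int[leb]_(x in `[0%R, +oo[) (erlang_weight p n x)%:E = (p ^- n.+1)%:E)%E.
Proof. by move=> p0; rewrite integral_erlang_weight_tail// erlang_cdf0 subr0. Qed.
End erlang_density.

(** * The Gamma integral *)

Section gamma_function.
Context {R : realType}.
Notation leb := (@lebesgue_measure R).

Lemma cvg_powR_right (r t : R) : 0 <= r -> 0 <= t -> powR x r @[x --> t^'+] --> powR t r.
Proof.
move=> r0; rewrite le_eqVlt => /predU1P[<-|t0].
  move: r0; rewrite le_eqVlt => /predU1P[<-|r0].
    by rewrite powRr0; under eq_fun do rewrite powRr0; exact: cvg_cst.
  by rewrite powR0 ?gt_eqF//; exact: powR_cvg0.
apply: cvg_at_right_filter.
have t1 : t \in `]0, +oo[ by rewrite in_itv/= t0.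
by have /derivable1_diffP/differentiable_continuous := @derivable_powR R 1 r t t1.
Qed.

Lemma powR_le_1Dexpn (x r : R) n : 0 <= x -> 0 <= r -> r <= n%:R -> powR x r <= 1 + x ^+ n.
Proof.
move=> x0 r0 rn; have [x1|x1] := leP x 1.
  have e1 : powR 1 r = 1 :> R by rewrite powR1.
  rewrite -[leLHS]addr0 lerD ?exprn_ge0// -[leRHS]e1.
  by rewrite ge0_ler_powR// nnegrE.
rewrite -[leLHS]add0r lerD// -powR_mulrn//.
by rewrite ler_powR// ltW.
Qed.

Lemma measurable_gamma_integrand (p r : R) (D : set R) :
  measurable_fun D (fun x : R => powR x r * expR (- p * x)).
Proof.
apply: measurable_funTS; apply: measurable_funM; first exact: measurable_powR.
apply: measurableT_comp => //; exact: mulrl_measurable.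
Qed.

(** [Gamma] is defined through [fine], so the integral is recovered only after it is known to be
    finite: x^(a-1) <= 1 + x^n for an integer n >= a - 1. All arguments that occur are at least 1,
    which keeps the integrand bounded near 0. *)
Lemma GammaE (a : R) : 1 <= a ->
  ((Gamma a)%:E = \int[leb]_(x in `[0%R, +oo[) (powR x (a - 1) * expR (- 1 * x))%:E)%E.
Proof.
move=> a1; rewrite /Gamma.
under eq_integral => x _ do rewrite -(mulN1r x).
rewrite integral_itv_obnd_cbnd; last first.
  by apply/measurable_EFinP; exact: measurable_gamma_integrand.
rewrite fineK// ge0_fin_numE; last first.
  by apply: integral_ge0 => x _; rewrite lee_fin mulr_ge0 ?powR_ge0 ?expR_ge0.
set n := (Num.truncn (a - 1)).+1.
have an : a - 1 <= n%:R by rewrite ltW// truncnS_gt.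
have mw m : measurable_fun (`[0%R, +oo[%classic : set R) (fun x : R => (erlang_weight 1 m x)%:E).
  apply/measurable_EFinP; apply: measurable_funTS; apply: continuous_measurable_fun.
  exact: continuous_erlang_weight.
have w0 m (x : R) : `[0%R, +oo[%classic x -> (0 <= (erlang_weight (1 : R) m x)%:E)%E.
  by rewrite /= in_itv/= andbT => x0; rewrite lee_fin erlang_weight_ge0.
apply: (@le_lt_trans _ _ (\int[leb]_(x in `[0%R, +oo[)
    ((erlang_weight 1 0 x)%:E + n`!%:R%:E * (erlang_weight 1 n x)%:E))%E).
  apply: ge0_le_integral => //.
  - by move=> x _; rewrite lee_fin mulr_ge0 ?powR_ge0 ?expR_ge0.
  - by apply/measurable_EFinP; exact: measurable_gamma_integrand.
  - by apply: emeasurable_funD; [exact: mw|apply: measurable_funeM; exact: mw].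
  - move=> x; rewrite /= in_itv/= andbT => x0.
    rewrite lee_fin [leRHS](_ : _ = (1 + x ^+ n) * expR (- 1 * x)); last first.
      by rewrite /erlang_weight fact0 expr0; field; rewrite fact_neq0.
    by rewrite ler_wpM2r ?expR_ge0// powR_le_1Dexpn// subr_ge0.
rewrite ge0_integralD//=; [|exact: w0|exact: mw| |]; last 2 first.
- by move=> x x0; rewrite mule_ge0// w0.
- by apply: measurable_funeM; exact: mw.
rewrite ge0_integralZl_EFin//=; [|exact: w0|exact: mw].
by rewrite !integral_erlang_weighty// -EFinM -EFinD ltry.
Qed.

Lemma Gamma_gt0 (a : R) : 1 <= a -> 0 < Gamma a.
Proof.
move=> a1; rewrite -lte_fin GammaE//.
(* On [1, 2] the integrand is at least exp(-2). *)
apply: (@lt_le_trans _ _ (\int[leb]_(x in `[1%R, 2%R]) (expR (- 2))%:E)%E).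
  rewrite integral_cst//= lebesgue_measure_itv/= lte_fin ltr1n.
  by rewrite -EFinB -EFinM lte_fin mulr_gt0 ?expR_gt0// subr_gt0 ltr1n.
apply: (@le_trans _ _ (\int[leb]_(x in `[1%R, 2%R]) (powR x (a - 1) * expR (- 1 * x))%:E)%E).
  apply: ge0_le_integral => //=.
  - by apply/measurable_EFinP; exact: measurable_gamma_integrand.
  - move=> x; rewrite in_itv/= => /andP[x1 x2].
    rewrite lee_fin -[leLHS]mul1r ler_pM ?expR_ge0// ?ler_expR ?mulN1r ?lerN2//.
    have e1 : powR 1 (a - 1) = 1 :> R by rewrite powR1.
    by rewrite -[leLHS]e1 ge0_ler_powR// ?nnegrE ?subr_ge0// (le_trans _ x1).
apply: ge0_subset_integral => //=.
- by apply/measurable_EFinP; exact: measurable_gamma_integrand.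
- by move=> x _; rewrite lee_fin mulr_ge0 ?powR_ge0 ?expR_ge0.
- by move=> x /=; rewrite !in_itv/= => /andP[x1 _]; rewrite andbT (le_trans _ x1).
Qed.

Lemma Gamma_nat n : Gamma n.+1%:R = n`!%:R :> R.
Proof.
apply: EFin_inj; rewrite GammaE ?ler1n//.
transitivity (\int[leb]_(x in `[0%R, +oo[) (n`!%:R%:E * (erlang_weight 1 n x)%:E))%E.
  apply: eq_integral => x; rewrite inE/= in_itv/= andbT => x0.
  rewrite -natr1 addrK powR_mulrn// -EFinM /erlang_weight mulrA mulrCA divff ?fact_neq0//.
  by rewrite mulr1.
rewrite ge0_integralZl_EFin//=.
- by rewrite integral_erlang_weighty// expr1n invr1 mule1.
- by move=> x; rewrite in_itv/= andbT => x0; rewrite lee_fin erlang_weight_ge0.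
- apply/measurable_EFinP; apply: measurable_funTS; apply: continuous_measurable_fun.
  exact: continuous_erlang_weight.
Qed.

Lemma Gamma_scale (a p : R) : 1 <= a -> 0 < p ->
  (\int[leb]_(x in `[0%R, +oo[) (powR x (a - 1) * expR (- p * x))%:E = (Gamma a / powR p a)%:E)%E.
Proof.
move=> a1 p0.
have dF : (fun x : R => p * x)^`()%classic = cst p.
  by apply/funext => x; rewrite derive1Ml// derive1_id mulr1.
have pa0 : 0 < powR p a by rewrite powR_gt0.
set G := fun x : R => powR x (a - 1) * expR (- 1 * x).
have a10 : 0 <= a - 1 by rewrite subr_ge0.
have cexp : continuous (fun x : R => expR (- 1 * x)).
  move=> x; apply: continuous_comp; first exact: mulrl_continuous.
  exact: continuous_expR.
have cG : {within `[0, +oo[, continuous G}.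
  apply/continuous_within_itvcyP; split.
    move=> x; rewrite in_itv/= andbT => x0; apply: cvgM; last exact: cexp.
    have x1 : x \in `]0, +oo[ by rewrite in_itv/= x0.
    by have /derivable1_diffP/differentiable_continuous := @derivable_powR R 1 (a - 1) x x1.
  by apply: cvgM; [exact: cvg_powR_right|apply: cvg_at_right_filter; exact: cexp].
have E : ((Gamma a)%:E = (powR p a)%:E *
    \int[leb]_(x in `[0%R, +oo[) (powR x (a - 1) * expR (- p * x))%:E)%E.
  transitivity (\int[leb]_(x in `[(p * 0)%R, +oo[) (G x)%:E)%E.
    by rewrite mulr0 GammaE.
  rewrite (@increasing_ge0_integration_by_substitutiony R (fun x => p * x) G 0).
  - rewrite -ge0_integralZl_EFin//=.
    + apply: eq_integral => x; rewrite inE/= in_itv/= andbT => x0.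
      rewrite -EFinM dF !fctE /= /G powRM ?(ltW p0)// mulN1r mulNr.
      rewrite -(mulr_powRB1 (ltW p0) (lt_le_trans ltr01 a1)).
      by congr EFin; ring.
    + by move=> x _; rewrite lee_fin mulr_ge0 ?powR_ge0 ?expR_ge0.
    + by apply/measurable_EFinP; exact: measurable_gamma_integrand.
    + exact: ltW.
  - by move=> x y _ _ xy; rewrite ltr_pM2l.
  - by move=> x _; rewrite dF; exact: cvg_cst.
  - by rewrite dF; apply: is_cvg_cst.
  - by rewrite dF; apply: is_cvg_cst.
  - split; first by move=> x _; apply: ex_derive.
    by apply: cvg_at_right_filter; apply: cvgMl_tmp.
  - exact: gt0_cvgMry.
  - by rewrite mulr0.
  - by move=> x _; rewrite mulr_ge0 ?powR_ge0 ?expR_ge0.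
rewrite EFinM E muleC muleA -EFinM mulVf ?mul1e//.
by rewrite gt_eqF.
Qed.
End gamma_function.

(** * Uniqueness of the Laplace transform *)

Section laplace_uniqueness.
Context {R : realType}.
Notation leb := (@lebesgue_measure R).
Local Notation Rp := (`[0%R, +oo[%classic : set R).

Lemma one_sub_expn_ge (x : R) N : 0 <= x <= 1 -> 1 - N%:R * x <= (1 - x) ^+ N.
Proof.
move=> /andP[x0 x1]; elim: N => [|N IH]; first by rewrite mul0r subr0.
rewrite exprSr; apply: (@le_trans _ _ ((1 - N%:R * x) * (1 - x))); last first.
  by rewrite ler_wpM2r// subr_ge0.
rewrite -natr1 -subr_ge0 (_ : _ - _ = N%:R * x ^+ 2); first by rewrite mulr_ge0// sqr_ge0.
by ring.
Qed.

Lemma one_sub_expn_le (x : R) N : 0 <= x <= 1 -> (1 - x) ^+ N <= expR (- (N%:R * x)).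
Proof.
move=> /andP[x0 x1]; rewrite -mulrN expRM_natl lerXn2r ?nnegrE ?expR_ge0 ?subr_ge0//.
exact: expR_ge1Dx.
Qed.

(* The kernel converges to the indicator of (T, +oo) and is a polynomial in exp(-nt). *)
Definition step_kernel (T : R) (n : nat) (t : R) : R :=
  (1 - expR (- n%:R * t)) ^+ Num.truncn (expR (n%:R * T)).

Lemma step_kernel_01 T n t : 0 <= t -> 0 <= step_kernel T n t <= 1.
Proof.
move=> t0; have e1 : expR (- n%:R * t) <= 1 by rewrite expR_le1 mulNr oppr_le0 mulr_ge0.
by rewrite exprn_ge0 ?subr_ge0//= exprn_ile1// ?subr_ge0// gerBl expR_ge0.
Qed.

(** With x = exp(-n t) and N close to exp(n T), the product N x is about exp(n (T - t)). For t < T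
    it is at least n (T - t), and the kernel is at most exp(-N x); for t > T it is at most exp(-n (t
    - T)), and Bernoulli's inequality applies. *)
Lemma step_kernel_err T n t : 0 <= t -> t != T ->
  `|step_kernel T n t - (T < t)%R%:R| <= expR (- `|t - T|) ^+ n.
Proof.
move=> t0 tT; have /andP[k0 k1] := step_kernel_01 T n t0.
set x := expR (- n%:R * t); have x0 : 0 <= x <= 1.
  by rewrite expR_ge0 expR_le1 mulNr oppr_le0 mulr_ge0.
have [N1 N2] : (Num.truncn (expR (n%:R * T)))%:R <= expR (n%:R * T) /\
    expR (n%:R * T) < (Num.truncn (expR (n%:R * T)))%:R + 1.
  have := truncn_itv (expR_ge0 (n%:R * T)).
  by rewrite -natr1 => /andP[].
set N := (Num.truncn _)%:R in N1 N2.
have NE : expR (n%:R * T) * x = expR (n%:R * (T - t)).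
  by rewrite /x -expRD; congr expR; ring.
rewrite -expRM_natl; have [tT'|Tt|tT'] := ltgtP t T; last by rewrite tT' eqxx in tT.
- rewrite subr0 ger0_norm// (le_trans (one_sub_expn_le _ x0))// ler_expR mulrN lerN2.
  rewrite -/N distrC ger0_norm ?subr_ge0 ?(ltW tT')//.
  have : (expR (n%:R * T) - 1) * x <= N * x.
    by rewrite ler_wpM2r ?(andP x0).1// lerBlDr ltW.
  apply: le_trans; rewrite mulrBl NE mul1r.
  have := expR_ge1Dx (n%:R * (T - t)); move: x0 => /andP[_]; lra.
- rewrite distrC ger0_norm ?subr_ge0// ger0_norm ?subr_ge0 ?(ltW Tt)//.
  rewrite lerBlDr -lerBlDl; apply: le_trans (one_sub_expn_ge _ x0); rewrite -/N lerB//.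
  rewrite mulrN -mulrN opprB -NE ler_wpM2r// (andP x0).1//.
Qed.

Lemma step_kernel_cvg T t : 0 <= t -> t != T ->
  step_kernel T n t @[n --> \oo] --> ((T < t)%R%:R : R).
Proof.
move=> t0 tT; apply/cvgrPdist_le => e e0.
have e1 : `|expR (- `|t - T|)| < 1.
  by rewrite ger0_norm ?expR_ge0// expR_lt1 oppr_lt0 normr_gt0 subr_eq0.
have := cvg_expr e1 => /cvgrPdist_le/(_ _ e0).
apply: filterS => n; rewrite sub0r normrN ger0_norm ?exprn_ge0 ?expR_ge0// => ne.
by rewrite distrC (le_trans (step_kernel_err n t0 tT)).
Qed.

(** A factor exp(-n t) shifts s to s + n, so equality for all [s0 <= s] carries over to polynomials
    in exp(-n t); hence s is general in the induction. *)
Lemma laplace_poly (A B : R -> R) (s0 : R) (n : nat) :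
  (forall s, s0 <= s -> leb.-integrable Rp (fun t => (expR (- s * t) * A t)%:E)) ->
  (forall s, s0 <= s -> leb.-integrable Rp (fun t => (expR (- s * t) * B t)%:E)) ->
  (forall s, s0 <= s -> (\int[leb]_(t in Rp) (expR (- s * t) * A t)%:E =
                         \int[leb]_(t in Rp) (expR (- s * t) * B t)%:E)%E) ->
  forall (p : {poly R}) s, s0 <= s ->
  [/\ leb.-integrable Rp (fun t => (p.[expR (- n%:R * t)] * (expR (- s * t) * A t))%:E),
      leb.-integrable Rp (fun t => (p.[expR (- n%:R * t)] * (expR (- s * t) * B t))%:E) &
      (\int[leb]_(t in Rp) (p.[expR (- n%:R * t)] * (expR (- s * t) * A t))%:E =
       \int[leb]_(t in Rp) (p.[expR (- n%:R * t)] * (expR (- s * t) * B t))%:E)%E].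
Proof.
move=> iA iB AB; elim/poly_ind => [|p c IH] s s0s.
  have E0 (F : R -> R) : (fun t => (0.[expR (- n%:R * t)] * (expR (- s * t) * F t))%:E) = cst 0%E.
    by apply/funext => t; rewrite horner0 mul0r.
  by rewrite !E0; split => //; exact: integrable0.
have s0sn : s0 <= s + n%:R by rewrite (le_trans s0s)// lerDl.
have [I1 I2 I3] := IH _ s0sn.
have E (F : R -> R) : (fun t => ((p * 'X + c%:P).[expR (- n%:R * t)] * (expR (- s * t) * F t))%:E) =
  (fun t => (p.[expR (- n%:R * t)] * (expR (- (s + n%:R) * t) * F t))%:E + c%:E * (expR (- s * t) * F t)%:E)%E.
  apply/funext => t; rewrite -EFinM -EFinD hornerD hornerMX hornerC.
  have -> : expR (- (s + n%:R) * t) = expR (- s * t) * expR (- n%:R * t).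
    by rewrite -expRD; congr expR; ring.
  by congr EFin; ring.
rewrite !E; split.
- by apply: integrableD => //; apply: integrableZl => //; exact: iA.
- by apply: integrableD => //; apply: integrableZl => //; exact: iB.
- rewrite !integralD//=; [|by apply: integrableZl => //; exact: iB|by apply: integrableZl => //; exact: iA].
  by rewrite I3 !integralZl ?AB//; [exact: iB|exact: iA].
Qed.

Lemma step_kernel_poly T n : exists p : {poly R}, forall t, step_kernel T n t = p.[expR (- n%:R * t)].
Proof.
by exists ((1 - 'X) ^+ Num.truncn (expR (n%:R * T))) => t; rewrite !hornerE.
Qed.

Lemma measurable_step (T : R) (D : set R) : measurable_fun D (fun t => (T < t)%R%:R : R).
Proof.
rewrite (_ : (fun t => _) = \1_(`]T, +oo[%classic)); first exact: measurable_indic.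
by apply/funext => t; rewrite indicE mem_setE in_itv/= andbT.
Qed.

(** Limit of [laplace_poly] along [step_kernel]. Since the kernel lies in [0, 1], the integrand
    itself is the dominating function; the single point T is null. *)
Lemma laplace_tail (A B : R -> R) (s0 T : R) :
  (forall s, s0 <= s -> leb.-integrable Rp (fun t => (expR (- s * t) * A t)%:E)) ->
  (forall s, s0 <= s -> leb.-integrable Rp (fun t => (expR (- s * t) * B t)%:E)) ->
  (forall s, s0 <= s -> (\int[leb]_(t in Rp) (expR (- s * t) * A t)%:E =
                         \int[leb]_(t in Rp) (expR (- s * t) * B t)%:E)%E) ->
  (\int[leb]_(t in Rp) ((T < t)%R%:R * (expR (- s0 * t) * A t))%:E =
   \int[leb]_(t in Rp) ((T < t)%R%:R * (expR (- s0 * t) * B t))%:E)%E.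
Proof.
move=> iA iB AB.
have lim (F : R -> R) : leb.-integrable Rp (fun t => (expR (- s0 * t) * F t)%:E) ->
  (\int[leb]_(t in Rp) (step_kernel T n t * (expR (- s0 * t) * F t))%:E)%E @[n --> \oo] -->
  (\int[leb]_(t in Rp) ((T < t)%R%:R * (expR (- s0 * t) * F t))%:E)%E.
  move=> iF.
  have mF : measurable_fun Rp (fun t => expR (- s0 * t) * F t).
    by apply/measurable_EFinP; move/integrableP : iF => [].
  have [] // := @dominated_convergence _ _ R leb Rp (measurable_itv _)
    (fun n t => (step_kernel T n t * (expR (- s0 * t) * F t))%:E)
    (fun t => ((T < t)%R%:R * (expR (- s0 * t) * F t))%:E)
    (fun t => `|(expR (- s0 * t) * F t)%:E|)%E.
  - move=> n; apply/measurable_EFinP; apply: measurable_funM => //.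
    apply: measurable_funX; apply: measurable_funB => //; apply: measurableT_comp => //.
  - by apply/measurable_EFinP; apply: measurable_funM => //; exact: measurable_step.
  - exists [set T]; split => //; first exact: lebesgue_measure_set1.
    move=> t /=; apply: contra_notP => /eqP tT; rewrite in_itv/= andbT => t0.
    apply: cvg_EFin; first exact: nearW.
    by apply: cvgMr_tmp; exact: step_kernel_cvg.
  - exact: integrable_abse.
  - apply: aeW => t n; rewrite /= in_itv/= andbT => t0.
    rewrite lee_fin normrM ler_piMl// ger0_norm; have /andP[] // := step_kernel_01 T n t0.
have LA := lim _ (iA _ (lexx _)); have LB := lim _ (iB _ (lexx _)).
have E n : (\int[leb]_(t in Rp) (step_kernel T n t * (expR (- s0 * t) * A t))%:E =
   \int[leb]_(t in Rp) (step_kernel T n t * (expR (- s0 * t) * B t))%:E)%E.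
  have [p pE] := step_kernel_poly T n.
  have [_ _] := laplace_poly n iA iB AB p (lexx _).
  by under eq_integral do rewrite -pE; under [in RHS]eq_integral do rewrite -pE.
by move: LA; rewrite (funext E) => LA; exact: (cvg_unique _ LA LB).
Qed.

(** If B exceeded A at t, it would do so by a fixed amount just to the right of t, and a difference
    of two tail integrals isolates an interval there. *)
Lemma laplace_inj_le (A B : R -> R) (s0 t : R) : 0 <= t ->
  (forall s, s0 <= s -> leb.-integrable Rp (fun t => (expR (- s * t) * A t)%:E)) ->
  (forall s, s0 <= s -> leb.-integrable Rp (fun t => (expR (- s * t) * B t)%:E)) ->
  (forall s, s0 <= s -> (\int[leb]_(t in Rp) (expR (- s * t) * A t)%:E =
                         \int[leb]_(t in Rp) (expR (- s * t) * B t)%:E)%E) ->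
  A x @[x --> t^'+] --> A t -> B x @[x --> t^'+] --> B t -> B t <= A t.
Proof.
move=> t0 iA iB AB rA rB; rewrite leNgt; apply/negP => AtB.
(* Both functions may move by e and still leave a gap of e. *)
set e := (B t - A t) / 3; have e0 : 0 < e by rewrite divr_gt0// subr_gt0.
have [d d0 dAB] : exists2 d : R, 0 < d & forall x, t < x < t + d -> A x + e <= B x.
  move/cvgrPdist_le : (rA) => /(_ _ e0) rA'; move/cvgrPdist_le : (rB) => /(_ _ e0) rB'.
  have : \forall x \near t^'+, A x + e <= B x.
    near=> x; have : `|A t - A x| <= e by near: x.
    have : `|B t - B x| <= e by near: x.
    rewrite !ler_norml => /andP[b1 b2] /andP[a1 a2].
    by move: b2 a1; rewrite /e; lra.
  rewrite near_withinE => -[d /= d0 H]; exists d => // x /andP[tx xd].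
  apply: H => //=; rewrite ltr0_norm; lra.
pose T1 := t + d / 3; pose T2 := t + d / 2.
have T12 : T1 < T2 by rewrite ltrD2l ltr_pM2l// ltf_pV2 ?posrE// ltr_nat.
have iT (T : R) (F : R -> R) : leb.-integrable Rp (fun t => (expR (- s0 * t) * F t)%:E) ->
    leb.-integrable Rp (fun t => ((T < t)%R%:R * (expR (- s0 * t) * F t))%:E).
  move=> iF; apply: (le_integrable _ _ _ iF) => //.
    apply/measurable_EFinP; apply: measurable_funM; first exact: measurable_step.
    by apply/measurable_EFinP; move/integrableP : iF => [].
  move=> x _; rewrite lee_fin normrM ler_piMl//.
  by case: (T < x); rewrite ?normr1 ?normr0.
have iA0 := iA _ (lexx s0); have iB0 := iB _ (lexx s0).
(* This is exp(-s0 x) (B x - A x) restricted to the interval ]T1, T2]. *)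
pose h x := ((T1 < x)%R%:R * (expR (- s0 * x) * B x) - (T1 < x)%R%:R * (expR (- s0 * x) * A x))
  - ((T2 < x)%R%:R * (expR (- s0 * x) * B x) - (T2 < x)%R%:R * (expR (- s0 * x) * A x)).
have h0 : (\int[leb]_(x in Rp) (h x)%:E = 0)%E.
  rewrite /h; under eq_integral do rewrite EFinB 2!EFinB.
  have E T := laplace_tail T iA iB AB.
  have iAB T : leb.-integrable Rp (fun x => ((T < x)%R%:R * (expR (- s0 * x) * B x))%:E -
      ((T < x)%R%:R * (expR (- s0 * x) * A x))%:E)%E.
    by apply: integrableB => //; exact: iT.
  have EAB T : (\int[leb]_(x in Rp) (((T < x)%R%:R * (expR (- s0 * x) * B x))%:E -
      ((T < x)%R%:R * (expR (- s0 * x) * A x))%:E) = 0)%E.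
    rewrite integralB// ?E ?subee//; [|exact: iT|exact: iT].
    by apply: integrable_fin_num => //; exact: iT.
  by rewrite integralB// !EAB sube0.
have mh : measurable_fun Rp h.
  have mF (F : R -> R) : leb.-integrable Rp (fun t => (expR (- s0 * t) * F t)%:E) ->
      measurable_fun Rp (fun t => expR (- s0 * t) * F t).
    by move=> /integrableP[/measurable_EFinP].
  by apply: measurable_funB; apply: measurable_funB; apply: measurable_funM;
    [exact: measurable_step|exact: mF|exact: measurable_step|exact: mF|
     exact: measurable_step|exact: mF|exact: measurable_step|exact: mF].
(* A lower bound of h on that interval, for [s0] of either sign. *)
set c1 := e * expR (- (`|s0| * T2)).
have hc x : T1 < x <= T2 -> c1 <= h x.
  move=> /andP[T1x xT2]; rewrite /h T1x (ltNge T2) xT2 /= !mul1r !mul0r !subr0 -mulrBr.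
  have tx : t < x < t + d by rewrite /T1 /T2 in T1x xT2; lra.
  rewrite /c1 mulrC; apply: ler_pM; rewrite ?expR_ge0 ?(ltW e0)//.
    rewrite ler_expR mulNr lerN2; apply: (@le_trans _ _ (`|s0| * x)).
      by rewrite ler_wpM2r ?ler_norm// (le_trans t0)// ltW//; case/andP: tx.
    by rewrite ler_wpM2l.
  by have := dAB _ tx; lra.
have hp x : Rp x -> (0 <= (h x)%:E)%E.
  move=> _; rewrite lee_fin; have [T1x|xT1] := ltP T1 x; last first.
    by rewrite /h !ltNge xT1 (le_trans xT1 (ltW T12)) /= !mul0r !subrr.
  have [T2x|xT2] := ltP T2 x; first by rewrite /h T1x T2x subrr.
  apply: le_trans (hc x _); last by rewrite T1x.
  by rewrite mulr_ge0 ?expR_ge0// ltW.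
have : (\int[leb]_(x in `]T1, T2]) c1%:E <= \int[leb]_(x in Rp) (h x)%:E)%E.
  apply: (@le_trans _ _ (\int[leb]_(x in `]T1, T2]) (h x)%:E)%E); last first.
    apply: ge0_subset_integral => //; first exact/measurable_EFinP.
    move=> x /=; rewrite !in_itv/= andbT => /andP[T1x _].
    by rewrite (le_trans _ (ltW T1x))// /T1; lra.
  apply: ge0_le_integral => //.
  - by move=> x _; rewrite lee_fin mulr_ge0 ?expR_ge0// ltW.
  - apply/measurable_EFinP; apply: measurable_funS mh => //.
    move=> x /=; rewrite !in_itv/= andbT => /andP[T1x _].
    by rewrite (le_trans _ (ltW T1x))// /T1; lra.
rewrite h0 integral_cst//= lebesgue_measure_itv/= lte_fin T12 -EFinB -EFinM lee_fin.
by apply/negP; rewrite -ltNge mulr_gt0 ?mulr_gt0 ?expR_gt0 ?subr_gt0.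
Unshelve. all: by end_near. Qed.

Lemma laplace_inj (A B : R -> R) (s0 t : R) : 0 <= t ->
  (forall s, s0 <= s -> leb.-integrable Rp (fun t => (expR (- s * t) * A t)%:E)) ->
  (forall s, s0 <= s -> leb.-integrable Rp (fun t => (expR (- s * t) * B t)%:E)) ->
  (forall s, s0 <= s -> (\int[leb]_(t in Rp) (expR (- s * t) * A t)%:E =
                         \int[leb]_(t in Rp) (expR (- s * t) * B t)%:E)%E) ->
  A x @[x --> t^'+] --> A t -> B x @[x --> t^'+] --> B t -> A t = B t.
Proof.
move=> t0 iA iB AB rA rB; apply/eqP; rewrite eq_le; apply/andP; split.
  by apply: (laplace_inj_le t0 iB iA _ rB rA) => s s0s; rewrite AB.
exact: (laplace_inj_le t0 iA iB AB rA rB).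
Qed.
End laplace_uniqueness.

(** * Series of monotone functions *)

Section monotone_series.
Context {R : realType}.
Notation leb := (@lebesgue_measure R).
Local Notation Rp := (`[0%R, +oo[%classic : set R).

Lemma fine_nneseries (u : R^nat) N : (forall n, 0 <= u n) ->
  (\sum_(n <oo) (u n)%:E < +oo)%E ->
  fine (\sum_(n <oo) (u n)%:E)%E =
  \sum_(n < N) u n + fine (\sum_(N <= n <oo) (u n)%:E)%E.
Proof.
move=> u0 uoo.
have spl := @nneseries_split _ (fun n => (u n)%:E) 0 N (fun k _ => u0 k).
rewrite spl add0n big_mkord sumEFin fineD//.
have tail0 : (0 <= \sum_(N <= n <oo) (u n)%:E)%E.
  by apply: nneseries_ge0 => n _ _; rewrite lee_fin.
rewrite ge0_fin_numE//; apply: le_lt_trans uoo; rewrite spl add0n leeDr//.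
by rewrite big_mkord sume_ge0// => i _; rewrite lee_fin.
Qed.

Lemma measurable_nneseries d (T : measurableType d) (D : set T) (h : nat -> T -> \bar R) :
  (forall n x, D x -> (0 <= h n x)%E) -> (forall n, measurable_fun D (h n)) ->
  measurable_fun D (fun x => \sum_(n <oo) h n x)%E.
Proof.
move=> h0 mh.
rewrite (_ : (fun x => _) = (fun x => \sum_(n <oo | n \in predT) h n x)%E).
  by apply: ge0_emeasurable_sum => [n x Dx _|n _]; [exact: h0|exact: mh].
by apply/funext => x; apply: eq_eseriesl.
Qed.

(** As the terms increase, the tail at T bounds the tails at all points up to T: finiteness at one
    point further right makes the convergence uniform. *)
Lemma nondecreasing_series_right_continuous (u : nat -> R -> R) (t T : R) : 0 <= t -> t < T ->
  (forall n x, 0 <= x -> 0 <= u n x) ->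
  (forall n x y, 0 <= x -> x <= y -> u n x <= u n y) ->
  (forall n, u n x @[x --> t^'+] --> u n t) ->
  (\sum_(n <oo) (u n T)%:E < +oo)%E ->
  fine (\sum_(n <oo) (u n x)%:E)%E @[x --> t^'+] --> fine (\sum_(n <oo) (u n t)%:E)%E.
Proof.
move=> t0 tT u0 umono uc uoo.
have T0 : 0 <= T by rewrite (le_trans t0)// ltW.
have foo x : 0 <= x -> x <= T -> (\sum_(n <oo) (u n x)%:E < +oo)%E.
  move=> x0 xT; apply: le_lt_trans uoo; apply: lee_nneseries.
    by move=> n _ _; rewrite lee_fin u0.
  by move=> n _; rewrite lee_fin umono.
have tail0 : fine (\sum_(N <= n <oo) (u n T)%:E)%E @[N --> \oo] --> (0 : R).
  apply: (@fine_cvg _ _ _ _ _ 0%R).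
  by apply: nneseries_tail_cvg => // n _; rewrite lee_fin u0.
apply/cvgrPdist_le => e e0.
have e2 : 0 < e / 2 by rewrite divr_gt0.
move/cvgrPdist_le : tail0 => /(_ _ e2)[N _ /(_ N (leqnn N))/=].
rewrite sub0r normrN => tailN.
have tail_fin x : 0 <= x -> x <= T -> (\sum_(N <= n <oo) (u n x)%:E)%E \is a fin_num.
  move=> x0 xT; rewrite ge0_fin_numE; last by apply: nneseries_ge0 => n _ _; rewrite lee_fin u0.
  apply: le_lt_trans (foo x x0 xT).
  rewrite (@nneseries_split _ (fun n => (u n x)%:E) 0 N (fun k _ => u0 k x x0)) add0n leeDr//.
  by rewrite big_mkord sume_ge0// => i _; rewrite lee_fin u0.
have tail_mono x y : 0 <= x -> x <= y -> y <= T ->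
   fine (\sum_(N <= n <oo) (u n x)%:E)%E <= fine (\sum_(N <= n <oo) (u n y)%:E)%E.
  move=> x0 xy yT; apply: fine_le.
  - by apply: tail_fin => //; exact: le_trans yT.
  - by apply: tail_fin => //; exact: le_trans xy.
  - apply: lee_nneseries => [n _ _|n _]; first by rewrite lee_fin u0.
    by rewrite lee_fin umono.
have part : \sum_(n < N) u n x @[x --> t^'+] --> \sum_(n < N) u n t.
  elim: (N) => [|m IH].
    by rewrite big_ord0; under eq_fun do rewrite big_ord0; exact: cvg_cst.
  by rewrite big_ord_recr /=; under eq_fun do rewrite big_ord_recr /=; exact: cvgD.
move/cvgrPdist_le : part => /(_ _ e2) part.
near=> x.
have tx : t <= x by near: x; exact: nbhs_right_ge.
have xT : x <= T by near: x; exact: nbhs_right_le.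
have x0 : 0 <= x := le_trans t0 tx.
rewrite (fine_nneseries N) ?foo//; [|by move=> n; exact: u0|exact: ltW].
rewrite (@fine_nneseries (u ^~ x) N) ?foo//; last by move=> n; exact: u0.
have : `|\sum_(n < N) u n t - \sum_(n < N) u n x| <= e / 2 by near: x.
have := tail_mono _ _ t0 tx xT; have := tail_mono _ _ x0 xT (lexx T).
have : 0 <= fine (\sum_(N <= n <oo) (u n t)%:E)%E.
  by apply: fine_ge0; apply: nneseries_ge0 => n _ _; rewrite lee_fin u0.
move: tailN; rewrite !ler_norml.
move: (\sum_(n < N) u n t) (\sum_(n < N) u n x) (fine _) (fine _) (fine _).
move=> a b c1 c2 c3; lra.
Unshelve. all: by end_near. Qed.

End monotone_series.

(** * Mittag-Leffler series with nonnegative coefficients *)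

Section tempered_series.
Context {R : realType}.
Notation leb := (@lebesgue_measure R).
Local Notation Rp := (`[0%R, +oo[%classic : set R).
Variables (theta alpha : R) (g : nat).
Hypotheses (theta0 : 0 < theta) (alpha0 : 0 < alpha).

Let expo (q j : nat) : R := alpha * (j + g.+1)%:R + q%:R.
Let coef (q j : nat) : R :=
  theta ^+ q * ((j + g)`!%:R / (j`!%:R * g`!%:R)) / Gamma (expo q j + 1).

Lemma expo_gt0 q j : 0 < expo q j.
Proof. by rewrite ltr_wpDr// mulr_gt0// ltr0n addnS. Qed.

Lemma coef_ge0 q j : 0 <= coef q j.
Proof.
rewrite !mulr_ge0 ?exprn_ge0 ?(ltW theta0) ?invr_ge0 ?mulr_ge0//.
by rewrite ltW// Gamma_gt0// lerDr ltW// expo_gt0.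
Qed.

(** For [b j = beta ^+ j] and gamma = g + 1 this is the general term of the double series in
    [M_formula], without exp(-theta t) and with the Gamma quotient written in factorials. A
    nonnegative b takes the place of the powers of beta so that Tonelli applies. *)
Definition tempered_term (b : R^nat) (q j : nat) (t : R) : R :=
  coef q j * b j * powR t (expo q j).

Definition tempered_series (b : R^nat) (t : R) : \bar R :=
  (\sum_(q <oo) \sum_(j <oo) (tempered_term b q j t)%:E)%E.

Variable b : R^nat.
Hypothesis b0 : forall j, 0 <= b j.

Lemma tempered_term_ge0 q j t : 0 <= tempered_term b q j t.
Proof. by rewrite /tempered_term mulr_ge0 ?powR_ge0// mulr_ge0// coef_ge0. Qed.

Lemma tempered_term_mono q j x y : 0 <= x -> x <= y ->
  tempered_term b q j x <= tempered_term b q j y.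
Proof.
move=> x0 xy; rewrite /tempered_term ler_wpM2l//; first by rewrite mulr_ge0 ?coef_ge0.
by apply: ge0_ler_powR => //; [exact/ltW/expo_gt0|rewrite nnegrE (le_trans x0)].
Qed.

Lemma tempered_series_mono x y : 0 <= x -> x <= y ->
  (tempered_series b x <= tempered_series b y)%E.
Proof.
move=> x0 xy; apply: lee_nneseries => [q _ _|q _].
  by apply: nneseries_ge0 => j _ _; rewrite lee_fin tempered_term_ge0.
apply: lee_nneseries => [j _ _|j _]; first by rewrite lee_fin tempered_term_ge0.
by rewrite lee_fin tempered_term_mono.
Qed.

Lemma tempered_series_ge0 t : (0 <= tempered_series b t)%E.
Proof.
by apply: nneseries_ge0 => q _ _; apply: nneseries_ge0 => j _ _;
   rewrite lee_fin tempered_term_ge0.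
Qed.

Lemma measurable_tempered_series D : measurable_fun D (tempered_series b).
Proof.
apply: measurable_nneseries => [q t _|q].
  by apply: nneseries_ge0 => j _ _; rewrite lee_fin tempered_term_ge0.
apply: measurable_nneseries => [j t _|j]; first by rewrite lee_fin tempered_term_ge0.
apply/measurable_EFinP; apply: measurable_funTS; exact: measurable_funM.

Qed.

(** The origin of the sum over q: exp(-theta t) shifts s to s + theta, and the factor 1/s has to be
    expanded in powers of 1/(s + theta). *)
Let geometric_sum (s : R) : 0 < s ->
  (\sum_(q <oo) (theta ^+ q / (s + theta) ^+ q.+1)%:E = (s^-1)%:E)%E.
Proof.
move=> s0; have p0 : 0 < s + theta by rewrite addr_gt0.
have r1 : `|theta / (s + theta)| < 1.
  by rewrite ger0_norm ?divr_ge0 ?ltW// ltr_pdivrMr// mul1r ltrDr.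
have cg := @cvg_geometric_series R (s + theta)^-1 _ r1.
have E q : theta ^+ q / (s + theta) ^+ q.+1 = geometric (s + theta)^-1 (theta / (s + theta)) q.
  by rewrite /= exprMn exprVn exprS invfM; ring.
under eq_eseriesr do rewrite E.
rewrite nneseries_EFin; last 2 first.
- by move=> n; rewrite /= mulr_ge0 ?exprn_ge0 ?divr_ge0 ?invr_ge0// ltW.
- exact: cvgP cg.
by rewrite (cvg_lim _ cg)//; rewrite -invfM mulrBr mulr1 mulrCA divff ?gt_eqF// mulr1 addrK.
Qed.

(** Each term is a Gamma integral. The sum over q is geometric and gives 1/s; the sum over j is not
    evaluated but written back as an integral over u, the shape in which the transform of the
    moments appears. *)
Lemma laplace_tempered_series s : 0 < s ->
  (\int[leb]_(t in Rp) ((expR (- (s + theta) * t))%:E * tempered_series b t) =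
   (s^-1)%:E * \int[leb]_(u in Rp) (\sum_(j <oo)
     (u ^+ g / g`!%:R * expR (- powR (s + theta) alpha * u) * (b j * u ^+ j / j`!%:R))%:E))%E.
Proof.
move=> s0; have p0 : 0 < s + theta by rewrite addr_gt0.
set p := s + theta in p0 *; set P := powR p alpha.
have P0 : 0 < P by rewrite powR_gt0.
pose d j : R := b j * ((j + g)`!%:R / (j`!%:R * g`!%:R)) / P ^+ (j + g).+1.
have d0 j : 0 <= d j.
  by rewrite /d divr_ge0 ?exprn_ge0 ?(ltW P0)// mulr_ge0// divr_ge0// mulr_ge0.
have E1 t : ((expR (- p * t))%:E * tempered_series b t =
    \sum_(q <oo) \sum_(j <oo) (expR (- p * t) * tempered_term b q j t)%:E)%E.
  rewrite /tempered_series -nneseriesZl; last first.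
    by move=> q _; apply: nneseries_ge0 => j _ _; rewrite lee_fin tempered_term_ge0.
  apply: eq_eseriesr => q _; rewrite -nneseriesZl//.
  by move=> j _; rewrite lee_fin tempered_term_ge0.
under eq_integral do rewrite E1.
have t0 q j t : 0 <= expR (- p * t) * tempered_term b q j t.
  by rewrite mulr_ge0 ?expR_ge0 ?tempered_term_ge0.
have mt q j : measurable_fun Rp (fun t : R => (expR (- p * t) * tempered_term b q j t)%:E).
  apply/measurable_EFinP; apply: measurable_funTS; apply: measurable_funM.
    by apply: measurableT_comp => //; exact: mulrl_measurable.
  by apply: measurable_funM => //; exact: measurable_powR.
rewrite integral_nneseries//; last 2 first.
- by move=> q; apply: measurable_nneseries => [j t _|j]; [rewrite lee_fin t0|exact: mt].
- by move=> q t _; apply: nneseries_ge0 => j _ _; rewrite lee_fin t0.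
transitivity (\sum_(q <oo) \sum_(j <oo) ((theta ^+ q / p ^+ q.+1) * d j)%:E)%E.
  apply: eq_eseriesr => q _; rewrite integral_nneseries//; last 2 first.
  - by move=> j; exact: mt.
  - by move=> j t _; rewrite lee_fin t0.
  apply: eq_eseriesr => j _.
  have e1 : 1 <= expo q j + 1 by rewrite lerDr ltW// expo_gt0.
  transitivity (\int[leb]_(t in Rp) ((coef q j * b j)%:E *
      (powR t (expo q j + 1 - 1) * expR (- p * t))%:E))%E.
    apply: eq_integral => t _; rewrite -EFinM addrK; congr EFin.
    by rewrite /tempered_term; ring.
  rewrite ge0_integralZl_EFin//; last 3 first.
  - by move=> t _; rewrite lee_fin mulr_ge0 ?powR_ge0 ?expR_ge0.
  - by apply/measurable_EFinP; exact: measurable_gamma_integrand.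
  - by rewrite mulr_ge0 ?coef_ge0.
  rewrite Gamma_scale// -EFinM; congr EFin.
  have -> : powR p (expo q j + 1) = P ^+ (j + g).+1 * p ^+ q.+1.
    rewrite -!powR_mulrn ?(ltW p0)// ?(ltW P0)// /P -powRrM -powRD; last by rewrite (gt_eqF p0) implybT.
    by congr powR; rewrite /expo -[q.+1%:R]natr1 addnS addrA.
  have G0 : Gamma (expo q j + 1) != 0 by rewrite gt_eqF// Gamma_gt0.
  rewrite /coef /d; move: (P ^+ _) (p ^+ q.+1) (expf_neq0 (j + g).+1 (lt0r_neq0 P0))
    (expf_neq0 q.+1 (lt0r_neq0 p0)) => X Y X0 Y0.
  by field; rewrite X0 Y0 G0 !fact_neq0.
rewrite nneseries_interchange; last first.
  by move=> q j; rewrite lee_fin mulr_ge0// divr_ge0// exprn_ge0 ?ltW.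
transitivity (\sum_(j <oo) ((s^-1)%:E * (d j)%:E))%E.
  apply: eq_eseriesr => j _; rewrite -geometric_sum// muleC -nneseriesZl.
    by apply: eq_eseriesr => q _; rewrite -EFinM mulrC.
  by move=> q _; rewrite lee_fin divr_ge0// exprn_ge0 ?ltW.
rewrite nneseriesZl; last by move=> j _; rewrite lee_fin.
congr (_ * _)%E; rewrite integral_nneseries//.
- apply: eq_eseriesr => j _.
  transitivity (\int[leb]_(u in Rp) ((d j * P ^+ (j + g).+1)%:E * (erlang_weight P (j + g) u)%:E))%E.
    rewrite ge0_integralZl_EFin//.
    + rewrite integral_erlang_weighty// -EFinM mulfK// expf_neq0// gt_eqF//.
    + by move=> x; rewrite /= in_itv/= andbT => x0; rewrite lee_fin erlang_weight_ge0.
    + apply/measurable_EFinP; apply: measurable_funTS; apply: continuous_measurable_fun.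
      exact: continuous_erlang_weight.
    + by rewrite mulr_ge0// exprn_ge0// ltW.
  apply: eq_integral => u _; rewrite -EFinM; congr EFin.
  rewrite /d /erlang_weight divfK ?expf_neq0 ?gt_eqF// exprD.
  by field; rewrite !fact_neq0.
- move=> j; apply/measurable_EFinP; apply: measurable_funTS; apply: measurable_funM.
    apply: measurable_funM; first by apply: measurable_funM => //; exact: exprn_measurable.
    by apply: measurableT_comp => //; exact: mulrl_measurable.
  apply: measurable_funM => //; apply: measurable_funM => //; exact: exprn_measurable.
- move=> j u; rewrite /= in_itv/= andbT => u0; rewrite lee_fin.
  by rewrite !mulr_ge0 ?exprn_ge0 ?expR_ge0 ?invr_ge0.
Qed.

Hypothesis finite_laplace : exists2 p : R,
  0 < p & (\int[leb]_(t in Rp) ((expR (- p * t))%:E * tempered_series b t) < +oo)%E.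

(** A finite transform bounds the series almost everywhere; by monotonicity an infinite value at t
    would persist on [t, t + 1]. *)
Lemma tempered_series_fin t : 0 <= t -> (tempered_series b t < +oo)%E.
Proof.
move=> t0; have [p p0 foo] := finite_laplace.
rewrite ltey; apply/negP => /eqP too; move: foo; rewrite ltNge => /negP; apply.
have mF D : measurable_fun D (fun x : R => (expR (- p * x))%:E * tempered_series b x)%E.
  apply: emeasurable_funM; last exact: measurable_tempered_series.
  apply/measurable_EFinP; apply: measurableT_comp => //; exact: mulrl_measurable.
have F0 x : (0 <= (expR (- p * x))%:E * tempered_series b x)%E.
  by rewrite mule_ge0 ?lee_fin ?expR_ge0 ?tempered_series_ge0.
apply: (@le_trans _ _ (\int[leb]_(x in `[t, (t + 1)%R]) ((expR (- p * x))%:E * tempered_series b x))%E); last first.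
  apply: ge0_subset_integral => //; first exact: mF.
  by move=> x /=; rewrite !in_itv/= andbT => /andP[tx _]; exact: le_trans tx.
rewrite (eq_integral (cst +oo%E)); last first.
  move=> x; rewrite inE/= in_itv/= => /andP[tx _].
  have -> : tempered_series b x = +oo%E.
    by apply/eqP; rewrite -leye_eq -too tempered_series_mono.
  by rewrite gt0_muley// lte_fin expR_gt0.
rewrite integral_cst//= lebesgue_measure_itv/= lte_fin ltrDl ltr01.
by rewrite -EFinB addrAC subrr add0r mule1.
Qed.

Lemma tempered_series_inner q t : 0 <= t -> (\sum_(j <oo) (tempered_term b q j t)%:E < +oo)%E.
Proof.
move=> t0; apply: le_lt_trans (tempered_series_fin t0).
have inner0 n : (0 <= \sum_(j <oo) (tempered_term b n j t)%:E)%E.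
  by apply: nneseries_ge0 => j _ _; rewrite lee_fin tempered_term_ge0.
rewrite /tempered_series.
rewrite (@nneseries_split _ (fun q => \sum_(j <oo) (tempered_term b q j t)%:E)%E 0 q.+1)//.
rewrite add0n big_nat_recr//= addeAC leeDr// adde_ge0//.
  by rewrite big_mkord sume_ge0.
by apply: nneseries_ge0.
Qed.

Definition tempered_inner q t : R := fine (\sum_(j <oo) (tempered_term b q j t)%:E)%E.

Lemma tempered_innerK q t : 0 <= t ->
  ((tempered_inner q t)%:E = \sum_(j <oo) (tempered_term b q j t)%:E)%E.
Proof.
move=> t0; rewrite fineK// ge0_fin_numE ?tempered_series_inner//.
by apply: nneseries_ge0 => j _ _; rewrite lee_fin tempered_term_ge0.
Qed.

Lemma tempered_seriesE t : 0 <= t ->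
  (tempered_series b t = \sum_(q <oo) (tempered_inner q t)%:E)%E.
Proof. by move=> t0; apply: eq_eseriesr => q _; rewrite tempered_innerK. Qed.

Lemma tempered_series_right_continuous t : 0 <= t ->
  fine (tempered_series b x) @[x --> t^'+] --> fine (tempered_series b t).
Proof.
move=> t0; have tt1 : t < t + 1 by rewrite ltrDl.
have t10 : 0 <= t + 1 by rewrite addr_ge0.
rewrite tempered_seriesE//.
have H : fine (\sum_(q <oo) (tempered_inner q x)%:E)%E @[x --> t^'+] -->
    fine (\sum_(q <oo) (tempered_inner q t)%:E)%E.
  apply: (nondecreasing_series_right_continuous t0 tt1).
  - move=> q x x0; rewrite -lee_fin tempered_innerK//.
    by apply: nneseries_ge0 => j _ _; rewrite lee_fin tempered_term_ge0.
  - move=> q x y x0 xy; rewrite -lee_fin !tempered_innerK// ?(le_trans x0)//.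
    apply: lee_nneseries => [j _ _|j _]; first by rewrite lee_fin tempered_term_ge0.
    by rewrite lee_fin tempered_term_mono.
  - move=> q; apply: (nondecreasing_series_right_continuous t0 tt1).
    + by move=> j x _; exact: tempered_term_ge0.
    + by move=> j x y; exact: tempered_term_mono.
    + by move=> j; apply: cvgMl_tmp; apply: cvg_powR_right => //; exact/ltW/expo_gt0.
    + exact: tempered_series_inner.
  - by rewrite -tempered_seriesE// tempered_series_fin.
apply: cvg_trans H; apply: near_eq_cvg; near=> x.
rewrite tempered_seriesE//.
have tx : t <= x by near: x; exact: nbhs_right_ge.
exact: le_trans tx.
Unshelve. all: by end_near. Qed.
End tempered_series.

(** * Discretization and measurability *)

Section discretization.
Context {R : realType}.

Lemma measurable_fun_natcomp d (T : measurableType d) d' (U : measurableType d')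
    (D : set T) (N : T -> nat) (f : nat -> T -> U) :
  (forall k, measurable (D `&` N @^-1` [set k])) -> (forall k, measurable_fun D (f k)) ->
  measurable_fun D (fun x => f (N x) x).
Proof.
move=> mN mf mD B mB.
rewrite (_ : D `&` _ = \bigcup_k ((D `&` N @^-1` [set k]) `&` (D `&` f k @^-1` B))).
  apply: bigcup_measurable => k _; apply: measurableI; first exact: mN.
  exact: mf.
apply/seteqP; split => [x [Dx Bx]|x [k _ [[Dx Nk] [_ Bx]]]].
  by exists (N x).
by split => //=; rewrite Nk.
Qed.

Lemma measurable_truncn d (T : measurableType d) (f : T -> R) k :
  measurable_fun setT f -> measurable ((fun x => Num.truncn (f x)) @^-1` [set k]).
Proof.
move=> mf.
have mlt n : measurable [set x | (Num.truncn (f x) <= n)%N].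
  rewrite (_ : mkset _ = f @^-1` `]-oo, n.+1%:R[).
    by rewrite -[X in measurable X]setTI; apply: mf.
  by apply/seteqP; split => x /=; rewrite in_itv/= -truncn_le_nat.
case: k => [|k].
  rewrite (_ : _ @^-1` _ = [set x | (Num.truncn (f x) <= 0)%N])//.
  by apply/seteqP; split => x /= => [->//|]; rewrite leqn0 => /eqP.
rewrite (_ : _ @^-1` _ = [set x | (Num.truncn (f x) <= k.+1)%N] `\` [set x | (Num.truncn (f x) <= k)%N]).
  exact: measurableD.
apply/seteqP; split => x /= => [->|[xk /negP]]; first by rewrite ltnn.
by rewrite -ltnNge => kx; apply/eqP; rewrite eqn_leq xk.
Qed.

(* approximation of a point strictly from the right on the grid of mesh 1/(n+1) *)
Definition grid_up (n : nat) (t : R) : R := (Num.truncn (n.+1%:R * t)).+1%:R / n.+1%:R.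

Lemma grid_up_gt n t : t < grid_up n t.
Proof. by rewrite /grid_up ltr_pdivlMr// mulrC truncnS_gt. Qed.

Lemma grid_up_le n t : 0 <= t -> grid_up n t <= t + n.+1%:R^-1.
Proof.
move=> t0; rewrite /grid_up ler_pdivrMr// mulrDl mulVf ?pnatr_eq0// -natr1 lerD2r mulrC.
by rewrite truncn_le mulr_ge0.
Qed.

Lemma grid_up_cvg t : 0 <= t -> grid_up n t @[n --> \oo] --> t.
Proof.
move=> t0; apply: (@squeeze_cvgr _ _ _ _ (cst t) (fun n => t + n.+1%:R^-1)).
- by apply: nearW => n; rewrite grid_up_le// ltW// grid_up_gt.
- exact: cvg_cst.
- by rewrite -[X in _ --> X]addr0; apply: cvgD; [exact: cvg_cst|exact: cvg_harmonic].
Qed.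

Lemma measurable_le_indicator d (T : measurableType d) (D : set T) (f h : T -> R) :
  measurable_fun D f -> measurable_fun D h -> measurable_fun D (fun x => (f x <= h x)%R%:R : R).
Proof.
move=> mf mh.
rewrite (_ : (fun x => _) = (\1_(`[0, +oo[%classic : set R) : R -> R) \o (fun x => h x - f x)).
  apply: measurableT_comp; first exact: measurable_indic.
  exact: measurable_funB.
by apply/funext => x /=; rewrite indicE mem_setE in_itv/= andbT subr_ge0.
Qed.
End discretization.

(** * Distribution function of the tempered subordinator *)

Section tempered_subordinator.
Context {R : realType}.
Notation leb := (@lebesgue_measure R).
Local Notation Rp := (`[0%R, +oo[%classic : set R).
Variables (theta alpha : R) (d : measure_display) (T : measurableType d)
  (P : probability T R) (D : R -> T -> R).
Hypotheses (theta0 : 0 < theta) (alpha0 : 0 < alpha)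
  (hD : is_tempered_subordinator theta alpha P D).

Let psi s := tempered_psi theta alpha s.

Lemma subordinator_measurable u : measurable_fun setT (D u).
Proof. by have [] := hD. Qed.

Lemma subordinator_mono w u v : 0 <= u -> u <= v -> D u w <= D v w.
Proof. by have [_ _ h _ _] := hD; exact: h. Qed.

Lemma subordinator_ge0 w u : 0 <= u -> 0 <= D u w.
Proof.
by have [_ D0 _ _ _] := hD => u0; rewrite -(D0 w); exact: subordinator_mono.
Qed.

Lemma subordinator_laplace u s : 0 <= u -> 0 <= s ->
  (\int[P]_w (expR (- (s * D u w)))%:E = (expR (- u * psi s))%:E)%E.
Proof.
move=> u0 s0; have [_ D0 _ _ h] := hD.
have := h [:: u] [:: s] erefl; rewrite /= !andbT => /(_ u0 s0).
under eq_integral => w _ do rewrite big_ord1 /= D0 subr0.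
by rewrite big_ord1 /= subr0.
Qed.

(* [u] is replaced by its positive part so that [subordinator_cdf] is monotone in [u] on
   the whole line *)
Definition subordinator_cdf (u t : R) : R := fine (P [set w | D (Num.max u 0) w <= t]).

Let mDset u t : measurable [set w | D u w <= t].
Proof.
rewrite (_ : mkset _ = D u @^-1` `]-oo, t]).
  by rewrite -[X in measurable X]setTI; apply: subordinator_measurable.
by apply/seteqP; split => w /=; rewrite in_itv.
Qed.

Lemma subordinator_cdfE u t : 0 <= u ->
  ((subordinator_cdf u t)%:E = P [set w | (D u w <= t)%R])%E.
Proof. by move=> u0; rewrite /subordinator_cdf max_l// fineK// fin_num_measure. Qed.

Lemma subordinator_cdf_int u t : 0 <= u ->
  ((subordinator_cdf u t)%:E = \int[P]_w ((D u w <= t)%R%:R)%:E)%E.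
Proof.
move=> u0; rewrite subordinator_cdfE//.
transitivity (\int[P]_w (\1_[set w | D u w <= t] w)%:E)%E.
  by rewrite integral_indic// setIT.
apply: eq_integral => w _; rewrite indicE.
by rewrite (_ : (w \in _) = (D u w <= t))//; apply/idP/idP; rewrite inE.
Qed.

Lemma subordinator_cdf_ge0 u t : 0 <= subordinator_cdf u t.
Proof. exact: fine_ge0. Qed.

Lemma subordinator_cdf_mono u s t : s <= t -> subordinator_cdf u s <= subordinator_cdf u t.
Proof.
move=> st; apply: fine_le; rewrite ?fin_num_measure// le_measure ?inE//.
by move=> w /= /le_trans; apply.
Qed.

Lemma subordinator_cdf_anti t : nonincreasing_fun (subordinator_cdf ^~ t).
Proof.
move=> u v uv; apply: fine_le; rewrite ?fin_num_measure// le_measure ?inE//.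
move=> w /=; apply: le_trans; apply: subordinator_mono; first by rewrite le_max lexx orbT.
by rewrite ge_max !le_max uv lexx orbT.
Qed.

Lemma subordinator_cdf_max u t : subordinator_cdf (Num.max u 0) t = subordinator_cdf u t.
Proof. by rewrite /subordinator_cdf -maxA maxxx. Qed.

(** By Tonelli: for fixed w, the integral of exp(-s t) over t >= D u w is exp(-s D u w) / s. *)
Lemma subordinator_cdf_laplace u s : 0 <= u -> 0 < s ->
  (\int[leb]_(t in Rp) (expR (- s * t) * subordinator_cdf u t)%:E =
   (s^-1 * expR (- u * psi s))%:E)%E.
Proof.
move=> u0 s0.
pose f (z : R * T) : \bar R := (\1_Rp z.1 * (expR (- s * z.1) * (D u z.2 <= z.1)%R%:R))%:E.
have mf : measurable_fun setT f.
  apply/measurable_EFinP; apply: measurable_funM.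
    by apply: measurableT_comp => //; exact: measurable_indic.
  apply: measurable_funM.
    apply: measurableT_comp => //; apply: measurableT_comp => //; exact: mulrl_measurable.
  apply: measurable_le_indicator => //.
  by apply: measurableT_comp => //; exact: subordinator_measurable.
have f0 z : (0 <= f z)%E by rewrite lee_fin !mulr_ge0 ?expR_ge0.
transitivity (\int[leb]_t \int[P]_w f (t, w))%E.
  rewrite integral_mkcond; apply: eq_integral => t _; rewrite patchE /f /= indicE.
  case: ifP => tR; last by rewrite integral0_eq// => w _; rewrite mul0r.
  under eq_integral do rewrite mul1r EFinM.
  rewrite ge0_integralZl_EFin ?expR_ge0//; last first.
    apply/measurable_EFinP; apply: measurable_le_indicator => //.
    exact: subordinator_measurable.
  by rewrite -subordinator_cdf_int.
rewrite (@fubini_tonelli _ _ _ _ _ leb P f)//.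
transitivity (\int[P]_w ((s^-1)%:E * (expR (- (s * D u w)))%:E))%E.
  apply: eq_integral => w _.
  have Du0 := subordinator_ge0 w u0.
  transitivity (\int[leb]_(t in `[D u w, +oo[) (erlang_weight s 0 t)%:E)%E.
    rewrite [RHS]integral_mkcond; apply: eq_integral => t _; rewrite patchE /f /= indicE !mem_setE !in_itv/= !andbT.
    case: (leP (D u w) t) => [Dt|_]; last by rewrite !mulr0.
    by rewrite (le_trans Du0 Dt) /erlang_weight fact0 expr0 divr1 !mul1r mulr1.
  rewrite integral_erlang_weight_tail// -EFinM; congr EFin.
  rewrite /erlang_cdf (_ : exp_poly 0 = 1%:P); last first.
    by apply/polyP => j; rewrite coef_poly coefC; case: j => [|j] //=; rewrite invr1.
  by rewrite hornerC expr1; field; rewrite gt_eqF.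
rewrite ge0_integralZl_EFin ?invr_ge0 ?(ltW s0)//.
- by rewrite subordinator_laplace// ltW.
- apply/measurable_EFinP; apply: measurableT_comp => //; apply: measurable_funN.
  by apply: measurable_funM => //; exact: subordinator_measurable.
Qed.

Lemma subordinator_cdf_seq u t (v : R^nat) : 0 <= u -> (forall n, t <= v n) ->
  v n @[n --> \oo] --> t -> subordinator_cdf u (v n) @[n --> \oo] --> subordinator_cdf u t.
Proof.
move=> u0 tv vt.
have mind r : measurable_fun setT (fun w => ((D u w <= r)%R%:R : R)%:E).
  apply/measurable_EFinP; apply: measurable_le_indicator => //.
  exact: subordinator_measurable.
have [] // := @dominated_convergence _ T R P setT measurableT
    (fun n w => ((D u w <= v n)%R%:R)%:E) (fun w => ((D u w <= t)%R%:R)%:E) (cst 1%E).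
- apply: aeW => w _; apply: cvg_EFin; first exact: nearW.
  apply: cvg_near_cst.
  have [Dt|tD] := leP (D u w) t.
    by apply: nearW => n; rewrite /= (le_trans Dt).
  have : \forall n \near \oo, v n < D u w by exact: (cvgr_lt _ vt).
  by apply: filterS => n; rewrite ltNge /= => /negbTE ->.
- exact: finite_measure_integrable_cst.
- by apply: aeW => w n _; rewrite /= lee_fin; case: (D u w <= v n); rewrite ?normr1 ?normr0.
move=> _ _; rewrite -subordinator_cdf_int//.
under eq_fun do rewrite -subordinator_cdf_int//.
exact: fine_cvg.
Qed.

(** The function is monotone in u for fixed t and right-continuous in t. With t replaced by its grid
    value it consists of countably many pieces that depend on u alone, and a limit remains. The
    maximum keeps t nonnegative, as the grid requires. *)
Lemma measurable_subordinator_cdf :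
  measurable_fun setT (fun z : R * R => subordinator_cdf z.1 (Num.max z.2 0)).
Proof.
apply: (@measurable_fun_cvg _ (R * R)%type R setT
    (fun n z => subordinator_cdf z.1 (grid_up n (Num.max z.2 0)))) => [n|[u t] _ /=]; last first.
  rewrite -subordinator_cdf_max.
  under eq_fun do rewrite -subordinator_cdf_max.
  apply: subordinator_cdf_seq; first by rewrite le_max lexx orbT.
    by move=> n; rewrite ltW// grid_up_gt.
  by apply: grid_up_cvg; rewrite le_max lexx orbT.
apply: (measurable_fun_natcomp (N := fun z : R * R => Num.truncn (n.+1%:R * Num.max z.2 0))
   (f := fun k z => subordinator_cdf z.1 (k.+1%:R / n.+1%:R))).
  move=> k; rewrite setTI; apply: measurable_truncn.
  apply: measurable_funM => //.
  by apply: measurable_maxr.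
move=> k; apply: (@measurableT_comp _ _ _ _ _ _ (fun u => subordinator_cdf u (k.+1%:R / n.+1%:R))) => //.
by apply: nonincreasing_measurable => //; exact: subordinator_cdf_anti.
Qed.
End tempered_subordinator.

(** * Moments of the inverse subordinator *)

Section inverse_subordinator_moments.
Context {R : realType}.
Notation leb := (@lebesgue_measure R).
Local Notation Rp := (`[0%R, +oo[%classic : set R).
Variables (theta alpha : R) (d : measure_display) (T : measurableType d)
  (P : probability T R) (D : R -> T -> R).
Hypotheses (theta0 : 0 < theta) (alpha0 : 0 < alpha)
  (hD : is_tempered_subordinator theta alpha P D).
Variables (nu : R) (g : nat).
Hypothesis nu0 : 0 <= nu.

Local Notation cdf := (subordinator_cdf P D).
Local Notation psi := (tempered_psi theta alpha).

Lemma psi_gt0 s : 0 < s -> 0 < psi s.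
Proof.
by move=> s0; rewrite subr_gt0 gt0_ltr_powR// ?nnegrE ?addr_ge0 ?(ltW s0) ?(ltW theta0)// ltrDr.
Qed.

(* the Laplace transform at 1 and Markov's inequality *)
Lemma subordinator_cdf_le u t : 0 <= u -> cdf u t <= expR t * expR (- u * psi 1).
Proof.
move=> u0; rewrite -lee_fin (subordinator_cdf_int hD)// EFinM -(subordinator_laplace hD u0 ler01).
rewrite -ge0_integralZl_EFin ?expR_ge0//; last first.
- apply/measurable_EFinP; apply: measurableT_comp => //; apply: measurable_funN.
  by apply: measurable_funM => //; exact: subordinator_measurable hD _.
apply: ge0_le_integral => //.
- apply/measurable_EFinP; apply: measurable_le_indicator => //.
  exact: subordinator_measurable hD _.
- apply: measurable_funeM; apply/measurable_EFinP; apply: measurableT_comp => //; apply: measurable_funN.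
  by apply: measurable_funM => //; exact: subordinator_measurable hD _.
- move=> w _; rewrite -EFinM lee_fin -expRD mul1r; have [Dt|_] := boolP (D u w <= t); last exact: expR_ge0.
  by rewrite -expR0 ler_expR subr_ge0.
Qed.

(** Written with the law of the subordinator, to which [subordinator_laplace] gives access;
    [inverse_moment_expectation] returns to the inverse. *)
Definition inverse_moment (t : R) : \bar R :=
  (\int[leb]_(u in Rp) (erlang_weight nu g u * cdf u t)%:E)%E.

Let w0 u : Rp u -> 0 <= erlang_weight nu g u.
Proof. by rewrite /= in_itv/= andbT; exact: erlang_weight_ge0. Qed.

Let mw (D' : set R) : measurable_fun D' (erlang_weight nu g).
Proof. by apply: measurable_funTS; apply: continuous_measurable_fun; exact: continuous_erlang_weight. Qed.

Let mcdf t (D' : set R) : measurable_fun D' (fun u => cdf u t).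
Proof.
apply: measurable_funTS; apply: nonincreasing_measurable => //.
exact: subordinator_cdf_anti hD _.
Qed.

Lemma inverse_moment_ge0 t : (0 <= inverse_moment t)%E.
Proof.
apply: integral_ge0 => u uR; rewrite lee_fin mulr_ge0 ?w0//.
exact: subordinator_cdf_ge0.
Qed.

Let dom (t u : R) : (erlang_weight nu g u * (expR t * expR (- u * psi 1)))%:E =
  ((expR t)%:E * (erlang_weight (nu + psi 1) g u)%:E)%E.
Proof.
rewrite -EFinM /erlang_weight; congr EFin.
have -> : expR (- (nu + psi 1) * u) = expR (- nu * u) * expR (- u * psi 1).
  by rewrite -expRD; congr expR; ring.
by ring.
Qed.

Let dom_integrable t : leb.-integrable Rp (fun u => ((expR t)%:E * (erlang_weight (nu + psi 1) g u)%:E)%E).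
Proof.
apply: integrableZl => //; apply/integrableP; split.
  apply/measurable_EFinP; apply: measurable_funTS; apply: continuous_measurable_fun; exact: continuous_erlang_weight.
have -> : (\int[leb]_(u in Rp) `|(erlang_weight (nu + psi 1) g u)%:E| =
           \int[leb]_(u in Rp) (erlang_weight (nu + psi 1) g u)%:E)%E.
  apply: eq_integral => u; rewrite inE/= in_itv/= andbT => u0.
  by rewrite ger0_norm// erlang_weight_ge0.
by rewrite integral_erlang_weighty ?ltry// ltr_wpDl// psi_gt0.
Qed.

Lemma inverse_moment_fin t : (inverse_moment t < +oo)%E.
Proof.
apply: (@le_lt_trans _ _ (\int[leb]_(u in Rp) ((expR t)%:E * (erlang_weight (nu + psi 1) g u)%:E))%E).
  apply: ge0_le_integral => //.
  - by move=> u uR; rewrite lee_fin mulr_ge0 ?w0// subordinator_cdf_ge0.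
  - by apply/measurable_EFinP; apply: measurable_funM; [exact: mw|exact: mcdf].
  - by move/integrableP : (dom_integrable t) => [].
  - move=> u uR; rewrite -dom lee_fin ler_wpM2l ?w0// subordinator_cdf_le//.
    by move: uR; rewrite /= in_itv/= andbT.
have /integrableP[_] := dom_integrable t.
apply: le_lt_trans; apply: ge0_le_integral => //.
- move=> u uR; rewrite -dom lee_fin mulr_ge0 ?w0// mulr_ge0 ?expR_ge0//.
- by move/integrableP : (dom_integrable t) => [].
- by apply: measurableT_comp => //; move/integrableP : (dom_integrable t) => [].
- by move=> u _; exact: lee_abs.
Qed.

Lemma inverse_moment_mono : nondecreasing_fun (fine \o inverse_moment).
Proof.
move=> s t st; apply: fine_le.
- by rewrite ge0_fin_numE ?inverse_moment_fin ?inverse_moment_ge0.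
- by rewrite ge0_fin_numE ?inverse_moment_fin ?inverse_moment_ge0.
apply: ge0_le_integral => //.
- by move=> u uR; rewrite lee_fin mulr_ge0 ?w0// subordinator_cdf_ge0.
- by apply/measurable_EFinP; apply: measurable_funM; [exact: mw|exact: mcdf].
- by apply/measurable_EFinP; apply: measurable_funM; [exact: mw|exact: mcdf].
- by move=> u uR; rewrite lee_fin ler_wpM2l ?w0// (subordinator_cdf_mono hD).
Qed.

Lemma inverse_moment_right_continuous t : 0 <= t ->
  fine (inverse_moment x) @[x --> t^'+] --> fine (inverse_moment t).
Proof.
move=> t0; apply/cvg_at_rightP => v [vt vcvg].
(* The dominating function depends on an upper bound for [v n], so finitely many terms are
   dropped. *)
have [N _ vN] : \forall n \near \oo, v n <= t + 1.
  by apply: (cvgr_le _ vcvg); rewrite ltrDl.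
rewrite -(cvg_shiftn N).
have [] // := @dominated_convergence _ _ R leb Rp (measurable_itv _)
  (fun n u => (erlang_weight nu g u * cdf u (v (n + N)%N))%:E)
  (fun u => (erlang_weight nu g u * cdf u t)%:E)
  (fun u => ((expR (t + 1))%:E * (erlang_weight (nu + psi 1) g u)%:E)%E).
- by move=> n; apply/measurable_EFinP; apply: measurable_funM; [exact: mw|exact: mcdf].
- by apply/measurable_EFinP; apply: measurable_funM; [exact: mw|exact: mcdf].
- apply: aeW => u; rewrite /= in_itv/= andbT => u0.
  apply: cvg_EFin; first exact: nearW.
  apply: cvgMl_tmp; apply: (subordinator_cdf_seq hD u0) => [n|]; first exact: ltW.
  by rewrite (cvg_shiftn N).
- apply: aeW => u n uR; rewrite -dom lee_fin ger0_norm; last first.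
    by rewrite mulr_ge0 ?w0 ?subordinator_cdf_ge0.
  have u0 : 0 <= u by move: uR; rewrite /= in_itv/= andbT.
  rewrite ler_wpM2l ?w0//; apply: (le_trans (subordinator_cdf_le _ u0)).
  by rewrite ler_wpM2r ?expR_ge0// ler_expR vN//= leq_addl.
move=> _ _ H.
have Gfin : inverse_moment t \is a fin_num by rewrite ge0_fin_numE ?inverse_moment_fin ?inverse_moment_ge0.
apply: fine_cvg; rewrite fineK//.
Qed.

Lemma inverse_moment_laplace s : 0 < s ->
  (\int[leb]_(t in Rp) ((expR (- s * t))%:E * inverse_moment t) =
   (s^-1)%:E * \int[leb]_(u in Rp) (erlang_weight nu g u * expR (- u * psi s))%:E)%E.
Proof.
move=> s0.
(* The maximum comes from the jointly measurable form of the distribution function; where the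
   indicators are 1 it changes nothing. *)
pose f (z : R * R) : \bar R := (\1_Rp z.1 * (\1_Rp z.2 *
   (expR (- s * z.2) * (erlang_weight nu g z.1 * cdf z.1 (Num.max z.2 0)))))%:E.
have mf : measurable_fun setT f.
  apply/measurable_EFinP; apply: measurable_funM.
    by apply: measurableT_comp => //; exact: measurable_indic.
  apply: measurable_funM.
    by apply: measurableT_comp => //; exact: measurable_indic.
  apply: measurable_funM.
    apply: measurableT_comp => //; apply: measurableT_comp => //; exact: mulrl_measurable.
  apply: measurable_funM; last exact: (measurable_subordinator_cdf hD).
  by apply: (@measurableT_comp _ _ _ _ _ _ (erlang_weight nu g)) => //; exact: mw.
have f0 z : (0 <= f z)%E.
  rewrite lee_fin indicE.
  have [zR|zR] := boolP (z.1 \in Rp); last by rewrite mul0r.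
  rewrite mul1r mulr_ge0// mulr_ge0 ?expR_ge0// mulr_ge0 ?subordinator_cdf_ge0//.
  exact: w0 (set_mem zR).
transitivity (\int[leb]_t \int[leb]_u f (u, t))%E.
  rewrite integral_mkcond; apply: eq_integral => t _; rewrite patchE.
  case: ifPn => tR; last first.
    by rewrite integral0_eq// => u _; rewrite /f /= [X in _ * (X * _)]indicE (negbTE tR) mul0r mulr0.
  have t0 : 0 <= t by move: tR; rewrite inE/= in_itv/= andbT.
  rewrite /inverse_moment -ge0_integralZl_EFin ?expR_ge0//; last 2 first.
  - by move=> u uR; rewrite lee_fin mulr_ge0 ?w0// subordinator_cdf_ge0.
  - by apply/measurable_EFinP; apply: measurable_funM; [exact: mw|exact: mcdf].
  rewrite integral_mkcond; apply: eq_integral => u _; rewrite patchE /f /= !indicE tR mul1r max_l//.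
  by case: ifPn => uR; rewrite ?mul1r ?mul0r.
rewrite -(@fubini_tonelli _ _ _ _ _ leb leb f)//.
transitivity (\int[leb]_(u in Rp) ((s^-1)%:E * (erlang_weight nu g u * expR (- u * psi s))%:E))%E.
  rewrite [RHS]integral_mkcond; apply: eq_integral => u _; rewrite patchE.
  case: ifPn => uR; last first.
    by rewrite integral0_eq// => t _; rewrite /f /= indicE (negbTE uR) mul0r.
  have u0 : 0 <= u by move: uR; rewrite inE/= in_itv/= andbT.
  transitivity (\int[leb]_(t in Rp) ((erlang_weight nu g u)%:E * (expR (- s * t) * cdf u t)%:E))%E.
    rewrite [RHS]integral_mkcond; apply: eq_integral => t _; rewrite patchE /f /= !indicE uR mul1r.
    case: ifPn => tR; rewrite ?mul1r ?mul0r// -EFinM max_l; first by congr EFin; ring.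
    by move: tR; rewrite inE/= in_itv/= andbT.
  rewrite ge0_integralZl_EFin ?erlang_weight_ge0//.
  - by rewrite (subordinator_cdf_laplace hD)// -!EFinM; congr EFin; ring.
  - by move=> t _; rewrite lee_fin mulr_ge0 ?expR_ge0 ?subordinator_cdf_ge0.
  - apply/measurable_EFinP; apply: measurable_funM.
      by apply: measurableT_comp => //; exact: mulrl_measurable.
    apply: nondecreasing_measurable => // x y xy; exact: (subordinator_cdf_mono hD).
rewrite ge0_integralZl_EFin ?invr_ge0 ?(ltW s0)//.
- by move=> u uR; rewrite lee_fin mulr_ge0 ?w0 ?expR_ge0.
- apply/measurable_EFinP; apply: measurable_funM; first exact: mw.
  apply: measurableT_comp => //; apply: measurable_funM => //; exact: oppr_measurable.
Qed.

Let beta := powR theta alpha - nu.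

(* positive and negative parts of [beta ^+ j] *)
Definition ppow (j : nat) : R := Num.max (beta ^+ j) 0.
Definition npow (j : nat) : R := Num.max (- beta ^+ j) 0.

Lemma ppow_ge0 j : 0 <= ppow j. Proof. by rewrite le_max lexx orbT. Qed.
Lemma npow_ge0 j : 0 <= npow j. Proof. by rewrite le_max lexx orbT. Qed.

Lemma ppowE j : ppow j = beta ^+ j + npow j.
Proof.
rewrite /ppow /npow; have [b0|b0] := boolP (0 <= beta ^+ j).
  by rewrite max_l// max_r ?addr0// oppr_le0.
rewrite -ltNge in b0.
by rewrite max_r ?(ltW b0)// max_l ?subrr// oppr_ge0 ltW.
Qed.

Lemma ppow_le j : ppow j <= `|beta| ^+ j.
Proof. by rewrite ge_max exprn_ge0// andbT -normrX ler_norm. Qed.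

Lemma npow_le j : npow j <= `|beta| ^+ j.
Proof. by rewrite ge_max exprn_ge0// andbT -normrX -normrN ler_norm. Qed.

Local Notation series_kernel b s u :=
  (\sum_(j <oo) (u ^+ g / g`!%:R * expR (- powR (s + theta) alpha * u) * (b j * u ^+ j / j`!%:R))%:E)%E.

Lemma nneseries_expR (x : R) : 0 <= x -> (\sum_(j <oo) (x ^+ j / j`!%:R)%:E = (expR x)%:E)%E.
Proof.
move=> x0; rewrite nneseries_EFin//; first by move=> j; exact: exp_coeff_ge0.
exact: is_cvg_series_exp_coeff.
Qed.

Lemma series_kernel_fin (b : R^nat) s u : (forall j, 0 <= b j <= `|beta| ^+ j) -> 0 <= u ->
  (series_kernel b s u <= (erlang_weight (powR (s + theta) alpha - `|beta|) g u)%:E)%E.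
Proof.
move=> bb u0.
have A0 : 0 <= u ^+ g / g`!%:R * expR (- powR (s + theta) alpha * u).
  by rewrite !mulr_ge0 ?exprn_ge0 ?expR_ge0 ?invr_ge0.
have -> : erlang_weight (powR (s + theta) alpha - `|beta|) g u =
    u ^+ g / g`!%:R * expR (- powR (s + theta) alpha * u) * expR (`|beta| * u).
  rewrite /erlang_weight -[RHS]mulrA -expRD; congr (_ * expR _); ring.
rewrite [leRHS]EFinM -nneseries_expR ?mulr_ge0// -nneseriesZl; last first.
  by move=> j _; rewrite lee_fin divr_ge0 ?exprn_ge0 ?mulr_ge0.
apply: lee_nneseries => [j _ _|j _].
  by rewrite lee_fin mulr_ge0// divr_ge0// mulr_ge0 ?exprn_ge0//; have /andP[] := bb j.
rewrite -EFinM lee_fin ler_wpM2l// ler_wpM2r ?invr_ge0// exprMn.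
by rewrite ler_wpM2r ?exprn_ge0//; have /andP[] := bb j.
Qed.

(** The differences [ppow j - npow j] are the powers of beta, whose exponential series is exp(beta
    u), and (s + theta)^alpha - beta = nu + psi(s). *)
Lemma series_kernel_split s u : 0 <= u ->
  (series_kernel ppow s u = (erlang_weight nu g u * expR (- u * psi s))%:E + series_kernel npow s u)%E.
Proof.
move=> u0.
have A0 : 0 <= u ^+ g / g`!%:R * expR (- powR (s + theta) alpha * u).
  by rewrite !mulr_ge0 ?exprn_ge0 ?expR_ge0 ?invr_ge0.
have fin (b : R^nat) : (forall j, 0 <= b j <= `|beta| ^+ j) -> series_kernel b s u =
    (u ^+ g / g`!%:R * expR (- powR (s + theta) alpha * u) * limn (series (fun j => b j * u ^+ j / j`!%:R)))%:E
    /\ cvgn (series (fun j => b j * u ^+ j / j`!%:R)).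
  move=> bb; have c : cvgn (series (fun j => b j * u ^+ j / j`!%:R)).
    apply: (series_le_cvg _ _ _ (is_cvg_series_exp_coeff (`|beta| * u))) => j.
    - by rewrite divr_ge0// mulr_ge0 ?exprn_ge0//; have /andP[] := bb j.
    - by apply: exp_coeff_ge0; rewrite mulr_ge0.
    - rewrite /exp_coeff /= exprMn ler_wpM2r ?invr_ge0// ler_wpM2r ?exprn_ge0//.
      by have /andP[] := bb j.
  split => //; rewrite [RHS]EFinM -nneseries_EFin//; last first.
    by move=> j; rewrite divr_ge0// mulr_ge0 ?exprn_ge0//; have /andP[] := bb j.
  rewrite -nneseriesZl; first by apply: eq_eseriesr => j _; rewrite -EFinM.
  by move=> j _; rewrite lee_fin divr_ge0// mulr_ge0 ?exprn_ge0//; have /andP[] := bb j.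
have [-> cp] := fin ppow (fun j => introT andP (conj (ppow_ge0 j) (ppow_le j))).
have [-> cn] := fin npow (fun j => introT andP (conj (npow_ge0 j) (npow_le j))).
rewrite -EFinD; congr EFin.
have -> : limn (series (fun j => ppow j * u ^+ j / j`!%:R)) =
    expR (beta * u) + limn (series (fun j => npow j * u ^+ j / j`!%:R)).
  rewrite /expR -limD//; last exact: is_cvg_series_exp_coeff.
  congr (lim (_ @ \oo)); apply/funext => N; rewrite /series /= fctE -big_split /=.
  by apply: eq_bigr => j _; rewrite /exp_coeff /= ppowE exprMn; ring.
rewrite mulrDr; congr (_ + _); rewrite /erlang_weight -!mulrA; congr (_ * (_ * _)).
by rewrite -!expRD; congr expR; rewrite /beta /tempered_psi; ring.
Qed.
End inverse_subordinator_moments.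

(** * Identification of the moments by their transforms *)

Section inverse_moment_series.
Context {R : realType}.
Notation leb := (@lebesgue_measure R).
Local Notation Rp := (`[0%R, +oo[%classic : set R).
Variables (theta alpha : R) (d : measure_display) (T : measurableType d)
  (P : probability T R) (D : R -> T -> R).
Hypotheses (theta0 : 0 < theta) (alpha0 : 0 < alpha)
  (hD : is_tempered_subordinator theta alpha P D).
Variables (nu : R) (g : nat).
Hypothesis nu0 : 0 <= nu.

Let beta := powR theta alpha - nu.
(** Chosen with s0^alpha = |beta| + 1: from there on (s + theta)^alpha exceeds |beta|, and
    coefficients bounded by |beta|^j give a finite transform. *)
Let s0 := powR (`|beta| + 1) alpha^-1.

Local Notation ppow := (ppow theta alpha nu).
Local Notation npow := (npow theta alpha nu).
Local Notation ser := (tempered_series theta alpha g).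
Local Notation G := (inverse_moment P D nu g).

Lemma s0_gt0 : 0 < s0.
Proof. by rewrite powR_gt0// ltr_wpDl. Qed.

Lemma s0_dominates s : s0 <= s -> `|beta| < powR (s + theta) alpha.
Proof.
move=> s0s; have s_ge0 : 0 <= s := le_trans (ltW s0_gt0) s0s.
apply: (@lt_le_trans _ _ (`|beta| + 1)); first by rewrite ltrDl.
have -> : `|beta| + 1 = powR s0 alpha.
  by rewrite /s0 -powRrM mulVf ?gt_eqF// powRr1// addr_ge0.
rewrite ge0_ler_powR ?nnegrE ?(ltW alpha0) ?(ltW s0_gt0) ?addr_ge0 ?(ltW theta0)//.
by rewrite (le_trans s0s)// lerDl ltW.
Qed.

Let kernel_ge0 (b : R^nat) s u j : (forall j, 0 <= b j) -> 0 <= u ->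
  (0 <= (u ^+ g / g`!%:R * expR (- powR (s + theta) alpha * u) * (b j * u ^+ j / j`!%:R))%:E)%E.
Proof.
by move=> b0 u0; rewrite lee_fin !mulr_ge0 ?exprn_ge0 ?expR_ge0 ?invr_ge0.
Qed.

Let measurable_kernel (b : R^nat) s : (forall j, 0 <= b j) ->
  measurable_fun Rp (fun u => (\sum_(j <oo)
    (u ^+ g / g`!%:R * expR (- powR (s + theta) alpha * u) * (b j * u ^+ j / j`!%:R))%:E)%E).
Proof.
move=> b0; apply: measurable_nneseries => [j u|j].
  by rewrite /= in_itv/= andbT => u0; exact: kernel_ge0.
apply/measurable_EFinP; apply: measurable_funTS; apply: measurable_funM.
  apply: measurable_funM; first by apply: measurable_funM => //; exact: exprn_measurable.
  by apply: measurableT_comp => //; exact: mulrl_measurable.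
by apply: measurable_funM => //; apply: measurable_funM => //; exact: exprn_measurable.
Qed.

Lemma laplace_ser_fin (b : R^nat) s : (forall j, 0 <= b j <= `|beta| ^+ j) -> s0 <= s ->
  (\int[leb]_(t in Rp) ((expR (- (s + theta) * t))%:E * ser b t) < +oo)%E.
Proof.
move=> bb s0s; have s_gt0 : 0 < s := lt_le_trans s0_gt0 s0s.
rewrite laplace_tempered_series//; last by move=> j; have /andP[] := bb j.
have Pb : 0 < powR (s + theta) alpha - `|beta| by rewrite subr_gt0 s0_dominates.
rewrite lte_mul_pinfty ?lee_fin ?invr_ge0 ?(ltW s_gt0)//.
apply: (@le_lt_trans _ _ (\int[leb]_(u in Rp) (erlang_weight (powR (s + theta) alpha - `|beta|) g u)%:E)%E); last first.
  by rewrite integral_erlang_weighty// ltry.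
apply: ge0_le_integral => //.
- move=> u; rewrite /= in_itv/= andbT => u0; apply: nneseries_ge0 => j _ _.
  by apply: kernel_ge0 => // i; have /andP[] := bb i.
- by apply: measurable_kernel => j; have /andP[] := bb j.
- apply/measurable_EFinP; apply: measurable_funTS; apply: continuous_measurable_fun; exact: continuous_erlang_weight.
- by move=> u; rewrite /= in_itv/= andbT => u0; exact: series_kernel_fin.
Qed.

Lemma ppow_bound j : 0 <= ppow j <= `|beta| ^+ j.
Proof. by rewrite ppow_ge0 ppow_le. Qed.

Lemma npow_bound j : 0 <= npow j <= `|beta| ^+ j.
Proof. by rewrite npow_ge0 npow_le. Qed.

Lemma ser_fin (b : R^nat) t : (forall j, 0 <= b j <= `|beta| ^+ j) -> 0 <= t -> (ser b t < +oo)%E.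
Proof.
move=> bb t0; apply: tempered_series_fin => //; first by move=> j; have /andP[] := bb j.
exists (s0 + theta); first by rewrite addr_gt0 ?s0_gt0.
exact: laplace_ser_fin.
Qed.

Let serK (b : R^nat) t : (forall j, 0 <= b j <= `|beta| ^+ j) -> 0 <= t -> ((fine (ser b t))%:E = ser b t)%E.
Proof.
move=> bb t0; rewrite fineK// ge0_fin_numE ?ser_fin//.
by apply: tempered_series_ge0 => // j; have /andP[] := bb j.
Qed.

Let GK t : ((fine (G t))%:E = G t)%E.
Proof.
rewrite fineK// ge0_fin_numE ?(inverse_moment_fin theta0 alpha0 hD)//.
exact: inverse_moment_ge0.
Qed.

Let ser_integrable (b : R^nat) s : (forall j, 0 <= b j <= `|beta| ^+ j) -> s0 <= s ->
  leb.-integrable Rp (fun t => (expR (- s * t) * (expR (- theta * t) * fine (ser b t)))%:E) /\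
  (\int[leb]_(t in Rp) (expR (- s * t) * (expR (- theta * t) * fine (ser b t)))%:E =
   \int[leb]_(t in Rp) ((expR (- (s + theta) * t))%:E * ser b t))%E.
Proof.
move=> bb s0s.
have b0 j : 0 <= b j by have /andP[] := bb j.
have E : (\int[leb]_(t in Rp) (expR (- s * t) * (expR (- theta * t) * fine (ser b t)))%:E =
   \int[leb]_(t in Rp) ((expR (- (s + theta) * t))%:E * ser b t))%E.
  apply: eq_integral => t; rewrite inE/= in_itv/= andbT => t0.
  rewrite -serK// -EFinM mulrA -expRD; congr (expR _ * _)%:E; ring.
split => //; apply/integrableP; split.
  apply/measurable_EFinP; apply: measurable_funM.
    by apply: measurableT_comp => //; exact: mulrl_measurable.
  apply: measurable_funM.
    by apply: measurableT_comp => //; exact: mulrl_measurable.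
  by apply: measurableT_comp => //; exact: measurable_tempered_series.
have -> : (\int[leb]_(t in Rp) `|(expR (- s * t) * (expR (- theta * t) * fine (ser b t)))%:E| =
  \int[leb]_(t in Rp) (expR (- s * t) * (expR (- theta * t) * fine (ser b t)))%:E)%E.
  apply: eq_integral => t _; rewrite gee0_abs// lee_fin !mulr_ge0 ?expR_ge0// fine_ge0//.
  exact: tempered_series_ge0.
by rewrite E laplace_ser_fin.
Qed.

Let G_integrable s : 0 < s ->
  (\int[leb]_(t in Rp) ((expR (- s * t))%:E * G t) < +oo)%E ->
  leb.-integrable Rp (fun t => (expR (- s * t) * fine (G t))%:E) /\
  (\int[leb]_(t in Rp) (expR (- s * t) * fine (G t))%:E =
   \int[leb]_(t in Rp) ((expR (- s * t))%:E * G t))%E.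
Proof.
move=> s_gt0 foo.
have E : (\int[leb]_(t in Rp) (expR (- s * t) * fine (G t))%:E =
   \int[leb]_(t in Rp) ((expR (- s * t))%:E * G t))%E.
  by apply: eq_integral => t _; rewrite -GK.
split => //; apply/integrableP; split.
  apply/measurable_EFinP; apply: measurable_funM.
    by apply: measurableT_comp => //; exact: mulrl_measurable.
  apply: nondecreasing_measurable => //; exact: (inverse_moment_mono theta0 alpha0 hD).
have -> : (\int[leb]_(t in Rp) `|(expR (- s * t) * fine (G t))%:E| =
  \int[leb]_(t in Rp) (expR (- s * t) * fine (G t))%:E)%E.
  apply: eq_integral => t _; rewrite gee0_abs// lee_fin !mulr_ge0 ?expR_ge0// fine_ge0//.
  exact: inverse_moment_ge0.
by rewrite E.
Qed.

(** All three transforms are 1/s times an integral over u, so [series_kernel_split] can be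
    integrated. *)
Lemma laplace_split s : s0 <= s ->
  (\int[leb]_(t in Rp) ((expR (- (s + theta) * t))%:E * ser ppow t) =
   \int[leb]_(t in Rp) ((expR (- s * t))%:E * G t) +
   \int[leb]_(t in Rp) ((expR (- (s + theta) * t))%:E * ser npow t))%E.
Proof.
move=> s0s; have s_gt0 : 0 < s := lt_le_trans s0_gt0 s0s.
have Lp := @laplace_tempered_series R theta alpha g theta0 alpha0 ppow (@ppow_ge0 R theta alpha nu) s s_gt0.
have Ln := @laplace_tempered_series R theta alpha g theta0 alpha0 npow (@npow_ge0 R theta alpha nu) s s_gt0.
have LG := @inverse_moment_laplace R theta alpha d T P D hD nu g s s_gt0.
rewrite Lp Ln LG -ge0_muleDr.
- congr (_ * _)%E; rewrite -ge0_integralD//.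
  + by apply: eq_integral => u; rewrite inE/= in_itv/= andbT => u0; rewrite series_kernel_split.
  + move=> u; rewrite /= in_itv/= andbT => u0.
    by rewrite lee_fin mulr_ge0 ?expR_ge0 ?erlang_weight_ge0.
  + apply/measurable_EFinP; apply: measurable_funM.
      apply: measurable_funTS; apply: continuous_measurable_fun; exact: continuous_erlang_weight.
    by apply: measurableT_comp => //; apply: measurable_funM => //; exact: oppr_measurable.
  + move=> u; rewrite /= in_itv/= andbT => u0; apply: nneseries_ge0 => j _ _.
    by apply: kernel_ge0 => // i; exact: npow_ge0.
  + by apply: measurable_kernel => j; exact: npow_ge0.
- apply: integral_ge0 => u; rewrite /= in_itv/= andbT => u0.
  by rewrite lee_fin mulr_ge0 ?expR_ge0 ?erlang_weight_ge0.
- apply: integral_ge0 => u; rewrite /= in_itv/= andbT => u0; apply: nneseries_ge0 => j _ _.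
  by apply: kernel_ge0 => // i; exact: npow_ge0.
Qed.

Lemma inverse_momentE t : 0 <= t ->
  fine (G t) = expR (- theta * t) * (fine (ser ppow t) - fine (ser npow t)).
Proof.
move=> t0.
pose A x := fine (G x) + expR (- theta * x) * fine (ser npow x).
pose B x := expR (- theta * x) * fine (ser ppow x).
suff : A t = B t by rewrite /A /B mulrBr => <-; rewrite addrK.
(* The transform of G is one of two nonnegative summands of a finite quantity. *)
have Gfoo s : s0 <= s -> (\int[leb]_(t in Rp) ((expR (- s * t))%:E * G t) < +oo)%E.
  move=> s0s; apply: le_lt_trans (laplace_ser_fin ppow_bound s0s).
  rewrite laplace_split// leeDl//; apply: integral_ge0 => x _.
  by rewrite mule_ge0 ?lee_fin ?expR_ge0// tempered_series_ge0// => j; exact: npow_ge0.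
have spl s : (fun x => (expR (- s * x) * A x)%:E) = (fun x => (expR (- s * x) * fine (G x))%:E +
     (expR (- s * x) * (expR (- theta * x) * fine (ser npow x)))%:E)%E.
  by apply/funext => x; rewrite -EFinD /A mulrDr.
have cexp : expR (- theta * x) @[x --> t^'+] --> expR (- theta * t).
  apply: cvg_at_right_filter; apply: (cvg_comp (fun x => - theta * x) expR).
    exact: mulrl_continuous.
  exact: continuous_expR.
have rser (b : R^nat) : (forall j, 0 <= b j <= `|beta| ^+ j) ->
    expR (- theta * x) * fine (ser b x) @[x --> t^'+] --> expR (- theta * t) * fine (ser b t).
  move=> bb; apply: cvgM => //; apply: tempered_series_right_continuous => //.
    by move=> j; have /andP[] := bb j.
  exists (s0 + theta); first by rewrite addr_gt0 ?s0_gt0.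
  exact: laplace_ser_fin.
apply: (@laplace_inj R A B s0 t t0).
- move=> s s0s; rewrite spl; apply: integrableD => //.
    by have [] := G_integrable (lt_le_trans s0_gt0 s0s) (Gfoo _ s0s).
  by have [] := ser_integrable npow_bound s0s.
- by move=> s s0s; have [] := ser_integrable ppow_bound s0s.
- move=> s s0s; rewrite spl.
  have [iG EG] := G_integrable (lt_le_trans s0_gt0 s0s) (Gfoo _ s0s).
  have [iN EN] := ser_integrable npow_bound s0s.
  have [iP EP] := ser_integrable ppow_bound s0s.
  by rewrite integralD// EG EN EP laplace_split.
- by apply: cvgD; [exact: (inverse_moment_right_continuous theta0 alpha0 hD)|exact: rser npow_bound].
- exact: rser ppow_bound.
Qed.
End inverse_moment_series.

(** * Return to the Mittag-Leffler functions *)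

Section mittag_leffler_form.
Context {R : realType}.
Variables (theta alpha : R) (d : measure_display) (T : measurableType d)
  (P : probability T R) (D : R -> T -> R).
Hypotheses (theta0 : 0 < theta) (alpha0 : 0 < alpha)
  (hD : is_tempered_subordinator theta alpha P D).
Variables (nu : R) (g : nat).
Hypothesis nu0 : 0 <= nu.

Let beta := powR theta alpha - nu.
Local Notation ppow := (ppow theta alpha nu).
Local Notation npow := (npow theta alpha nu).
Local Notation ser := (tempered_series theta alpha g).
Local Notation inner := (tempered_inner theta alpha g).
Local Notation term := (tempered_term theta alpha g).

Lemma tempered_term_diff q j t : 0 < t ->
  term ppow q j t - term npow q j t =
  theta ^+ q * powR t (alpha * g.+1%:R + 1 + q%:R - 1) / Gamma g.+1%:R *
  (Gamma (j%:R + g.+1%:R) * (beta * powR t alpha) ^+ j /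
    (j`!%:R * Gamma (alpha * j%:R + (alpha * g.+1%:R + 1 + q%:R)))).
Proof.
move=> t0; rewrite /tempered_term ppowE -natrD addnS !Gamma_nat exprMn.
have -> : alpha * j%:R + (alpha * g.+1%:R + 1 + q%:R) = alpha * (j + g).+1%:R + q%:R + 1.
  by rewrite -addnS natrD; ring.
have -> : powR t (alpha * (j + g).+1%:R + q%:R) =
   powR t (alpha * g.+1%:R + 1 + q%:R - 1) * powR t alpha ^+ j.
  rewrite -powR_mulrn ?powR_ge0// -powRrM -powRD; last by rewrite (gt_eqF t0) implybT.
  by congr powR; rewrite -addnS natrD; ring.
have G0 : Gamma (alpha * (j + g).+1%:R + q%:R + 1) != 0.
  by rewrite gt_eqF// Gamma_gt0// lerDr addr_ge0// mulr_ge0// ltW.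
by field; rewrite G0 !fact_neq0.
Qed.

Lemma mittag_leffler_inner q t : 0 < t ->
  theta ^+ q * powR t (alpha * g.+1%:R + 1 + q%:R - 1) *
    ML3 g.+1%:R alpha (alpha * g.+1%:R + 1 + q%:R) (beta * powR t alpha) =
  inner ppow q t - inner npow q t.
Proof.
move=> t0.
have ci (b : R^nat) : (forall j, 0 <= b j <= `|beta| ^+ j) ->
    series (fun j => term b q j t) @ \oo --> inner b q t.
  move=> bb; have b0 j : 0 <= b j by have /andP[] := bb j.
  apply: cvg_series_nneseries; first by move=> j; exact: tempered_term_ge0.
  apply: tempered_series_inner => //; last exact: ltW.
  exists (powR (`|beta| + 1) alpha^-1 + theta); first by rewrite addr_gt0// powR_gt0// ltr_wpDl.
  exact: (laplace_ser_fin theta0 alpha0 g bb (lexx _)).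
set a := theta ^+ q * powR t (alpha * g.+1%:R + 1 + q%:R - 1).
have a0 : a / Gamma g.+1%:R != 0.
  by rewrite gt_eqF// divr_gt0 ?Gamma_gt0 ?ler1n// mulr_gt0 ?exprn_gt0 ?powR_gt0.
rewrite /ML3; set S := fun N => _.
have SE : S = (fun N => (a / Gamma g.+1%:R)^-1 *
   (series (fun j => term ppow q j t) N - series (fun j => term npow q j t) N)).
  apply/funext => N; rewrite /S /series /= -sumrB mulr_sumr big_mkord; apply: eq_bigr => j _.
  by rewrite tempered_term_diff// -/a mulKf.
have : S @ \oo --> (a / Gamma g.+1%:R)^-1 * (inner ppow q t - inner npow q t).
  rewrite SE; apply: cvgMl_tmp; apply: cvgB; apply: ci => j.
    exact: ppow_bound.
  exact: npow_bound.
move=> /cvg_lim -> //.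
have G0 : Gamma g.+1%:R != 0 :> R by rewrite Gamma_nat fact_neq0.
have a_neq0 : a != 0 by apply: contraNneq a0 => ->; rewrite mul0r.
by field; rewrite G0 a_neq0.
Qed.

(** The finite nonnegative series for [ppow] and [npow] supply the convergence that both limits
    require, over j inside [ML3] and over q here. *)
Lemma mittag_leffler_moment t : 0 <= t ->
  expR (- theta * t) * limn (fun N => \sum_(q < N)
    theta ^+ q * powR t (alpha * g.+1%:R + 1 + q%:R - 1) *
    ML3 g.+1%:R alpha (alpha * g.+1%:R + 1 + q%:R) (beta * powR t alpha)) =
  fine (inverse_moment P D nu g t).
Proof.
move=> t_ge0; rewrite (inverse_momentE theta0 alpha0 hD)//; congr (_ * _).
(* At t = 0 the common factor of the inner series vanishes and cannot be divided out; both sides are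
   0. *)
move: (t_ge0); rewrite le_eqVlt => /predU1P[<-|t0].
  have e0 q : powR 0 (alpha * g.+1%:R + 1 + q%:R - 1) = 0 :> R.
    by rewrite powR0// gt_eqF// addrAC addrK ltr_wpDr// mulr_gt0.
  rewrite (_ : (fun N => _) = cst 0); last first.
    by apply/funext => N; rewrite big1// => q _; rewrite e0 mulr0 mul0r.
  rewrite lim_cst//.
  have ser0 (b : R^nat) : fine (ser b 0) = 0.
    rewrite /tempered_series eseries0// => q _ _; rewrite eseries0// => j _ _.
    by rewrite /tempered_term powR0 ?mulr0 ?mul0r// gt_eqF// ltr_wpDr// mulr_gt0.
  by rewrite !ser0 subrr.
have co (b : R^nat) : (forall j, 0 <= b j <= `|beta| ^+ j) ->
    series (fun q => inner b q t) @ \oo --> fine (ser b t).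
  move=> bb; have b0 j : 0 <= b j by have /andP[] := bb j.
  have fl : exists2 p : R, 0 < p & (\int[lebesgue_measure]_(t in `[0%R, +oo[)
      ((expR (- p * t))%:E * ser b t) < +oo)%E.
    exists (powR (`|beta| + 1) alpha^-1 + theta); first by rewrite addr_gt0// powR_gt0// ltr_wpDl.
    exact: (laplace_ser_fin theta0 alpha0 g bb (lexx _)).
  rewrite tempered_seriesE//; apply: cvg_series_nneseries.
    move=> q; rewrite fine_ge0//; apply: nneseries_ge0 => j _ _.
    by rewrite lee_fin tempered_term_ge0.
  by rewrite -tempered_seriesE// tempered_series_fin.
apply/cvg_lim => //.
rewrite (_ : (fun N => _) = (fun N => series (fun q => inner ppow q t) N - series (fun q => inner npow q t) N)).
  by apply: cvgB; apply: co => j; [exact: ppow_bound|exact: npow_bound].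
apply/funext => N; rewrite /series /= -sumrB big_mkord; apply: eq_bigr => q _.
exact: mittag_leffler_inner.
Qed.
End mittag_leffler_form.

(** * Mean queue length of the chain *)

Section series_facts.
Context {R : realType}.

Lemma nneseries_finite (f : nat -> \bar R) N : (forall n, (N <= n)%N -> f n = 0%E) ->
  (\sum_(n <oo) f n = \sum_(n < N) f n)%E.
Proof.
move=> f0; apply/cvg_lim => //; apply: cvg_near_cst.
exists N => // m /= Nm; rewrite (big_cat_nat (leq0n N) Nm)/= [X in (_ + X)%E]big_nat_cond.
by rewrite [X in (_ + X)%E]big1 ?adde0 ?big_mkord// => i; rewrite andbT => /andP[/f0].
Qed.

Lemma nneseries_pick (a : nat) (c : nat -> R) :
  (\sum_(j <oo) (((a == j)%N%:R : R) * c j)%:E = (c a)%:E)%E.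
Proof.
rewrite (@nneseries_finite _ a.+1); last by move=> j aj; rewrite (ltn_eqF aj) mul0r.
rewrite (bigD1 ord_max)//= eqxx mul1r big1 ?adde0// => j ja.
rewrite eq_sym; suff /negbTE -> : (j : nat) != a by rewrite mul0r.
by apply: contraNneq ja => ja; apply/eqP/val_inj.
Qed.

(** Poisson tail: more than i events by time u means that event i + 1 has occurred, so the Erlang
    distribution function sums the Poisson probabilities over j > i. The power of q is q^j /
    q^(i+1). *)
Lemma erlang_cdf_series (q : R) i u : 0 < q -> 0 <= u ->
  ((erlang_cdf q i u)%:E =
   \sum_(j <oo) (expR (- q * u) * (u ^+ j / j`!%:R * ((i < j)%N%:R * q ^+ (j.-1 - i))))%:E)%E.
Proof.
move=> q0 u0.
have E : \sum_(j < i.+1) exp_coeff (q * u) j = (exp_poly i).[q * u].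
  rewrite (@horner_coef_wide _ i.+1) ?size_poly//; apply: eq_bigr => j _.
  by rewrite coef_poly ltn_ord /exp_coeff /= mulrC.
have -> : erlang_cdf q i u = expR (- q * u) * (q ^- i.+1 * (expR (q * u) - (exp_poly i).[q * u])).
  have e : expR (- (q * u)) * expR (q * u) = 1 by rewrite -expRD addNr expR0.
  by rewrite /erlang_cdf mulNr -[X in (X - _) / _]e; ring.
have q1 : q ^+ i.+1 != 0 by rewrite expf_neq0// gt_eqF.
have F j : u ^+ j / j`!%:R * ((i < j)%N%:R * q ^+ (j.-1 - i)) =
    q ^- i.+1 * ((i < j)%N%:R * exp_coeff (q * u) j).
  have [ij|_] := ltnP i j; last by rewrite !mul0r !mulr0.
  rewrite !mul1r /exp_coeff /= exprMn -[in q ^+ j](subnK ij) exprD subnS -[(j - i).-1]subn1 subnAC subn1.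
  by field; rewrite q1 fact_neq0.
under eq_eseriesr do rewrite F.
rewrite nneseries_EFin; last first.
- apply: is_cvg_seriesZ; apply: is_cvg_seriesZ.
  apply: (series_le_cvg _ _ _ (is_cvg_series_exp_coeff (q * u))) => j.
  + by rewrite mulr_ge0// exp_coeff_ge0// mulr_ge0// ltW.
  + by rewrite exp_coeff_ge0// mulr_ge0// ltW.
  + by case: (i < j)%N; rewrite ?mul1r ?mul0r// exp_coeff_ge0// mulr_ge0// ltW.
- move=> j; rewrite mulr_ge0 ?expR_ge0// mulr_ge0 ?invr_ge0 ?exprn_ge0 ?(ltW q0)//.
  by rewrite mulr_ge0//; apply: exp_coeff_ge0; rewrite mulr_ge0// ltW.
congr EFin; apply/esym/cvg_lim => //.
rewrite [X in X @ _](_ : _ = (fun N => expR (- q * u) * (q ^- i.+1 *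
   series (fun j => (i < j)%N%:R * exp_coeff (q * u) j) N))); last first.
  by apply/funext => N; rewrite /series /= !mulr_sumr.
apply: cvgMl_tmp; apply: cvgMl_tmp.
rewrite -(cvg_shiftn i.+1).
rewrite [X in X @ _](_ : _ = (fun N => series (exp_coeff (q * u)) (N + i.+1)%N - (exp_poly i).[q * u])).
  by apply: cvgB; [rewrite (cvg_shiftn i.+1); exact: is_cvg_series_exp_coeff|exact: cvg_cst].
apply/funext => N; rewrite /series /= -E -(big_mkord predT (exp_coeff (q * u))) !(big_cat_nat (leq0n i.+1) (leq_addl N i.+1))/=.
rewrite [X in X + _ = _]big_nat_cond [X in X + _ = _]big1 ?add0r; last first.
  by move=> j; rewrite andbT ltnS => /andP[_ ji]; rewrite ltnNge ji mul0r.
rewrite addrAC subrr add0r big_nat_cond [RHS]big_nat_cond; apply: eq_bigr => j.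
by rewrite andbT => /andP[-> _]; rewrite mul1r.
Qed.

Lemma erlang_cdf_ge0 (q : R) i u : 0 < q -> 0 <= u -> 0 <= erlang_cdf q i u.
Proof.
move=> q0 u0; rewrite -lee_fin erlang_cdf_series//; apply: nneseries_ge0 => j _ _.
by rewrite lee_fin !mulr_ge0 ?expR_ge0 ?exprn_ge0 ?invr_ge0 ?(ltW q0).
Qed.

(** The inner sums are those of [mean_weightE]; after the interchange with the Poisson average each
    [V i] meets a Poisson tail. *)
Lemma poisson_convolution (q u : R) (V : R^nat) : 0 < q -> 0 <= u -> (forall i, 0 <= V i) ->
  (\sum_(j <oo) (expR (- q * u) * (u ^+ j / j`!%:R * \sum_(i < j) q ^+ (j.-1 - i) * V i))%:E =
   \sum_(i <oo) (V i * erlang_cdf q i u)%:E)%E.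
Proof.
move=> q0 u0 V0.
pose a j i := (expR (- q * u) * (u ^+ j / j`!%:R * ((i < j)%N%:R * q ^+ (j.-1 - i))) * V i)%:E.
have a0 j i : (0 <= a j i)%E.
  by rewrite lee_fin !mulr_ge0 ?expR_ge0 ?exprn_ge0 ?invr_ge0 ?(ltW q0).
transitivity (\sum_(j <oo) \sum_(i <oo) a j i)%E.
  apply: eq_eseriesr => j _; rewrite (@nneseries_finite _ j); last first.
    by move=> i ji; rewrite /a ltnNge ji !(mul0r, mulr0).
  rewrite sumEFin; congr EFin; rewrite !mulr_sumr; apply: eq_bigr => i _.
  by rewrite ltn_ord mul1r !mulrA.
rewrite nneseries_interchange//; apply: eq_eseriesr => i _.
rewrite EFinM erlang_cdf_series// -nneseriesZl.
  by apply: eq_eseriesr => j _; rewrite /a mulrC EFinM.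
by move=> j _; rewrite lee_fin !mulr_ge0 ?expR_ge0 ?exprn_ge0 ?invr_ge0 ?(ltW q0).
Qed.

(** The weights (q x)^i / i! exp(-q x) add up to 1, hence their integrals over [0, u] to u. In the
    proof this appears as the mean of the Poisson law divided by q. *)
Lemma series_pow_erlang_cdf (q u : R) : 0 < q -> 0 <= u ->
  (\sum_(i <oo) (q ^+ i * erlang_cdf q i u)%:E = u%:E)%E.
Proof.
move=> q0 u0; rewrite -poisson_convolution//; last by move=> i; rewrite exprn_ge0// ltW.
have e : expR (- q * u) * expR (q * u) = 1 by rewrite -expRD mulNr addNr expR0.
have qu0 : 0 <= q * u by rewrite mulr_ge0// ltW.
have t0 j : 0 <= expR (- q * u) * (u ^+ j / j`!%:R * \sum_(i < j) q ^+ (j.-1 - i) * q ^+ i).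
  rewrite !mulr_ge0 ?expR_ge0 ?exprn_ge0 ?invr_ge0//.
  by apply: sumr_ge0 => i _; rewrite mulr_ge0 ?exprn_ge0 ?(ltW q0).
(* The term j = 0 is an empty sum; afterwards j + 1 cancels against the factorial. *)
rewrite (@nneseries_split _ _ 0 1); last by move=> j _; rewrite lee_fin.
rewrite big_nat1 big_ord0 !mulr0 add0e add0n -nneseries_addn; last by move=> j; rewrite lee_fin.
have -> : u%:E = ((expR (- q * u) * u)%:E * (expR (q * u))%:E)%E by rewrite -EFinM mulrAC e mul1r.
rewrite -nneseries_expR//.
rewrite -nneseriesZl; last by move=> j _; rewrite lee_fin divr_ge0// exprn_ge0.
apply: eq_eseriesr => j _; rewrite -EFinM; congr EFin.
rewrite addn1 (eq_bigr (fun=> q ^+ j)); last first.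
  by move=> i _; rewrite -exprD subnK// -ltnS.
rewrite sumr_const card_ord -[RHS]mulrA; congr (_ * _).
rewrite factS natrM exprS exprMn -mulr_natl; field.
by rewrite fact_neq0 nat1r pnatr_eq0.
Qed.
End series_facts.

(** * The mean as a series over return weights *)

Section mean_queue_length.
Context {R : realType}.
Variables (k l : nat) (lam : nat -> R) (mu : R).
Hypotheses (k0 : (0 < k)%N) (lam0 : forall i : 'I_l, 0 <= lam i.+1) (mu0 : 0 < mu).
Let c := k%:R * mu.
Let q := Lam l lam + c.
Let c0 : 0 < c. Proof. by rewrite mulr_gt0// ltr0n. Qed.
Let q0 : 0 < q.
Proof.
rewrite /q -rate_sumE ltr_wpDl//; exact: sumr_ge0.
Qed.

Lemma box_sum_series (N : nat) (v : state -> R) : (forall y, 0 <= v y) -> supported k N v ->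
  (\sum_(a <oo) \sum_(b <oo) (v (a, b))%:E = (box_sum k N v)%:E)%E.
Proof.
move=> v0 sv; rewrite (@nneseries_finite _ _ N); last first.
  by move=> a Na; apply: eseries0 => b _ _; rewrite sv//= Na orbT.
rewrite /box_sum -sumEFin; apply: eq_bigr => a _.
rewrite (@nneseries_finite _ _ k.+1) ?sumEFin// => b kb; rewrite sv//.
apply/orP; left; apply/negP; rewrite /reach => /orP[/eqP[_ bE]|/and3P[_ _ /= bk]]; lia.
Qed.

(** Uniformization turns transition probabilities into Poisson averages of [forward]; for each j
    only finitely many states carry mass, and [forward_pairing] evaluates the sum over them. *)
Lemma mean_ptrans_series u : 0 <= u ->
  (\sum_(a <oo) \sum_(b <oo) ((gk k (a, b))%:R * ptrans k l lam mu u (0, 0) (a, b))%:E =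
   \sum_(j <oo) (expR (- q * u) * (u ^+ j / j`!%:R * mean_weight k l lam c j))%:E)%E.
Proof.
move=> u0.
have f0 := forward_ge0 k0 lam0 (ltW mu0).
pose h (y : state) j := (expR (- q * u) * ((gk k y)%:R * poisson_term k l lam mu u y j))%:E.
have h0 y j : (0 <= h y j)%E by rewrite lee_fin mulr_ge0 ?expR_ge0// mulr_ge0//; apply: poisson_term_ge0 => //; exact: ltW.
have E y : (((gk k y)%:R * ptrans k l lam mu u (0, 0) y)%:E = \sum_(j <oo) h y j)%E.
  rewrite EFinM ptrans_uniformized//; last exact: ltW.
  rewrite muleCA -nneseriesZl; last by move=> j _; rewrite lee_fin poisson_term_ge0// ltW.
  rewrite -nneseriesZl; last first.
    by move=> j _; rewrite -EFinM lee_fin mulr_ge0// poisson_term_ge0// ltW.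
  by apply: eq_eseriesr => j _; rewrite /h !EFinM.
transitivity (\sum_(a <oo) \sum_(j <oo) \sum_(b <oo) h (a, b) j)%E.
  apply: eq_eseriesr => a _; rewrite nneseries_interchange//.
  by apply: eq_eseriesr => b _; rewrite E.
rewrite nneseries_interchange; last by move=> *; exact: nneseries_ge0.
apply: eq_eseriesr => j _.
rewrite /mean_weight -(forward_pairing l lam k0 (ltW mu0) j (fun y => y%:R)).
rewrite -!box_sumZ -(box_sum_series (N := (l * j).+1)).
- apply: eq_eseriesr => a _; apply: eq_eseriesr => b _.
  by rewrite /h /poisson_term; congr EFin; ring.
- by move=> y; rewrite !mulr_ge0 ?expR_ge0 ?exprn_ge0 ?invr_ge0.
- by move=> y /(forward_supported lam k0 (ltW mu0)) ->; rewrite mul0r !mulr0.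
Qed.

Lemma mean_weight_ge0 j : 0 <= mean_weight k l lam c j.
Proof.
rewrite /mean_weight; elim: j 0%N => [x|j IH x]; first by rewrite /= ler0n.
rewrite iterS /back_step; apply: addr_ge0; first by rewrite mulr_ge0 ?(ltW c0).
by apply: sumr_ge0 => i _; rewrite mulr_ge0.
Qed.

(** The series on the right is the integral over [0, u] of the probability of the empty state. With
    [c * u] on the left the identity becomes [mean_weightE], term by term in the Poisson index. *)
Lemma mean_ptransE u : 0 <= u ->
  ((\sum_(a <oo) \sum_(b <oo) ((gk k (a, b))%:R * ptrans k l lam mu u (0, 0) (a, b))%:E) +
     (c * u)%:E =
   (k%:R * (\sum_(i < l) i.+1%:R * lam i.+1) * u)%:E +
     c%:E * \sum_(i <oo) (return_weight k l lam c i 0 * erlang_cdf q i u)%:E)%E.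
Proof.
move=> u0; rewrite mean_ptrans_series//.
pose A := k%:R * (\sum_(i < l) i.+1%:R * lam i.+1).
have A0 : 0 <= A by rewrite mulr_ge0//; apply: sumr_ge0 => i _; rewrite mulr_ge0.
have W0 i : 0 <= return_weight k l lam c i 0 by apply: return_weight_ge0 => //; exact: ltW.
have qi i : 0 <= q ^+ i by rewrite exprn_ge0// ltW.
pose S (V : R^nat) := (\sum_(j <oo) (expR (- q * u) * (u ^+ j / j`!%:R * \sum_(i < j) q ^+ (j.-1 - i) * V i))%:E)%E.
have SE V : (forall i, 0 <= V i) -> S V = (\sum_(i <oo) (V i * erlang_cdf q i u)%:E)%E.
  by move=> V0; exact: poisson_convolution.
have R0 i : 0 <= erlang_cdf q i u by exact: erlang_cdf_ge0.
have lin (a b : R) : 0 <= a -> 0 <= b ->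
   (\sum_(i <oo) ((a * q ^+ i + b * return_weight k l lam c i 0) * erlang_cdf q i u)%:E =
   (a * u)%:E + b%:E * \sum_(i <oo) (return_weight k l lam c i 0 * erlang_cdf q i u)%:E)%E.
  move=> a0 b0; rewrite EFinM -(series_pow_erlang_cdf q0 u0) -!nneseriesZl; last 2 first.
  - by move=> i _; rewrite lee_fin mulr_ge0.
  - by move=> i _; rewrite lee_fin mulr_ge0.
  rewrite -nneseriesD; last 2 first.
  - by move=> i _; rewrite -EFinM lee_fin mulr_ge0// mulr_ge0.
  - by move=> i _; rewrite -EFinM lee_fin mulr_ge0// mulr_ge0.
  by apply: eq_eseriesr => i _; rewrite -!EFinM -EFinD; congr EFin; ring.
rewrite -lin//; last exact: ltW.
rewrite -SE; last by move=> i; rewrite addr_ge0// mulr_ge0// ltW.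
rewrite EFinM -[in u%:E](series_pow_erlang_cdf q0 u0) -SE// /S -nneseriesZl; last first.
  move=> j _; rewrite lee_fin !mulr_ge0 ?expR_ge0 ?exprn_ge0 ?invr_ge0//.
  by apply: sumr_ge0 => i _; rewrite mulr_ge0.
rewrite -nneseriesD; last 2 first.
- move=> j _; rewrite lee_fin !mulr_ge0 ?expR_ge0 ?exprn_ge0 ?invr_ge0//.
  exact: mean_weight_ge0.
- move=> j _; rewrite -EFinM lee_fin mulr_ge0 ?(ltW c0)// !mulr_ge0 ?expR_ge0 ?exprn_ge0 ?invr_ge0//.
  by apply: sumr_ge0 => i _; rewrite mulr_ge0.
apply: eq_eseriesr => j _; rewrite -EFinM -EFinD; congr EFin.
have := mean_weightE k l lam (ltW c0) j; rewrite rate_sumE -/q -/A => <-.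
ring.
Qed.
End mean_queue_length.

(** * Time change by the inverse subordinator *)

Section independent_events.
Context {R : realType} {d : measure_display} {T : measurableType d} (P : probability T R).
Variable E : set T.
Hypothesis mE : measurable E.

Definition indep_event (F : set T) := P (E `&` F) = (P E * P F)%E.

Lemma indep_event_setT : indep_event setT.
Proof. by rewrite /indep_event setIT probability_setT mule1. Qed.

(** The events {Y < x} arise from the events {t < D u} by two operations, proper differences and
    increasing unions; both preserve independence of [E]. *)
Lemma indep_event_setD F G : measurable F -> measurable G -> G `<=` F ->
  indep_event F -> indep_event G -> indep_event (F `\` G).
Proof.
move=> mF mG GF iF iG; rewrite /indep_event setIDA !measureD//; last 3 first.
- by rewrite ltey_eq fin_num_measure.
- exact: measurableI.
- by rewrite ltey_eq fin_num_measure//; exact: measurableI.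
rewrite -setIA (setIidr GF) muleBr ?fin_num_measure//; last by rewrite fin_num_adde_defr// fin_num_measure.
by congr (_ - _)%E; [exact: iF|exact: iG].
Qed.

Lemma indep_event_bigcup (F : nat -> set T) : (forall n, measurable (F n)) ->
  (forall m n, (m <= n)%N -> F m `<=` F n) -> (forall n, indep_event (F n)) ->
  indep_event (\bigcup_n F n).
Proof.
move=> mF ndF iF.
have c1 : (P \o (fun n => E `&` F n)) n @[n --> \oo] --> P (E `&` \bigcup_n F n).
  rewrite setI_bigcupr; apply: nondecreasing_cvg_mu.
  - by move=> n; exact: measurableI.
  - by apply: bigcup_measurable => n _; exact: measurableI.
  - by move=> m n mn; apply/subsetPset => w [Ew /(ndF _ _ mn)].
have c2 : (P E * (P \o F) n)%E @[n --> \oo] --> (P E * P (\bigcup_n F n))%E.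
  apply: cvgeZl; first by rewrite fin_num_measure.
  apply: nondecreasing_cvg_mu => //; first exact: bigcup_measurable.
  by move=> m n mn; apply/subsetPset; exact: ndF.
rewrite /indep_event -(cvg_lim _ c1)// -(cvg_lim _ c2)//.
by congr (lim (_ @ \oo)); apply/funext => n; exact: iF.
Qed.
End independent_events.

(** * Level events of the inverse subordinator *)

Section inverse_subordinator.
Context {R : realType}.
Notation leb := (@lebesgue_measure R).
Local Notation Rp := (`[0%R, +oo[%classic : set R).
Variables (theta alpha : R) (d : measure_display) (T : measurableType d)
  (P : probability T R) (D : R -> T -> R).
Hypotheses (theta0 : 0 < theta) (alpha0 : 0 < alpha)
  (hD : is_tempered_subordinator theta alpha P D).
Variable t : R.
Hypothesis t0 : 0 <= t.

Local Notation Y := (inv_sub D t).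
Local Notation S w := [set x | 0 < x /\ t < D x w].

Let exceed := [set w | exists x, 0 < x /\ t < D x w].
(** As paths increase, this countable union detects whether t is exceeded at some time before x. *)
Let before x := \bigcup_n [set w | 0 < x - n.+1%:R^-1 /\ t < D (x - n.+1%:R^-1) w].

Let has_lbS w : has_lbound (S w).
Proof. by exists 0 => x [/ltW]. Qed.

Lemma inv_sub_ge0 w : 0 <= Y w.
Proof.
have [S0|S0] := eqVneq (S w) set0; first by rewrite /inv_sub S0 inf0.
apply: lb_le_inf; first exact/set0P.
by move=> x [/ltW].
Qed.

Let mD_gt u : measurable [set w | t < D u w].
Proof.
rewrite (_ : mkset _ = D u @^-1` `]t, +oo[).
  by rewrite -[X in measurable X]setTI; apply: (subordinator_measurable hD).
by apply/seteqP; split => w /=; rewrite in_itv/= andbT.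
Qed.

Lemma exceedE : exceed = \bigcup_n [set w | t < D n.+1%:R w].
Proof.
apply/seteqP; split => [w [x [x0 xD]]|w [n _ /= nD]]; last by exists n.+1%:R.
exists (Num.truncn x) => //=; apply: lt_le_trans xD _.
apply: (subordinator_mono hD); [exact: ltW|exact/ltW/truncnS_gt].
Qed.

Lemma measurable_exceed : measurable exceed.
Proof. by rewrite exceedE; apply: bigcup_measurable => n _; exact: mD_gt. Qed.

Let before_item x n : [set w | 0 < x - n.+1%:R^-1 /\ t < D (x - n.+1%:R^-1) w] =
  if 0 < x - n.+1%:R^-1 then [set w | t < D (x - n.+1%:R^-1) w] else set0.
Proof. by case: ifPn => h; apply/seteqP; split => w //= [] // /negP; rewrite h. Qed.

Lemma measurable_before x : measurable (before x).
Proof. by apply: bigcup_measurable => n _; rewrite before_item; case: ifP. Qed.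

Let before_mono x m n : (m <= n)%N ->
  [set w | 0 < x - m.+1%:R^-1 /\ t < D (x - m.+1%:R^-1) w] `<=`
  [set w | 0 < x - n.+1%:R^-1 /\ t < D (x - n.+1%:R^-1) w].
Proof.
move=> mn w [x0 xD].
have le_mn : x - m.+1%:R^-1 <= x - n.+1%:R^-1 :> R.
  by rewrite lerD2l lerN2 lef_pV2 ?posrE// ler_nat ltnS.
split; first exact: lt_le_trans le_mn.
by apply: lt_le_trans xD _; apply: (subordinator_mono hD) => //; exact: ltW.
Qed.

Lemma before_exceed x : before x `<=` exceed.
Proof. by move=> w [n _ [x0 xD]]; exists (x - n.+1%:R^-1). Qed.

(** On paths that never exceed t the infimum is taken over the empty set and equals 0, so these
    paths belong to {Y < x}; hence the complement of a difference. *)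
Lemma inv_sub_lt x : 0 < x -> [set w | Y w < x] = ~` (exceed `\` before x).
Proof.
move=> x0; apply/seteqP; split => w /= => [Yx [ew nb]|/not_andP[ne|/contrapT[n _ [xn xD]]]].
- have [y [y0 yD] yx] := inf_lt ew Yx.
  apply: nb; have [n /ltW nxy] : exists n, n.+1%:R^-1 < x - y.
    have xy : 0 < x - y by rewrite subr_gt0.
    exists (Num.truncn (x - y)^-1); rewrite invf_plt ?posrE//.
    exact: truncnS_gt.
  have yxn : y <= x - n.+1%:R^-1 by rewrite lerBrDr -lerBrDl.
  exists n => //; split; first exact: lt_le_trans yxn.
  by apply: lt_le_trans yD _; apply: (subordinator_mono hD) => //; exact: ltW.
- rewrite /inv_sub (_ : S w = set0) ?inf0//.
  by rewrite -subset0 => y Sy; apply: ne; exists y.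
- apply: (@le_lt_trans _ _ (x - n.+1%:R^-1)); last by rewrite ltrBlDr ltrDl.
  exact: ge_inf.
Qed.

Lemma inv_sub_lt_le0 x : x <= 0 -> [set w | Y w < x] = set0.
Proof.
by move=> x0; rewrite -subset0 => w /= /lt_le_trans /(_ x0); rewrite ltNge inv_sub_ge0.
Qed.

Lemma measurable_inv_sub_lt x : measurable [set w | Y w < x].
Proof.
have [x0|x0] := ltP 0 x; last by rewrite inv_sub_lt_le0.
rewrite inv_sub_lt//; apply: measurableC; apply: measurableD.
  exact: measurable_exceed.
exact: measurable_before.
Qed.

Lemma measurable_inv_sub : measurable_fun setT Y.
Proof.
apply: (measurability _ (RGenInftyO.measurableE R)) => _ [_ [x ->] <-].
rewrite setTI (_ : _ @^-1` _ = [set w | Y w < x]); first exact: measurable_inv_sub_lt.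
by apply/seteqP; split => w /=; rewrite in_itv.
Qed.

Lemma indep_inv_sub_lt (E : set T) : measurable E ->
  (forall u, 0 < u -> indep_event P E [set w | t < D u w]) ->
  forall x, indep_event P E [set w | Y w < x].
Proof.
move=> mE iE x.
have [x0|x0] := ltP 0 x; last first.
  by rewrite inv_sub_lt_le0// /indep_event setI0 !measure0 mule0.
rewrite inv_sub_lt// -setTD; apply: indep_event_setD => //.
- by apply: measurableD; [exact: measurable_exceed|exact: measurable_before].
- exact: indep_event_setT.
apply: indep_event_setD => //.
- exact: measurable_exceed.
- exact: measurable_before.
- exact: before_exceed.
- rewrite exceedE; apply: indep_event_bigcup => // [m n mn w /= mD|n].
    by apply: lt_le_trans mD _; apply: (subordinator_mono hD); rewrite ?ler_nat.
  exact: iE.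
apply: indep_event_bigcup => // [n|m n|n].
- by rewrite before_item; case: ifP.
- exact: before_mono.
- by rewrite before_item; case: ifP => h; [exact: iE|rewrite /indep_event setI0 !measure0 mule0].
Qed.

(** Never exceeding t implies D_n <= t for every n >= 1, an event whose probability decays
    exponentially in n. *)
Lemma exceed_negligible : P (~` exceed) = 0%E.
Proof.
have psi1 := psi_gt0 theta0 alpha0 ltr01.
have le n : (P (~` exceed) <= (expR t * expR (- n.+1%:R * tempered_psi theta alpha 1))%:E)%E.
  apply: (@le_trans _ _ (subordinator_cdf P D n.+1%:R t)%:E); last first.
    by rewrite lee_fin (subordinator_cdf_le hD).
  rewrite (subordinator_cdfE hD)// le_measure ?inE//.
  - by apply: measurableC; exact: measurable_exceed.
  - rewrite (_ : mkset _ = ~` [set w | t < D n.+1%:R w]); first exact: measurableC.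
    by apply/seteqP; split => w /=; rewrite leNgt => /negP.
  by move=> w ne /=; rewrite leNgt; apply/negP => nD; apply: ne; exists n.+1%:R.
apply/eqP; rewrite eq_le measure_ge0 andbT.
have c : (expR t * expR (- n.+1%:R * tempered_psi theta alpha 1))%:E @[n --> \oo] --> 0%:E.
  apply: cvg_EFin; first exact: nearW.
  rewrite -(mulr0 (expR t)); apply: cvgMl_tmp.
  rewrite [X in X @ _](_ : _ = (fun n => expR (- tempered_psi theta alpha 1) ^+ n.+1)); last first.
    by apply/funext => n; rewrite -expRM_natl; congr expR; ring.
  have lt1 : `|expR (- tempered_psi theta alpha 1)| < 1.
    by rewrite ger0_norm ?expR_ge0// -[ltRHS]expR0 ltr_expR oppr_lt0.
  have := cvg_expr lt1.
  by rewrite (cvg_shiftS (fun n => expR (- tempered_psi theta alpha 1) ^+ n)).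
rewrite -[X in (_ <= X)%E](cvg_lim _ c)//.
apply: lime_ge; first by apply/cvg_ex; exists 0%E.
exact: nearW.
Qed.
End inverse_subordinator.

(** * Evaluation of an event at an independent random time *)

Section time_change.
Context {R : realType} {d : measure_display} {T : measurableType d} (P : probability T R).
Variables (Z : T -> R) (E : R -> set T).
Hypotheses (Z0 : forall w, 0 <= Z w) (mZ : measurable_fun setT Z)
  (mE : forall u, measurable (E u))
  (rcE : forall w u, 0 <= u -> exists2 e : R, 0 < e &
     forall s, u <= s < u + e -> (w \in E s) = (w \in E u))
  (iE : forall u x, 0 <= u -> indep_event P (E u) [set w | Z w < x]).

Let K n w := Num.truncn (n.+1%:R * Z w).
Let g n j : R := j.+1%:R / n.+1%:R.

Let g0 n j : 0 <= g n j.
Proof. by rewrite divr_ge0. Qed.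

Let mK n j : measurable [set w | K n w = j].
Proof. by apply: measurable_truncn; apply: measurable_funM. Qed.

Let iK n j u : 0 <= u -> indep_event P (E u) [set w | K n w = j].
Proof.
move=> u0.
have mlt x : measurable [set w | Z w < x].
  rewrite (_ : mkset _ = Z @^-1` `]-oo, x[); first by rewrite -[X in measurable X]setTI; exact: mZ.
  by apply/seteqP; split => w /=; rewrite in_itv.
rewrite (_ : mkset _ = [set w | Z w < j.+1%:R / n.+1%:R] `\` [set w | Z w < j%:R / n.+1%:R]).
  apply: indep_event_setD => //; try exact: iE.
  move=> w /= /lt_trans; apply.
  by rewrite ltr_pM2r ?invr_gt0// ltr_nat.
apply/seteqP; split => w /=.
  move=> Kj; have nZ0 : 0 <= n.+1%:R * Z w by rewrite mulr_ge0.
  have := truncn_itv nZ0; rewrite -/(K n w) Kj => /andP[jZ Zj].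
  split; first by rewrite ltr_pdivlMr// mulrC.
  by apply/negP; rewrite -leNgt ler_pdivrMr// mulrC.
move=> [Zj /negP]; rewrite -leNgt ler_pdivrMr// => jZ.
by apply/truncn_def; rewrite mulrC jZ/= -ltr_pdivlMr.
Qed.

Let fn n w : R := (w \in E (grid_up n (Z w)))%:R.
Let pr u := fine (P (E u)).
Let prE u : (pr u)%:E = P (E u). Proof. by rewrite fineK// fin_num_measure. Qed.
Let pn n w := pr (grid_up n (Z w)).

Let mfn n : measurable_fun setT (fn n).
Proof.
apply: (measurable_fun_natcomp (N := K n) (f := fun j w => (w \in E (g n j))%:R : R)) => j.
  by rewrite setTI; exact: mK.
rewrite (_ : (fun w => _) = \1_(E (g n j)) :> (T -> R)); first exact: measurable_indic.
by apply/funext => w; rewrite indicE.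
Qed.

Let mpn n : measurable_fun setT (pn n).
Proof.
apply: (measurable_fun_natcomp (N := K n) (f := fun j w => pr (g n j))) => j //.
by rewrite setTI; exact: mK.
Qed.

(** The grid value of Z is constant on each level set of [K n], where independence at a fixed time
    factorizes the probability. *)
Let int_fn_pn n : (\int[P]_w (fn n w)%:E = \int[P]_w (pn n w)%:E)%E.
Proof.
transitivity (\sum_(j <oo) (P (E (g n j)) * P [set w | K n w = j]))%E.
  transitivity (\int[P]_w \sum_(j <oo) (\1_(E (g n j) `&` [set w | K n w = j]) w)%:E)%E.
    apply: eq_integral => w _; rewrite -[LHS](nneseries_pick (K n w) (fun j => (w \in E (g n j))%:R)).
    apply: eq_eseriesr => j _; rewrite indicE in_setI mulrC -natrM mulnb; congr ((_ && _)%:R)%:E.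
    by apply/eqP/idP; rewrite inE.
  rewrite integral_nneseries//.
  - apply: eq_eseriesr => j _; rewrite integral_indic// ?setIT; first exact: iK.
    exact: measurableI.
  - move=> j; apply/measurable_EFinP; apply: measurable_indic; exact: measurableI.
transitivity (\int[P]_w \sum_(j <oo) ((pr (g n j))%:E * (\1_([set w | K n w = j]) w)%:E))%E.
  rewrite integral_nneseries//.
  - apply: eq_eseriesr => j _; rewrite ge0_integralZl_EFin//.
    + by rewrite integral_indic// setIT prE.
    + by apply/measurable_EFinP; exact: measurable_indic.
    + exact: fine_ge0.
  - by move=> j; apply: measurable_funeM; apply/measurable_EFinP; exact: measurable_indic.
  - by move=> j w _; rewrite -EFinM lee_fin mulr_ge0// fine_ge0.
apply: eq_integral => w _; rewrite -[RHS](nneseries_pick (K n w) (fun j => pr (g n j))).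
apply: eq_eseriesr => j _; rewrite -EFinM indicE mulrC; congr ((nat_of_bool _)%:R * _)%:E.
by apply/idP/idP => [/set_mem/= ->|/eqP Kj]; [exact: eqxx|rewrite mem_set].
Qed.

Let grid_near u w : 0 <= u -> \forall n \near \oo, (w \in E (grid_up n u)) = (w \in E u).
Proof.
move=> u0; have [e e0 He] := rcE w u0.
have : \forall n \near \oo, grid_up n u < u + e.
  by apply: (cvgr_lt _ (grid_up_cvg u0)); rewrite ltrDl.
by apply: filterS => n nu; apply: He; rewrite nu ltW// grid_up_gt.
Qed.

Let fn_cvg w : fn n w @[n --> \oo] --> ((w \in E (Z w))%:R : R).
Proof.
by apply: cvg_near_cst; apply: filterS (grid_near w (Z0 w)) => n /= h; rewrite /fn h.
Qed.

Let ind01 (b : bool) : (`|(b%:R : R)%:E| <= 1)%E.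
Proof. by rewrite lee_fin; case: b; rewrite ?normr1 ?normr0. Qed.

(** Right-continuity of the paths passes to the probabilities by dominated convergence. *)
Let pn_cvg w : pn n w @[n --> \oo] --> pr (Z w).
Proof.
have mi u : measurable_fun setT (fun w => ((w \in E u)%:R : R)%:E).
  apply/measurable_EFinP; rewrite (_ : (fun w => _) = \1_(E u) :> (T -> R)); first exact: measurable_indic.
  by apply/funext => v; rewrite indicE.
have prI u : ((pr u)%:E = \int[P]_v ((v \in E u)%:R)%:E)%E.
  by rewrite prE -[E u in LHS]setIT -integral_indic//.
have [] // := @dominated_convergence _ T R P setT measurableT
    (fun n v => ((v \in E (grid_up n (Z w)))%:R)%:E) (fun v => ((v \in E (Z w))%:R)%:E) (cst 1%E).
- apply: aeW => v _; apply: cvg_EFin; first exact: nearW.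
  by apply: cvg_near_cst; apply: filterS (grid_near v (Z0 w)) => n /= ->.
- exact: finite_measure_integrable_cst.
- by apply: aeW => v n _; exact: ind01.
move=> _ _; rewrite -prI.
under eq_fun do rewrite -prI.
exact: fine_cvg.
Qed.

Lemma measurable_time_change : measurable [set w | E (Z w) w].
Proof.
rewrite (_ : mkset _ = (fun w => ((w \in E (Z w))%:R : R)) @^-1` [set 1]).
  rewrite -[X in measurable X]setTI.
  suff mg : measurable_fun setT (fun w => ((w \in E (Z w))%:R : R)) by exact: mg.
  by apply: (measurable_fun_cvg mfn) => w _; exact: fn_cvg.
apply/seteqP; split => w /=; first by move=> Ew; rewrite mem_set.
by case: (boolP (w \in _)) => [/set_mem//|_ /eqP]; rewrite eq_sym oner_eq0.
Qed.

Lemma measurable_prob_time_change : measurable_fun setT (fun w => fine (P (E (Z w)))).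
Proof. by apply: (measurable_fun_cvg mpn) => w _; exact: pn_cvg. Qed.

(* [Z] is approximated strictly from the right by its grid values, whose level sets are
   differences of events [Z < x]; the paths of [E] are right-continuous. *)
Lemma prob_time_change : (P [set w | E (Z w) w] = \int[P]_w (fine (P (E (Z w))))%:E)%E.
Proof.
transitivity (\int[P]_w ((w \in E (Z w))%:R)%:E)%E.
  rewrite -[X in P X]setIT -integral_indic//; last exact: measurable_time_change.
have [] // := @dominated_convergence _ T R P setT measurableT
    (fun n w => (fn n w)%:E) (fun v => ((v \in E (Z v))%:R)%:E) (cst 1%E).
- by move=> n; apply/measurable_EFinP; exact: mfn.
- apply/measurable_EFinP; apply: (measurable_fun_cvg mfn) => w _; exact: fn_cvg.
- apply: aeW => v _; apply: cvg_EFin; first exact: nearW.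
  exact: fn_cvg.
- exact: finite_measure_integrable_cst.
- by apply: aeW => v n _; exact: ind01.
move=> _ _ c1.
have [] // := @dominated_convergence _ T R P setT measurableT
    (fun n w => (pn n w)%:E) (fun v => (pr (Z v))%:E) (cst 1%E).
- by move=> n; apply/measurable_EFinP; exact: mpn.
- by apply/measurable_EFinP; exact: measurable_prob_time_change.
- apply: aeW => v _; apply: cvg_EFin; first exact: nearW.
  exact: pn_cvg.
- exact: finite_measure_integrable_cst.
- apply: aeW => v n _; rewrite prE gee0_abs//; exact: probability_le1.
move=> _ _ c2.
rewrite -(cvg_lim _ c1)// -(cvg_lim _ c2)//.
by congr (lim (_ @ \oo)); apply/funext => n; exact: int_fn_pn.
Qed.
End time_change.

(** * Moments as expectations over the inverse subordinator *)

Section inverse_moment_expectation.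
Context {R : realType}.
Notation leb := (@lebesgue_measure R).
Local Notation Rp := (`[0%R, +oo[%classic : set R).
Variables (theta alpha : R) (d : measure_display) (T : measurableType d)
  (P : probability T R) (D : R -> T -> R).
Hypotheses (theta0 : 0 < theta) (alpha0 : 0 < alpha)
  (hD : is_tempered_subordinator theta alpha P D).
Variables (t nu : R) (g : nat).
Hypotheses (t0 : 0 <= t).

Local Notation Y := (inv_sub D t).

Let erl := erlang_weight nu g.
Let erl0 u : Rp u -> 0 <= erl u.
Proof. by rewrite /= in_itv/= andbT; exact: erlang_weight_ge0. Qed.
Let merl (D' : set R) : measurable_fun D' erl.
Proof. by apply: measurable_funTS; apply: continuous_measurable_fun; exact: continuous_erlang_weight. Qed.

Let mset d' (U : measurableType d') (b : U -> bool) :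
  measurable_fun setT (fun w => (b w)%:R : R) -> measurable [set w | b w].
Proof.
move=> mb; rewrite (_ : mkset _ = (fun w => (b w)%:R : R) @^-1` [set 1]).
  by rewrite -[X in measurable X]setTI; exact: mb.
by apply/seteqP; split => w /=; case: (b w) => // /eqP; rewrite eq_sym oner_eq0.
Qed.

(** A general [chi] covers both the strict and the weak inequality between u and Y, between which
    the moment is squeezed. *)
Lemma erlang_tonelli (chi : R * T -> bool) : measurable_fun setT (fun z => (chi z)%:R : R) ->
  (\int[leb]_(u in Rp) ((erl u)%:E * P [set w | chi (u, w)]) =
   \int[P]_w \int[leb]_(u in [set u : R | (0 <= u)%R && chi (u, w)]) (erl u)%:E)%E.
Proof.
move=> mchi.
pose f (z : R * T) : \bar R := (\1_Rp z.1 * (erl z.1 * (chi z)%:R))%:E.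
have mf : measurable_fun setT f.
  apply/measurable_EFinP; apply: measurable_funM.
    by apply: measurableT_comp => //; exact: measurable_indic.
  apply: measurable_funM => //.
  by apply: (@measurableT_comp _ _ _ _ _ _ erl) => //; exact: merl.
have f0 z : (0 <= f z)%E.
  rewrite lee_fin indicE.
  have [zR|zR] := boolP (z.1 \in Rp); last by rewrite mul0r.
  by rewrite mul1r mulr_ge0//; exact: erl0 (set_mem zR).
have msec u : measurable [set w | chi (u, w)].
  apply: mset; apply: (measurableT_comp mchi); exact: pair1_measurable.
transitivity (\int[leb]_u \int[P]_w f (u, w))%E.
  rewrite integral_mkcond; apply: eq_integral => u _; rewrite patchE.
  case: ifPn => uR; last first.
    by rewrite integral0_eq// => w _; rewrite /f /= indicE (negbTE uR) mul0r.
  rewrite -[X in P X]setIT -integral_indic//.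
  rewrite -ge0_integralZl_EFin//; last 2 first.
  - by apply/measurable_EFinP; exact: measurable_indic.
  - exact: erl0 (set_mem uR).
  apply: eq_integral => w _; rewrite /f /= !indicE uR mul1r -EFinM.
  by congr (_ * (nat_of_bool _)%:R)%:E; apply/idP/idP; rewrite inE.
rewrite (@fubini_tonelli _ _ _ _ _ leb P f)//.
apply: eq_integral => w _; rewrite [RHS]integral_mkcond; apply: eq_integral => u _.
rewrite patchE /f /= indicE mem_setE in_itv/= andbT.
have -> : (u \in [set u : R | (0 <= u)%R && chi (u, w)]) = (0 <= u) && chi (u, w).
  by apply/idP/idP; rewrite inE.
by case: (0 <= u); case: (chi _); rewrite ?(mul1r, mul0r, mulr1, mulr0).
Qed.

(* [u < Y] implies [D u <= t], which almost surely implies [u <= Y]. *)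
Lemma inverse_moment_expectation : inverse_moment P D nu g t =
  (\int[P]_w \int[leb]_(u in `[0%R, Y w]) (erl u)%:E)%E.
Proof.
have mY : measurable_fun setT Y := measurable_inv_sub hD t.
have mY2 : measurable_fun setT (fun z : R * T => Y z.2) by exact: measurableT_comp.
have mle : measurable_fun setT (fun z : R * T => ((z.1 <= Y z.2)%R%:R : R)).
  exact: measurable_le_indicator.
have mlt : measurable_fun setT (fun z : R * T => ((z.1 < Y z.2)%R%:R : R)).
  rewrite (_ : (fun z => _) = (fun z : R * T => 1 - (Y z.2 <= z.1)%R%:R)).
    by apply: measurable_funB => //; exact: measurable_le_indicator.
  by apply/funext => z; rewrite ltNge; case: (_ <= _); rewrite ?subrr ?subr0.
have mle1 u : measurable [set w | u <= Y w] by apply: mset; exact: measurable_le_indicator.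
have mD u : measurable [set w | D u w <= t].
  by apply: mset; apply: measurable_le_indicator => //; exact: (subordinator_measurable hD).
have mlt1 u : measurable [set w | u < Y w].
  rewrite (_ : mkset _ = ~` [set w | Y w <= u]).
    by apply: measurableC; apply: mset; exact: measurable_le_indicator.
  by apply/seteqP; split => w /=; rewrite ltNge => /negP.
have mcdf (D' : set R) : measurable_fun D' (fun u => subordinator_cdf P D u t).
  apply: measurable_funTS; apply: nonincreasing_measurable => //.
  exact: (subordinator_cdf_anti hD).
(* Measurability in u comes from the monotonicity of the events. *)
have mprob (B : R -> set T) : (forall u, measurable (B u)) -> (forall u v, u <= v -> B v `<=` B u) ->
    measurable_fun Rp (fun u => (erl u)%:E * P (B u))%E.
  move=> mB aB; rewrite (_ : (fun u => _) = (fun u => (erl u * fine (P (B u)))%:E)); last first.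
    by apply/funext => u; rewrite [RHS]EFinM fineK// fin_num_measure.
  apply/measurable_EFinP; apply: measurable_funM; first exact: merl.
  apply: measurable_funTS; apply: nonincreasing_measurable => // u v uv.
  by apply: fine_le; rewrite ?fin_num_measure// le_measure ?inE//; exact: aB.
have lbd w u : 0 <= u -> u < Y w -> D u w <= t.
  rewrite le_eqVlt => /predU1P[<-|u0] uY; first by have [_ -> _ _ _] := hD.
  rewrite leNgt; apply/negP => tD; move: uY; rewrite ltNge => /negP; apply.
  by apply: ge_inf => //; exists 0 => x [/ltW].
have ubd w u : 0 <= u -> (exists x, 0 < x /\ t < D x w) -> D u w <= t -> u <= Y w.
  move=> u0 ex Dt; apply: lb_le_inf; first by [].
  move=> x [x0 tD]; rewrite leNgt; apply/negP => xu.
  have := lt_le_trans tD (subordinator_mono hD w (ltW x0) (ltW xu)).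
  by rewrite ltNge Dt.
have lower : (\int[leb]_(u in Rp) ((erl u)%:E * P [set w | (u < Y w)%R]) <= inverse_moment P D nu g t)%E.
  apply: ge0_le_integral => //.
  - by move=> u uR; rewrite mule_ge0// lee_fin erl0.
  - by apply: mprob => // u v uv w /=; exact: le_lt_trans.
  - by apply/measurable_EFinP; apply: measurable_funM; [exact: merl|exact: mcdf].
  - move=> u uR; have u0 : 0 <= u by move: uR; rewrite /= in_itv/= andbT.
    rewrite [leRHS]EFinM lee_wpmul2l ?lee_fin ?erl0// (subordinator_cdfE hD)// le_measure ?inE//.
    by move=> w /=; exact: lbd.
have upper : (inverse_moment P D nu g t <= \int[leb]_(u in Rp) ((erl u)%:E * P [set w | (u <= Y w)%R]))%E.
  apply: ge0_le_integral => //.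
  - by move=> u uR; rewrite lee_fin mulr_ge0 ?erl0 ?subordinator_cdf_ge0.
  - by apply/measurable_EFinP; apply: measurable_funM; [exact: merl|exact: mcdf].
  - by apply: mprob => // u v uv w /=; exact: le_trans.
  - move=> u uR; have u0 : 0 <= u by move: uR; rewrite /= in_itv/= andbT.
    rewrite [leLHS]EFinM lee_wpmul2l ?lee_fin ?erl0// (subordinator_cdfE hD)//.
    have mex := measurable_exceed hD t.
    (* The null event that t is never exceeded is added; there Y is 0, however large u may be. *)
    rewrite -[leRHS]adde0 -(exceed_negligible theta0 alpha0 hD t).
    apply: (@le_trans _ _ (P ([set w | u <= Y w] `|` ~` [set w | exists x, 0 < x /\ t < D x w]))).
      rewrite le_measure ?inE//; first by apply: measurableU => //; exact: measurableC.
      move=> w /= Dt; have [ex|nex] := pselect (exists x, 0 < x /\ t < D x w); last by right.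
      by left; exact: ubd.
    by apply: measureU2 => //; exact: measurableC.
apply/eqP; rewrite eq_le; apply/andP; split.
  apply: (le_trans upper); rewrite (erlang_tonelli mle) le_eqVlt; apply/orP; left; apply/eqP.
  by apply: eq_integral => w _; congr (integral _ _ _).
apply: le_trans lower; rewrite (erlang_tonelli mlt) le_eqVlt; apply/orP; left; apply/eqP.
(* The lower and the upper bound differ by the end point [Y w] only, a null set. *)
apply: eq_integral => w _; rewrite -integral_itv_bndo_bndc; last first.
  by apply/measurable_EFinP; exact: merl.
by congr (integral _ _ _).
Qed.
End inverse_moment_expectation.

(** * The time-changed queue *)

Section subordinated_queue.
Context {R : realType}.
Notation leb := (@lebesgue_measure R).
Variables (k l : nat) (mu : R) (lam : nat -> R) (theta alpha : R).
Hypotheses (k0 : (0 < k)%N) (mu0 : 0 < mu) (lam0 : forall i : 'I_l, 0 <= lam i.+1)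
  (theta0 : 0 < theta) (alpha0 : 0 < alpha).
Variables (d : measure_display) (T : measurableType d) (P : probability T R)
    (Q : R -> T -> state) (D : R -> T -> R).
Hypotheses (hQ : is_erlang_chain k l lam mu P Q)
    (hD : is_tempered_subordinator theta alpha P D)
    (hind : indep_processes P Q D).
Variable t : R.
Hypothesis t0 : 0 <= t.

Local Notation Y := (inv_sub D t).
Let c := k%:R * mu.
Let q := Lam l lam + c.
Let A := k%:R * (\sum_(i < l) i.+1%:R * lam i.+1).
Local Notation W i := (return_weight k l lam c i 0).
Local Notation G nu g := (inverse_moment P D nu g t).

Let c0 : 0 < c. Proof. by rewrite mulr_gt0// ltr0n. Qed.
Let q0 : 0 < q.
Proof.
rewrite /q -rate_sumE ltr_wpDl//; exact: sumr_ge0.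
Qed.
Let A0 : 0 <= A.
Proof. by rewrite mulr_ge0//; apply: sumr_ge0 => i _; rewrite mulr_ge0. Qed.
Let W0 i : 0 <= W i.
Proof. by apply: return_weight_ge0 => //; exact: ltW. Qed.

Let E y u := [set w | Q u w = y].

Let mE y u : measurable (E y u).
Proof. by have [h _ _] := hQ; exact: h. Qed.

Lemma chain_prob u y : 0 <= u -> (P (E y u) = (ptrans k l lam mu u (0, 0) y)%:E)%E.
Proof.
move=> u0; have [_ _ h] := hQ.
have := h [:: u] [:: y] erefl; rewrite /= andbT => /(_ u0).
rewrite big_ord1 /= subr0 => <-; congr (P _); apply/seteqP; split => w /=.
  by move=> Qw [|i].
by move=> /(_ 0%N isT).
Qed.

Lemma indep_chain_inv_sub y u x : 0 <= u -> indep_event P (E y u) [set w | Y w < x].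
Proof.
move=> u0; apply: (indep_inv_sub_lt hD) => // s s0.
have := @hind [:: u] [:: y] [:: s] [:: `]t, +oo[%classic] => /=.
rewrite (_ : fdd_event _ _ _ = E y u); last first.
  apply/seteqP; split => w /=; first by move=> /(_ 0%N isT).
  by move=> Qw [|i].
rewrite (_ : [set w | forall i, (i < 1)%N -> _] = [set w | t < D s w]); last first.
  apply/seteqP; split => w /=.
    by move=> /(_ 0%N isT) /=; rewrite in_itv/= andbT.
  by move=> tD [|i] //= _; rewrite in_itv/= andbT.
by apply => B; rewrite inE => /eqP ->.
Qed.

Let rcE y w u : 0 <= u -> exists2 e : R, 0 < e &
     forall s, u <= s < u + e -> (w \in E y s) = (w \in E y u).
Proof.
move=> u0; have [_ h _] := hQ; have [e e0 He] := h w u u0.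
by exists e => // s /He Qs; apply/idP/idP; rewrite !inE /E /= Qs.
Qed.

Let EY y := [set w | Q (Y w) w = y].

Let mEY y : measurable (EY y).
Proof.
exact: (measurable_time_change (inv_sub_ge0 D t) (measurable_inv_sub hD t) (mE y) (@rcE y)).
Qed.

Let ptY y w : (fine (P (E y (Y w))))%:E = (ptrans k l lam mu (Y w) (0, 0) y)%:E.
Proof. by rewrite chain_prob// inv_sub_ge0. Qed.

Let mptY y : measurable_fun setT (fun w => (ptrans k l lam mu (Y w) (0, 0) y)%:E).
Proof.
rewrite (_ : (fun w => _) = (fun w => (fine (P (E y (Y w))))%:E)); last first.
  by apply/funext => w; rewrite ptY.
apply/measurable_EFinP.
exact: (measurable_prob_time_change P (inv_sub_ge0 D t) (measurable_inv_sub hD t) (mE y) (@rcE y)).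
Qed.

Let pEY y : (P (EY y) = \int[P]_w (ptrans k l lam mu (Y w) (0, 0) y)%:E)%E.
Proof.
rewrite (prob_time_change (inv_sub_ge0 D t) (measurable_inv_sub hD t) (mE y) (@rcE y)).
  by apply: eq_integral => w _; rewrite ptY.
by move=> u x; exact: indep_chain_inv_sub.
Qed.

(** The integrand is decomposed over the states, which reduces its measurability to that of the
    events [EY y]. *)
Lemma mean_queue_series : mean_queue k P Q D t =
  (\sum_(a <oo) \sum_(b <oo) ((gk k (a, b))%:R%:E * P (EY (a, b))))%E.
Proof.
have m1 y : measurable_fun setT (fun w => (\1_(EY y) w)%:E : \bar R).
  by apply/measurable_EFinP; exact: measurable_indic.
transitivity (\int[P]_w \sum_(a <oo) \sum_(b <oo) ((gk k (a, b))%:R%:E * (\1_(EY (a, b)) w)%:E))%E.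
  apply: eq_integral => w _; case E0 : (Q (Y w) w) => [x1 x2].
  rewrite -(nneseries_pick x1 (fun a => (gk k (a, x2))%:R)).
  apply: eq_eseriesr => a _.
  rewrite EFinM -(nneseries_pick x2 (fun b => (gk k (a, b))%:R)) -nneseriesZl; last first.
    by move=> b _; rewrite lee_fin mulr_ge0.
  apply: eq_eseriesr => b _; rewrite -!EFinM indicE mulrA mulrC -natrM mulnb.
  congr (_ * (nat_of_bool _)%:R)%:E.
  rewrite [RHS](_ : _ = ((x1, x2) == (a, b))); first by rewrite xpair_eqE.
  by rewrite -E0; apply/idP/eqP => [/set_mem|/mem_set].
rewrite integral_nneseries//.
- apply: eq_eseriesr => a _; rewrite integral_nneseries//.
  + by apply: eq_eseriesr => b _; rewrite ge0_integralZl_EFin// integral_indic ?setIT.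
  + by move=> b; apply: measurable_funeM.
- move=> a; apply: measurable_nneseries => [b w _|b]; first by rewrite -EFinM lee_fin mulr_ge0.
  exact: measurable_funeM.
- by move=> a w _; apply: nneseries_ge0 => b _ _; rewrite -EFinM lee_fin mulr_ge0.
Qed.

Let mcdf (p : R) n : p != 0 -> measurable_fun setT (fun w => erlang_cdf p n (Y w)).
Proof.
move=> p0; apply: (@measurableT_comp _ _ _ _ _ _ (erlang_cdf p n)); last exact: measurable_inv_sub hD t.
apply: continuous_measurable_fun => x.
apply: differentiable_continuous; apply/derivable1_diffP.
by have [] := is_derive_erlang_cdf n x p0.
Qed.

Let inverse_moment_cdf n : (G q n = \int[P]_w (erlang_cdf q n (Y w))%:E)%E.
Proof.
rewrite (inverse_moment_expectation theta0 alpha0 hD)//; apply: eq_integral => w _.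
by rewrite integral_erlang_weight ?inv_sub_ge0// gt_eqF.
Qed.

Let inverse_moment0 : (G 0 0 = \int[P]_w (Y w)%:E)%E.
Proof.
rewrite (inverse_moment_expectation theta0 alpha0 hD)//; apply: eq_integral => w _.
transitivity (\int[leb]_(u in `[0%R, Y w]) (cst 1%E u))%E.
  by apply: eq_integral => u _; rewrite /erlang_weight fact0 expr0 divr1 mul1r oppr0 mul0r expR0.
rewrite integral_cst//= mul1e lebesgue_measure_itv/= lte_fin.
case: ltP => [_|Y0]; first by rewrite -EFinD subr0.
by congr EFin; apply/eqP; rewrite eq_le inv_sub_ge0.
Qed.

Let cdfY_ge0 i w : 0 <= erlang_cdf q i (Y w).
Proof. by rewrite erlang_cdf_ge0 ?inv_sub_ge0. Qed.

(** This is [mean_ptransE] at the random time u = Y, integrated; [G 0 0] is the mean of Y. At this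
    stage the mean queue length may still be infinite. *)
Lemma mean_queue_identity :
  (mean_queue k P Q D t + c%:E * G 0 0 = A%:E * G 0 0 + c%:E * \sum_(i <oo) ((W i)%:E * G q i))%E.
Proof.
have mY : measurable_fun setT Y := measurable_inv_sub hD t.
have Yge w : 0 <= Y w by exact: inv_sub_ge0.
have pt0 y w : 0 <= ptrans k l lam mu (Y w) (0, 0) y by rewrite -lee_fin -chain_prob.
pose h (a b : nat) w := ((gk k (a, b))%:R%:E * (ptrans k l lam mu (Y w) (0, 0) (a, b))%:E : \bar R)%E.
have h0 a b w : (0 <= h a b w)%E by rewrite /h -EFinM lee_fin mulr_ge0.
have mh a b : measurable_fun setT (h a b) by apply: measurable_funeM; exact: mptY.
have -> : mean_queue k P Q D t = (\int[P]_w \sum_(a <oo) \sum_(b <oo) h a b w)%E.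
  rewrite mean_queue_series integral_nneseries//.
  - apply: eq_eseriesr => a _; rewrite integral_nneseries//.
    by apply: eq_eseriesr => b _; rewrite pEY ge0_integralZl_EFin// => w _; rewrite lee_fin.
  - by move=> a; apply: measurable_nneseries.
  - by move=> a w _; apply: nneseries_ge0.
have IZ (a : R) : 0 <= a -> (a%:E * G 0 0 = \int[P]_w (a * Y w)%:E)%E.
  move=> a0; rewrite inverse_moment0 -ge0_integralZl_EFin//.
  - by move=> w _; rewrite lee_fin.
  - exact/measurable_EFinP.
have -> : (\sum_(i <oo) ((W i)%:E * G q i) = \int[P]_w \sum_(i <oo) (W i * erlang_cdf q i (Y w))%:E)%E.
  rewrite integral_nneseries//.
  - apply: eq_eseriesr => i _; rewrite inverse_moment_cdf -ge0_integralZl_EFin//.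
    + by move=> w _; rewrite lee_fin.
    + by apply/measurable_EFinP; apply: mcdf; rewrite gt_eqF.
  - move=> i; apply/measurable_EFinP; apply: measurable_funM => //; apply: mcdf; rewrite gt_eqF//.
  - by move=> i w _; rewrite lee_fin mulr_ge0.
have mS : measurable_fun setT (fun w => \sum_(i <oo) (W i * erlang_cdf q i (Y w))%:E)%E.
  apply: measurable_nneseries => [i w _|i]; first by rewrite lee_fin mulr_ge0.
  by apply/measurable_EFinP; apply: measurable_funM => //; apply: mcdf; rewrite gt_eqF.
have S0 w : (0 <= \sum_(i <oo) (W i * erlang_cdf q i (Y w))%:E)%E.
  by apply: nneseries_ge0 => i _ _; rewrite lee_fin mulr_ge0.
rewrite !IZ ?(ltW c0)// -ge0_integralZl_EFin ?(ltW c0)//.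
rewrite -!ge0_integralD//.
- by apply: eq_integral => w _; rewrite -mean_ptransE//.
- by move=> w _; rewrite lee_fin mulr_ge0.
- by apply/measurable_EFinP; exact: measurable_funM.
- by move=> w _; rewrite mule_ge0// lee_fin ltW.
- exact: measurable_funeM.
- by move=> w _; apply: nneseries_ge0 => a _ _; exact: nneseries_ge0.
- by apply: measurable_nneseries => [a w _|a]; [exact: nneseries_ge0|exact: measurable_nneseries].
- by move=> w _; rewrite lee_fin mulr_ge0// ltW.
- by apply/measurable_EFinP; exact: measurable_funM.
Qed.

(** Return weights are at most q^i, and with q^i in their place the series sums to the mean of Y. *)
Lemma series_return_moment_fin : (\sum_(i <oo) ((W i)%:E * G q i) < +oo)%E.
Proof.
apply: (@le_lt_trans _ _ (\sum_(i <oo) ((q ^+ i)%:E * G q i))%E).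
  apply: lee_nneseries => [i _ _|i _]; first by rewrite mule_ge0 ?inverse_moment_ge0// lee_fin.
  rewrite lee_wpmul2r ?inverse_moment_ge0// lee_fin /q -rate_sumE.
  by apply: return_weight_le => //; exact: ltW.
have qi i : 0 <= q ^+ i by rewrite exprn_ge0// ltW.
rewrite (_ : (\sum_(i <oo) _)%E = G 0 0); first exact: (inverse_moment_fin theta0 alpha0 hD).
rewrite inverse_moment0.
transitivity (\int[P]_w \sum_(i <oo) (q ^+ i * erlang_cdf q i (Y w))%:E)%E; last first.
  by apply: eq_integral => w _; rewrite series_pow_erlang_cdf ?inv_sub_ge0.
rewrite integral_nneseries//.
- apply: eq_eseriesr => i _; rewrite inverse_moment_cdf -ge0_integralZl_EFin//.
  + by move=> w _; rewrite lee_fin.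
  + by apply/measurable_EFinP; apply: mcdf; rewrite gt_eqF.
- move=> i; apply/measurable_EFinP; apply: measurable_funM => //; apply: mcdf; rewrite gt_eqF//.
- by move=> i w _; rewrite lee_fin mulr_ge0.
Qed.

Lemma mean_queueE : mean_queue k P Q D t =
  ((A - c) * fine (G 0 0) + c * fine (\sum_(i <oo) ((W i)%:E * G q i))%E)%:E.
Proof.
have := mean_queue_identity.
have G0fin : G 0 0 \is a fin_num.
  by rewrite ge0_fin_numE ?inverse_moment_ge0// (inverse_moment_fin theta0 alpha0 hD).
have Sfin : (\sum_(i <oo) ((W i)%:E * G q i))%E \is a fin_num.
  rewrite ge0_fin_numE ?series_return_moment_fin//.
  by apply: nneseries_ge0 => i _ _; rewrite mule_ge0 ?inverse_moment_ge0// lee_fin.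
rewrite -(fineK G0fin) -(fineK Sfin) -!EFinM -EFinD /=.
(* All other terms are finite, which rules out an infinite mean and permits the subtraction. *)
case: (mean_queue k P Q D t) => //= r [] h; congr EFin.
by apply: (addIr (c * fine (G 0 0))); rewrite h; ring.
Qed.
End subordinated_queue.

(** * Regrouping by jump counts *)

Section regrouping.
Context {R : realType}.
Variables (k l : nat) (lam : nat -> R) (mu : R).
Hypotheses (k0 : (0 < k)%N) (mu0 : 0 < mu) (lam0 : forall i : 'I_l, 0 <= lam i.+1)
  (Lam0 : 0 < Lam l lam).

Lemma C0_ge0 h n (m : 'I_l -> nat) : 0 <= C0 k lam mu h n m.
Proof.
rewrite /C0 mulr_ge0// divr_ge0// mulr_ge0 ?exprn_ge0 ?mulr_ge0 ?exprn_ge0 ?(ltW mu0) ?(ltW Lam0)//.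
by apply: prodr_ge0 => i _; rewrite divr_ge0 ?exprn_ge0 ?divr_ge0// ltW.
Qed.

(** V is taken at the number of steps minus one: a walk back at 0 after i steps is followed by the
    down-step that completes a first passage of i + 1 steps. *)
Definition gamma_block (V : R^nat) h n : R :=
  \sum_(m : {ffun 'I_l -> 'I_n.+1} | (\sum_(i < l) (m i : nat) == n)%N)
    C0 k lam mu h n (fun i => m i : nat) * V (gamma0 k h n (fun i => m i : nat)).-1.

Lemma gamma_block_ge0 V h n : (forall i, 0 <= V i) -> 0 <= gamma_block V h n.
Proof. by move=> V0; apply: sumr_ge0 => m _; rewrite mulr_ge0 ?C0_ge0. Qed.

Lemma gamma_block0 V n : gamma_block V 0 n = 0.
Proof. by apply: big1 => m _; rewrite /C0 !mul0r. Qed.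

(** For fixed i only pairs with h + n <= i + 1 contribute, so [return_weight0_C0] can be written
    with infinite sums; after the interchange a single i, namely gamma - 1, remains for fixed h, n
    and m. *)
Lemma return_weight_series V : (forall i, 0 <= V i) ->
  (\sum_(i <oo) (return_weight k l lam (k%:R * mu) i 0 * V i)%:E =
   \sum_(h <oo) \sum_(n <oo) (gamma_block V h n)%:E)%E.
Proof.
move=> V0.
pose f i h n (m : {ffun 'I_l -> 'I_n.+1}) : R := C0 k lam mu h n (fun i => m i : nat) *
  (gamma0 k h n (fun i => m i : nat) == i.+1)%N%:R.
pose b i h n : R := (\sum_(m : {ffun 'I_l -> 'I_n.+1} | (\sum_(i < l) (m i : nat) == n)%N) f i h n m) * V i.
have f0 i h n m : 0 <= f i h n m by rewrite mulr_ge0 ?C0_ge0.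
have b0 i h n : (0 <= (b i h n)%:E)%E by rewrite lee_fin mulr_ge0// sumr_ge0.
have big i h n : (i.+1 < h + n)%N -> (b i h n)%:E = 0%E.
  move=> ihn; rewrite /b big1 ?mul0r// => m _; rewrite /f.
  by rewrite gtn_eqF ?mulr0// /gamma0; apply: (leq_trans ihn); exact: leq_addr.
transitivity (\sum_(i <oo) \sum_(h <oo) \sum_(n <oo) (b i h n)%:E)%E.
  apply: eq_eseriesr => i _.
  rewrite (@nneseries_finite _ _ i.+2); last first.
    by move=> h ih; apply: eseries0 => n _ _; apply: big; lia.
  have E h : (\sum_(n <oo) (b i h n)%:E = (\sum_(n < i.+2) b i h n)%:E)%E.
    rewrite (@nneseries_finite _ _ i.+2) ?sumEFin// => n iN; apply: big; lia.
  rewrite (eq_bigr (fun h : 'I_i.+2 => (\sum_(n < i.+2) b i h n)%:E)) ?sumEFin//; congr EFin.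
  rewrite (@return_weight0_C0 _ k l lam mu k0 mu0 Lam0 i i.+2)// mulr_suml.
  (* The term h = 0, absent from the finite formula, vanishes through the factor h of [C0]. *)
  rewrite -(big_mkord predT (fun h => \sum_(n < i.+2) b i h n)) [RHS]big_ltn//.
  rewrite [X in X + _]big1 ?add0r; last first.
    by move=> n _; rewrite /b big1 ?mul0r// => m _; rewrite /f /C0 !mul0r.
  by apply: eq_bigr => h _; rewrite mulr_suml.
rewrite [LHS]nneseries_interchange; last by move=> i h; apply: nneseries_ge0 => n _ _; exact: b0.
apply: eq_eseriesr => h _; rewrite [LHS]nneseries_interchange; last by move=> i n; exact: b0.
apply: eq_eseriesr => n _.
have [->|h0] := posnP h.
  rewrite gamma_block0 eseries0// => i _ _.
  by rewrite /b big1 ?mul0r// => m _; rewrite /f /C0 !mul0r.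
transitivity (\sum_(i <oo) \sum_(m : {ffun 'I_l -> 'I_n.+1} | (\sum_(i < l) (m i : nat) == n)%N)
   (f i h n m * V i)%:E)%E.
  by apply: eq_eseriesr => i _; rewrite /b mulr_suml sumEFin.
rewrite nneseries_sum; last by move=> m i _; rewrite lee_fin mulr_ge0.
rewrite /gamma_block -sumEFin; apply: eq_bigr => m _.
set g := gamma0 _ _ _ _.
have g1 : g = g.-1.+1 by rewrite prednK// /g /gamma0; lia.
rewrite -(nneseries_pick g.-1 (fun i => C0 k lam mu h n (fun i => m i : nat) * V i)).
apply: eq_eseriesr => i _; congr EFin; rewrite /f -/g [in LHS]g1 eqSS; ring.
Qed.

(** Finiteness of the double sum makes both limits genuine; the vanishing row h = 0 reconciles the
    range from 1 with the series from 0. *)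
Lemma iterated_limn (B : nat -> nat -> R) : (forall h n, 0 <= B h n) -> (forall n, B 0%N n = 0) ->
  (\sum_(h <oo) \sum_(n <oo) (B h n)%:E < +oo)%E ->
  limn (fun H => \sum_(1 <= h < H) limn (fun N => \sum_(n < N) B h n)) =
  fine (\sum_(h <oo) \sum_(n <oo) (B h n)%:E)%E.
Proof.
move=> B0 B00 fin.
have s0 h : (0 <= \sum_(n <oo) (B h n)%:E)%E by apply: nneseries_ge0 => n _ _; rewrite lee_fin.
have sfin h : (\sum_(n <oo) (B h n)%:E < +oo)%E.
  apply: le_lt_trans fin; rewrite (@nneseries_split _ (fun h => \sum_(n <oo) (B h n)%:E)%E 0 h.+1)// add0n big_nat_recr//=.
  rewrite addeAC leeDr// adde_ge0 ?sume_ge0//.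
  exact: nneseries_ge0.
have sE h : limn (fun N => \sum_(n < N) B h n) = fine (\sum_(n <oo) (B h n)%:E)%E.
  apply/cvg_lim => //; rewrite (_ : (fun N => _) = series (B h)).
    exact: cvg_series_nneseries.
  by apply/funext => N; rewrite /series /= big_mkord.
have sEE h : (fine (\sum_(n <oo) (B h n)%:E))%:E = (\sum_(n <oo) (B h n)%:E)%E.
  by rewrite fineK// ge0_fin_numE.
rewrite -(eq_eseriesr (fun h _ => sEE h)).
apply/cvg_lim => //.
rewrite (_ : (fun H => _) = series (fun h => fine (\sum_(n <oo) (B h n)%:E)%E)).
  apply: cvg_series_nneseries; first by move=> h; rewrite fine_ge0.
  by rewrite (eq_eseriesr (fun h _ => sEE h)).
apply/funext => -[|H]; first by rewrite /series /= !big_geq.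
rewrite /series /= [RHS]big_ltn// eseries0 ?add0r; last by move=> n _ _; rewrite B00.
exact: eq_bigr.
Qed.
End regrouping.

Theorem theorem3p5 (R : realType) (k l : nat) (mu : R) (lam : nat -> R)
    (theta alpha : R)
    (hk : (1 <= k)%N) (hl : (1 <= l)%N) (hmu : 0 < mu)
    (hlam : forall m : nat, (1 <= m <= l)%N -> 0 < lam m)
    (htheta : 0 < theta) (halpha0 : 0 < alpha) (halpha1 : alpha < 1)
    (d : measure_display) (T : measurableType d) (P : probability T R)
    (Q : R -> T -> state) (D : R -> T -> R)
    (hQ : is_erlang_chain k l lam mu P Q)
    (hD : is_tempered_subordinator theta alpha P D)
    (hind : indep_processes P Q D)
    (t : R) (ht : 0 <= t) :
  mean_queue k P Q D t = (M_formula k l lam mu theta alpha t)%:E.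
Proof.
have lam0 (i : 'I_l) : 0 <= lam i.+1 by rewrite ltW// hlam/=.
have Lam0 : 0 < Lam l lam.
  rewrite /Lam big_ltn// ltr_pwDl ?hlam//.
  rewrite big_nat_cond; apply: sumr_ge0 => m /andP[/andP[m1 ml] _].
  by rewrite ltW// hlam// (ltnW m1).
have q0 : 0 <= Lam l lam + k%:R * mu by rewrite addr_ge0 ?(ltW Lam0)// mulr_ge0// ltW.
rewrite (mean_queueE hk hmu lam0 htheta halpha0 hQ hD hind ht); congr EFin.
rewrite /M_formula; congr (_ + _).
  (* The linear term is the moment with nu = 0 and g = 0, for which beta becomes theta^alpha and
     [ML3] has first parameter 1. *)
  have M := @mittag_leffler_moment R theta alpha d T P D htheta halpha0 hD 0 0 (lexx _) t ht.
  rewrite -[RHS]mulrA; apply: (congr2 *%R).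
    rewrite mulrBr; apply: (congr2 (fun x y => x - y)) => //.
    rewrite [in RHS]mulr_sumr; congr (_ * _); by apply: eq_bigr => i _; field; rewrite gt_eqF.
  rewrite -M; apply: (congr1 (fun S : R^nat => expR (- theta * t) * limn S)).
  apply/funext => N; apply: eq_bigr => j _.
  rewrite /ML2 subr0.
  have -> : alpha * 1%:R + 1 + j%:R = alpha + j%:R + 1 :> R by ring.
  by have -> : alpha + j%:R + 1 - 1 = j%:R + alpha :> R by ring.
congr (_ * _); pose V i := fine (inverse_moment P D (Lam l lam + k%:R * mu) i t).
have V0 i : 0 <= V i by rewrite fine_ge0// inverse_moment_ge0.
have VE i : (V i)%:E = inverse_moment P D (Lam l lam + k%:R * mu) i t.
  by rewrite fineK// ge0_fin_numE ?inverse_moment_ge0// (inverse_moment_fin htheta halpha0 hD).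
have sE : (\sum_(i <oo) ((return_weight k l lam (k%:R * mu) i 0)%:E *
    inverse_moment P D (Lam l lam + k%:R * mu) i t) =
  \sum_(h <oo) \sum_(n <oo) (gamma_block k l lam mu V h n)%:E)%E.
  rewrite -return_weight_series//; apply: eq_eseriesr => i _.
  by rewrite EFinM VE.
have := series_return_moment_fin hk hmu lam0 htheta halpha0 hD ht; rewrite sE => fin.
rewrite -(iterated_limn _ _ fin); last 2 first.
- by move=> h n; apply: gamma_block_ge0.
- by move=> n; exact: gamma_block0.
apply: (congr1 (fun S : R^nat => limn S)); apply/funext => H; apply: eq_big_nat => h /andP[h1 _].
apply: (congr1 (fun S : R^nat => limn S)); apply/funext => N; apply: eq_bigr => n _.
apply: eq_bigr => m _; cbv zeta; rewrite -[RHS]mulrA; congr (_ * _).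
set g := gamma0 _ _ _ _.
(* As h >= 1, gamma is positive and the moment of index gamma - 1 is the one that corresponds to
   it. *)
have g1 : g = g.-1.+1 by rewrite prednK// /g /gamma0; lia.
rewrite /V -(mittag_leffler_moment htheta halpha0 hD g.-1 q0 ht) -g1.
by rewrite opprD addrA.
Qed.
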